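(* Let $G$ be a complex reductive algebraic group. A completely reducible subgroup $H\subset G$ is irreducible if and only if $\dim C_G(H)=\dim C(G)$.
   Context: Reductive groups are connected complex affine algebraic groups whose radical is an algebraic torus. $C_G(H)$ is the centralizer of $H$ in $G$ and $C(G)$ the center of $G$. A subgroup $H\subset G$ (closed or not) is irreducible if it is not contained in any proper parabolic subgroup of $G$. It is completely reducible if for every parabolic subgroup $P\subset G$ containing $H$ there is a Levi subgroup of $P$ containing $H$, where a Levi subgroup of $P$ is a connected subgroup $L\subset P$ such that $P$ is the semi-direct product of $L$ and the unipotent radical of $P$. *)

(* Defs.v *)
(* The complex numbers are [R[i]] for [R : realType]. *)
From HB Require Import structures.
From mathcomp Require Import all_boot all_order all_algebra.
From mathcomp Require Import boolp classical_sets reals constructive_ereal ereal.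
From mathcomp Require Import complex.
(* Not imported: the notations of mpoly clash with those of mathcomp-analysis. *)
From mathcomp Require mpoly.

Set Implicit Arguments.
Unset Strict Implicit.
Unset Printing Implicit Defensive.

Import GRing.Theory Num.Theory.
Local Open Scope ring_scope.
Local Open Scope complex_scope.
Local Open Scope classical_set_scope.

Definition polynomial (C : comNzRingType) (n : nat) := mpoly.mpoly n C.

Definition eval_at (C : comNzRingType) (n : nat) (p : polynomial C n)
  (x : 'rV[C]_n) : C := mpoly.meval (x 0) p.

Definition zero_locus (C : comNzRingType) (n : nat) (S : set (polynomial C n)) :
  set 'rV[C]_n := [set x | forall p, S p -> eval_at p x = 0].

(* When [e] identifies [T] with a closed subset of affine space, these are
   exactly the regular functions on [T]. *)
Definition regular_fun (C : comNzRingType) (n : nat) (T : Type)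
  (e : T -> 'rV[C]_n) (f : T -> C) :=
  exists p : polynomial C n, forall t, f t = eval_at p (e t).

(* A group structure on an affine variety; [coord] is a closed embedding of the
   variety into affine space. *)
Record affine_group (R : realType) := AffineGroup {
  group_of :> groupType;
  ambient : nat;
  coord : group_of -> 'rV[R[i]]_ambient;
  coord_inj : injective coord;
  coord_closed : exists S, range coord = zero_locus S;
  mul_regular : forall j, regular_fun
    (fun xy : group_of * group_of => row_mx (coord xy.1) (coord xy.2))
    (fun xy => coord (xy.1 * xy.2)%g 0 j);
  inv_regular : forall j, regular_fun coord (fun x => coord x^-1%g 0 j)
}.

Section AffineGroupTheory.
Context {R : realType} {G : affine_group R}.
Implicit Types (A B F H K L N P T U X : set G).
Local Notation C := R[i].

Definition zclosed X :=
  exists S, X = [set g | zero_locus S (coord g)].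

(* Connectedness for the topology induced on [X]. *)
Definition zconnected X := forall A B, zclosed A -> zclosed B ->
  X `<=` A `|` B -> X `&` A `&` B = set0 -> X `<=` A \/ X `<=` B.

Definition zirreducible X := X !=set0 /\
  (forall A B, zclosed A -> zclosed B -> X `<=` A `|` B ->
     X `<=` A \/ X `<=` B).

(* Krull dimension of a closed set [X], as an extended real; -oo if [X] is
   empty. *)
Definition krull_dim X : \bar R :=
  ereal_sup [set (n%:R)%:E | n in [set n : nat |
    exists Z : nat -> set G,
      (forall i, (i <= n)%N -> [/\ zclosed (Z i), zirreducible (Z i) & Z i `<=` X])
      /\ (forall i, (i < n)%N -> Z i `<` Z i.+1)]].

Definition subgroup H :=
  H 1%g /\ forall x y, H x -> H y -> H (x / y)%g.

Definition centralizer H : set G := [set g | forall h, H h -> commute g h].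

Definition center : set G := centralizer setT.

Definition normal_in K N := [/\ subgroup N, N `<=` K &
  forall n k, N n -> K k -> N (n ^ k)%g].

Definition derived_subgroup H : set G :=
  [set x | forall K, subgroup K ->
     (forall a b, H a -> H b -> K [~ a, b]%g) -> K x].

Definition solvable_subgroup H :=
  subgroup H /\ exists n, iter n derived_subgroup H `<=` [set 1%g].

Definition closed_connected_subgroup H :=
  [/\ subgroup H, zclosed H & zconnected H].

Definition rational_representation n (rho : G -> 'M[C]_n) :=
  [/\ rho 1%g = 1%:M,
      forall x y, rho (x * y)%g = rho x *m rho y &
      forall i j, regular_fun (@coord R G) (fun g => rho g i j)].

Definition unipotent (g : G) :=
  forall n (rho : G -> 'M[C]_n), rational_representation rho ->
    exists k, (rho g - 1%:M) ^+ k = 0.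

Definition is_radical K N :=
  let candidate N := [/\ normal_in K N, closed_connected_subgroup N &
                         solvable_subgroup N] in
  candidate N /\ forall N', candidate N' -> N' `<=` N.

Definition is_unipotent_radical K U :=
  let candidate U := [/\ normal_in K U, closed_connected_subgroup U &
                         forall u, U u -> unipotent u] in
  candidate U /\ forall U', candidate U' -> U' `<=` U.

(* [T] is isomorphic, as an algebraic group, to the r-th power of the
   multiplicative group.  The regular functions on the latter are the Laurent
   polynomials, i.e. the polynomials in the coordinates and their inverses. *)
Definition torus T := subgroup T /\ zclosed T /\
  exists (r : nat) (f : G -> 'rV[C]_r),
    let f' g := map_mx (fun z => z^-1) (f g) in
    [/\ forall j, exists p, forall t, T t -> f t 0 j = eval_at p (coord t),
        forall s t, T s -> T t -> forall j, f (s * t)%g 0 j = f s 0 j * f t 0 j,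
        forall t, T t -> forall j, f t 0 j != 0,
        forall z : 'rV[C]_r, (forall j, z 0 j != 0) -> exists2 t, T t & f t = z &
        forall i, exists q, forall t, T t ->
          coord t 0 i = eval_at q (row_mx (f t) (f' t))].

Definition borel_subgroup B :=
  let candidate B := closed_connected_subgroup B /\ solvable_subgroup B in
  candidate B /\ forall B', candidate B' -> B `<=` B' -> B' = B.

Definition parabolic_subgroup P := [/\ subgroup P, zclosed P &
  exists2 B, borel_subgroup B & B `<=` P].

(* In characteristic 0 an abstract semidirect product of closed subgroups is one
   of algebraic groups: a bijective morphism of algebraic groups is an
   isomorphism. *)
Definition levi_subgroup P L :=
  [/\ closed_connected_subgroup L, L `<=` P &
      exists U, [/\ is_unipotent_radical P U,
        L `&` U = [set 1%g] &
        P = [set (l * u)%g | l in L & u in U]]].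

Definition irreducible_subgroup H :=
  subgroup H /\ forall P, parabolic_subgroup P -> H `<=` P -> P = setT.

Definition completely_reducible H :=
  subgroup H /\ forall P, parabolic_subgroup P -> H `<=` P ->
    exists2 L, levi_subgroup P L & H `<=` L.

End AffineGroupTheory.

Arguments center {R} G.

Definition reductive (R : realType) (G : affine_group R) :=
  zconnected [set: G] /\ exists2 T : set G, is_radical [set: G] T & torus T.

(* Main.v *)
(* Fix a faithful representation rho of G, and let g be the Lie algebra of G. The
   trace form of rho is nondegenerate on g: its radical consists of nilpotent
   elements, which generate a closed connected unipotent normal subgroup of G,
   hence a unipotent subgroup of the radical, a torus. In characteristic 0 a
   connected subgroup lies in any algebra of matrices containing its Lie algebra,
   so the inclusions below may be tested on Lie algebras.

   If x in g commutes with H, the filtration of the representation space by the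
   real (or imaginary) parts of the eigenvalues of x is stable under H. Its
   stabilizer is parabolic: its Lie algebra contains that of a Borel subgroup,
   because a Borel subalgebra containing the weights >= 0 of the semisimple part
   of x has no negative weight, by nondegeneracy of the trace form and Lie-Kolchin.
   If x is nilpotent, one uses instead the filtration of the neutral element h of
   an sl2-triple (x, h, y); an element of H fixing x moves h by an element of
   ker(ad x) lying in im(ad x), where h has positive weights by Jacobson's lemma,
   so it preserves that filtration. Hence if H is irreducible, the identity
   component of C_G(H) is central.

   Conversely let H lie in a Levi subgroup L of a proper parabolic subgroup P. The
   orthogonal u of Lie P is a nonzero ideal of nilpotent elements, contained in
   Lie B for every Borel subgroup B of P. The trace of the adjoint action on u is
   represented on Lie L by some z in Lie L fixed by L. If z were central, the
   determinant of P on u would be trivial on L and on the unipotent radical, hence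
   on P; but for a nonzero e in u fixed up to scalars by B and an sl2-triple
   (e, h, y), the trace of ad h on u is not 0. So z belongs to the Lie algebra of
   C_G(H) but not to that of C(G), and the dimensions differ. *)

From HB Require Import structures.
From mathcomp Require Import all_boot all_order all_algebra.
From mathcomp Require Import boolp classical_sets reals.
From mathcomp.analysis Require exp.
From mathcomp Require Import complex mpoly ring perm.
From mathcomp Require constructive_ereal ereal.
Require Import Defs.

Set Implicit Arguments.
Unset Strict Implicit.
Unset Printing Implicit Defensive.

Import Order.TTheory GRing.Theory Num.Theory.
Local Open Scope ring_scope.
Local Open Scope complex_scope.
Local Open Scope classical_set_scope.

(** * Noetherian rings *)

(** The Lie algebra of a closed subgroup is the tangent space at [1] of the ideal vanishing on its
    image in a faithful representation. It determines a connected group for two reasons: a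
    polynomial whose derivatives along words of invariant fields all vanish at [1] lies, by an Euler
    field argument, in every power of the maximal ideal modulo the ideal of the group; Krull's
    intersection theorem then puts it in that ideal. The way back needs elements of the group. A
    nilpotent element gives a polynomial curve. A semisimple one is transformed through its
    eigenvalues: additive maps of [C] give elements of the same Lie algebra, homomorphisms from
    addition to multiplication give elements of the group. Complex conjugation is such an additive
    map, and the trace of [x] times its conjugate replica is the sum of the squared moduli of the
    eigenvalues: hence the nilpotency in the radical of the trace form. Real parts are another such
    map, and order the eigenvalues. Dimensions are compared by chains alone: a longest chain of the
    smaller group, translated into the identity component, is lengthened by one in the larger. *)

Definition noetherian (A : comNzRingType) := forall p : nat -> A,
  exists N (c : nat -> A), p N = \sum_(i < N) c i * p i.

(** Each choice sees the finite list of the earlier ones, as a greedy selection outside the ideal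
    generated so far requires. *)
Lemma dependent_choice (T : Type) (t0 : T) (P : seq T -> T -> Prop) :
  (forall l, exists t, P l t) ->
  exists f : nat -> T, forall n, P (mkseq f n) (f n).
Proof.
move=> /choice [g gP].
pose s := fix s n := if n is n'.+1 then rcons (s n') (g (s n')) else [::].
exists (fun n => g (s n)) => n.
suff -> : mkseq (fun n => g (s n)) n = s n by apply: gP.
by elim: n => //= n IH; rewrite mkseqS IH.
Qed.

Section Hilbert.
Variable A : comNzRingType.

Definition in_ideal (l : seq A) (x : A) :=
  exists c : nat -> A, x = \sum_(i < size l) c i * l`_i.

Lemma in_ideal_sum l (n : nat) (c : nat -> A) (f : nat -> A) :
  (forall i, (i < n)%N -> in_ideal l (f i)) ->
  in_ideal l (\sum_(i < n) c i * f i).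
Proof.
elim: n => [|n IH] H.
  by exists (fun=> 0); rewrite big_ord0 big1 // => i _; rewrite mul0r.
have [|d dE] := IH; first by move=> i ?; apply: H; apply: ltnW.
have [e eE] := H n (ltnSn n).
exists (fun i => d i + c n * e i); rewrite big_ord_recr /= dE eE mulr_sumr.
by rewrite -big_split; apply: eq_bigr => i _; rewrite mulrDl mulrA.
Qed.

Lemma in_ideal_take f n i : (i < n)%N -> in_ideal (mkseq f n) (f i).
Proof.
move=> ltin; exists (fun j => (j == i)%:R); rewrite size_mkseq.
rewrite (bigD1 (Ordinal ltin)) //= eqxx mul1r nth_mkseq // big1 ?addr0 //.
by move=> j /negPf; rewrite -val_eqE /= => ->; rewrite mul0r.
Qed.

Lemma in_idealB l x y : in_ideal l x -> in_ideal l y -> in_ideal l (x - y).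
Proof.
move=> [c ->] [d ->]; exists (fun i => c i - d i).
by rewrite -sumrB; apply: eq_bigr => i _; rewrite mulrBl.
Qed.

Lemma noetherianP : noetherian A <->
  forall p : nat -> A, exists N, in_ideal (mkseq p N) (p N).
Proof.
by split=> H p; have [N [c cE]] := H p; exists N; exists c;
  move: cE; rewrite size_mkseq => ->; apply: eq_bigr => i _; rewrite nth_mkseq.
Qed.

End Hilbert.

(** Hilbert's basis theorem. In the ideal [I] of all the [p n], pick greedily [f n] of least degree
    outside the ideal of its predecessors. When a leading coefficient depends on the earlier ones,
    subtracting the matching shifted combination leaves an element of smaller degree still outside,
    a contradiction. *)
Lemma noetherian_poly (A : comNzRingType) : noetherian A -> noetherian {poly A}.
Proof.
move=> /noetherianP nA; apply/noetherianP => p; apply: contrapT => np.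
pose I x := exists N, in_ideal (mkseq p N) x.
have mono M N x : (M <= N)%N -> in_ideal (mkseq p M) x -> in_ideal (mkseq p N) x.
  move=> leMN [c ->]; rewrite size_mkseq; apply: in_ideal_sum => i ltiM.
  by rewrite nth_mkseq //; apply/in_ideal_take/(leq_trans ltiM).
have Isum n (c : nat -> {poly A}) f :
    (forall i, (i < n)%N -> I (f i)) -> I (\sum_(i < n) c i * f i).
  move=> If; have /choice [N NP] : forall i, exists N, (i < n)%N ->
      in_ideal (mkseq p N) (f i).
    move=> i; case: (ltnP i n) => [/If [N ?]|]; first by exists N.
    by exists 0.
  exists (\max_(i < n) N i); apply: in_ideal_sum => i ltin.
  by apply: mono (NP i ltin); apply: (leq_bigmax (Ordinal ltin)).
have step l : exists f, (forall i, (i < size l)%N -> I l`_i) ->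
    [/\ I f, ~ in_ideal l f &
      forall g, I g -> ~ in_ideal l g -> (size f <= size g)%N].
  have [lI|] := pselect (forall i, (i < size l)%N -> I l`_i); last by exists 0.
  have [f0 [If0 nf0]] : exists f, I f /\ ~ in_ideal l f.
    apply: contrapT => nf.
    have /choice [N NP] : forall i, exists N, (i < size l)%N ->
        in_ideal (mkseq p N) l`_i.
      move=> i; case: (ltnP i (size l)) => [/lI [N ?]|]; first by exists N.
      by exists 0.
    (* The entries of [l] involve only the terms of [p] before [M], so [p M] in the ideal of [l]
       would contradict [np]. *)
    pose M := \max_(i < size l) N i; apply: np; exists M.
    have [] : in_ideal l (p M).
      apply: contrapT => npM; apply: nf; exists (p M); split=> //.
      by exists M.+1; apply: in_ideal_take.
    move=> c ->; apply: in_ideal_sum => i ltil; apply: mono (NP i ltil).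
    by apply: (leq_bigmax (Ordinal ltil)).
  pose Q n := `[< exists f, [/\ I f, ~ in_ideal l f & size f = n] >].
  have exQ : exists n, Q n by exists (size f0); apply/asboolP; exists f0.
  case: (ex_minnP exQ) => m /asboolP [f [If nf sf]] mmin.
  exists f => _; split=> // g Ig ng; rewrite sf; apply: mmin.
  by apply/asboolP; exists g.
have [f fP] := dependent_choice 0 step.
have If n : I (f n).
  elim/ltn_ind: n => n IH; have [] // := fP n.
  by move=> i; rewrite size_mkseq => ltin; rewrite nth_mkseq //; apply: IH.
have {}fP n : ~ in_ideal (mkseq f n) (f n) /\
    forall g, I g -> ~ in_ideal (mkseq f n) g -> (size (f n) <= size g)%N.
  have [] // := fP n.
  by move=> i; rewrite size_mkseq => ltin; rewrite nth_mkseq //; apply: If.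
have f0 n : f n != 0.
  apply/eqP => fn0; have [+ _] := fP n; apply; rewrite fn0; exists (fun=> 0).
  by rewrite big1 // => i _; rewrite mul0r.
have fmono i n : (i < n)%N -> (size (f i) <= size (f n))%N.
  move=> ltin; have [_] := fP i; apply=> // -[c cE]; have [+ _] := fP n; apply.
  rewrite cE size_mkseq; apply: in_ideal_sum => j ltji; rewrite nth_mkseq //.
  by apply/in_ideal_take/(ltn_trans ltji).
have [N [c cE]] := nA (fun n => lead_coef (f n)).
move: cE; rewrite size_mkseq => cE.
pose h := \sum_(i < N) (c i *: 'X^(size (f N) - size (f i))) * f i.
have hI : in_ideal (mkseq f N) h.
  apply: (@in_ideal_sum _ _ N (fun i => c i *: 'X^(size (f N) - size (f i)))).
  by move=> i; apply: in_ideal_take.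
pose g := f N - h.
have Ig : I g.
  have Ih : I h by apply: (Isum N (fun i => c i *: 'X^(size (f N) - size (f i)))).
  have := Isum 2%N (fun i => if i is 0 then 1 else -1)
    (fun i => if i is 0 then f N else h).
  by rewrite !big_ord_recr big_ord0 /= add0r mul1r mulN1r; apply=> -[|i].
have [nfN fmin] := fP N.
have ng : ~ in_ideal (mkseq f N) g.
  move=> gI; apply: nfN; have -> : f N = g - (0 - h) by rewrite sub0r opprK subrK.
  apply: in_idealB => //; apply: in_idealB => //.
  by exists (fun=> 0); rewrite big1 // => i _; rewrite mul0r.
have := fmin g Ig ng; apply/negP; rewrite -ltnNge.
have sizeS n : exists m, size (f n) = m.+1.
  by exists (size (f n)).-1; rewrite prednK // size_poly_gt0.
have [m sN] := sizeS N.
rewrite sN ltnS; apply/leq_sizeP => j lej; rewrite coefB coef_sum.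
have cf (i : 'I_N) : (c i *: 'X^(m.+1 - size (f i)) * f i)`_j =
    if j == m then c i * lead_coef (f i) else 0.
  rewrite -scalerAl coefZ coefXnM.
  have := fmono i N (ltn_ord i); have [k si] := sizeS i; rewrite sN si subSS ltnS.
  move=> lekm; rewrite ltnNge (leq_trans (leq_subr _ _) lej) /=.
  case: eqP => [->|/eqP nj]; first by rewrite subKn // lead_coefE si.
  rewrite nth_default ?mulr0 // si.
  have : (m < j)%N by rewrite ltn_neqAle eq_sym nj.
  by move=> ltj; rewrite ltn_subRL subnK.
rewrite /h sN in Ig *; rewrite (eq_bigr _ (fun i _ => cf i)); case: eqP => [->|/eqP nj].
  have -> : (f N)`_m = lead_coef (f N) by rewrite lead_coefE sN.
  rewrite cE; apply/eqP; rewrite subr_eq0; apply/eqP; apply: eq_bigr => i _.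
  by rewrite nth_mkseq.
rewrite big1 // subr0 nth_default // sN.
by rewrite ltn_neqAle eq_sym nj.
Qed.

Lemma mpoly_alg_ind (R : comNzRingType) n (P : {mpoly R[n]} -> Prop) :
  (forall c, P c%:MP) -> (forall i, P 'X_i) ->
  (forall p q, P p -> P q -> P (p + q)) -> (forall p q, P p -> P q -> P (p * q)) ->
  forall p, P p.
Proof.
move=> PC PX PD PM p.
have P1 m : P 'X_[m].
  rewrite mpolyXE_id; elim/big_ind: _ => // [|i _]; first by rewrite -mpolyC1.
  elim: (m i) => [|k IH]; first by rewrite expr0 -mpolyC1.
  by rewrite exprS; apply: PM.
elim/mpolyind: p => [|c m p _ _ Pp]; first by rewrite -mpolyC0.
by apply: PD => //; rewrite -mul_mpolyC; apply: PM.
Qed.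

Lemma noetherian_retract (A B : comNzRingType) (f : {rmorphism A -> B}) (g : B -> A) :
  cancel g f -> noetherian A -> noetherian B.
Proof.
move=> gK nA p; have [N [c cE]] := nA (g \o p).
exists N, (f \o c); rewrite -[LHS]gK [g _]cE rmorph_sum.
by apply: eq_bigr => i _; rewrite rmorphM /= gK.
Qed.

(** The noetherian property passes along this left inverse, which also gives the injectivity of
    [muni] in the dimension bound. *)
Lemma muni_retract (A : comNzRingType) n :
  exists phi : {rmorphism {poly {mpoly A[n]}} -> {mpoly A[n.+1]}}, cancel (@muni n A) phi.
Proof.
have [phi [phiC phiX]] :
    exists phi : {rmorphism {poly {mpoly A[n]}} -> {mpoly A[n.+1]}},
      (forall p, phi p%:P = mwiden p) /\ phi 'X = 'X_ord_max.
  exists (horner_eval 'X_ord_max \o map_poly (@mwiden n A)); split=> [p|] /=.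
    by rewrite map_polyC /= /horner_eval hornerC.
  by rewrite map_polyX /= /horner_eval hornerX.
have phiD : {morph phi : x y / x + y} := rmorphD phi.
have phiM : {morph phi : x y / x * y} := rmorphM phi.
exists phi; elim/mpoly_alg_ind => [c|i|p q ep eq|p q ep eq].
- by rewrite muniC phiC mwidenC.
- rewrite /muni mmapX mmap1U /=; case: splitP => j ij.
    rewrite phiC mwidenX mnmwiden1.
    by congr 'X_[U_(_)]; apply: val_inj.
  rewrite phiX; congr 'X_[U_(_)].
  apply: val_inj; rewrite /= -[RHS]/(nat_of_ord (cast_ord (esym (addn1 n)) i)).
  by rewrite ij ord1 addn0.
- by rewrite muniD phiD; apply: (f_equal2 +%R ep eq).
- by rewrite muniM phiM; apply: (f_equal2 *%R ep eq).
Qed.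

Lemma noetherian_mpoly (A : comNzRingType) n :
  noetherian A -> noetherian {mpoly A[n]}.
Proof.
move=> nA; elim: n => [|n IH].
  pose C : {rmorphism A -> {mpoly A[0]}} := @mpolyC 0 A.
  apply: (@noetherian_retract _ _ C (meval (fun=> 0))) => //.
  by elim/mpoly_alg_ind => [c|[]//|p q ep eq|p q ep eq];
    rewrite ?mevalC ?rmorphD ?rmorphM /= ?ep ?eq.
have [phi phiK] := muni_retract A n.
by apply: (noetherian_retract phiK); apply: noetherian_poly.
Qed.

Lemma noetherian_field (F : fieldType) : noetherian F.
Proof.
move=> p; have [p0|p0] := eqVneq (p 0%N) 0.
  by exists 0%N, (fun=> 0); rewrite big_ord0.
exists 1%N, (fun=> p 1%N / p 0%N).
by rewrite big_ord_recl big_ord0 addr0 divfK.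
Qed.

(** * Polynomial functions on matrices *)

Section PolyMatrix.
Variables (C : comNzRingType) (n : nat).
Local Notation P := {mpoly C[n * n]}.
Implicit Types (p q : P) (M Y x : 'M[C]_n).

Definition ev p M : C := meval (mxvec M 0) p.
Definition cf i j : P := 'X_(mxvec_index i j).
(** The differential of [p] at [M] in the direction [Y]. *)
Definition dev p M Y : C := \sum_i \sum_j Y i j * ev (mderiv (mxvec_index i j) p) M.
Definition ent Y i j : P := \sum_k Y k j *: cf i k.
(* The left-invariant vector field with value [x] at [1]. *)
Definition D x p : P := \sum_i \sum_j ent x i j * mderiv (mxvec_index i j) p.

Lemma evD p q M : ev (p + q) M = ev p M + ev q M. Proof. exact: mevalD. Qed.
Lemma evB p q M : ev (p - q) M = ev p M - ev q M. Proof. exact: mevalB. Qed.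
Lemma evN p M : ev (- p) M = - ev p M. Proof. exact: mevalN. Qed.
Lemma evM p q M : ev (p * q) M = ev p M * ev q M. Proof. exact: mevalM. Qed.
Lemma evZ c p M : ev (c *: p) M = c * ev p M. Proof. exact: mevalZ. Qed.
Lemma evC c M : ev c%:MP M = c. Proof. exact: mevalC. Qed.
Lemma ev0 M : ev 0 M = 0. Proof. exact: meval0. Qed.
Lemma ev1 M : ev 1 M = 1. Proof. exact: meval1. Qed.
Lemma ev_sum I (r : seq I) (Q : pred I) (F : I -> P) M :
  ev (\sum_(i <- r | Q i) F i) M = \sum_(i <- r | Q i) ev (F i) M.
Proof. exact: (big_morph (fun p => ev p M) (fun p q => evD p q M) (ev0 M)). Qed.
Lemma ev_prod I (r : seq I) (Q : pred I) (F : I -> P) M :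
  ev (\prod_(i <- r | Q i) F i) M = \prod_(i <- r | Q i) ev (F i) M.
Proof. exact: (big_morph (fun p => ev p M) (fun p q => evM p q M) (ev1 M)). Qed.
Lemma ev_cf i j M : ev (cf i j) M = M i j.
Proof. by rewrite /ev mevalXU mxvecE. Qed.
Lemma ev_ent Y i j M : ev (ent Y i j) M = (M *m Y) i j.
Proof. by rewrite ev_sum mxE; apply: eq_bigr => k _; rewrite evZ ev_cf mulrC. Qed.

Lemma mxpoly_ind (Q : P -> Prop) :
  (forall c, Q c%:MP) -> (forall i j, Q (cf i j)) ->
  (forall p q, Q p -> Q q -> Q (p + q)) -> (forall p q, Q p -> Q q -> Q (p * q)) ->
  forall p, Q p.
Proof.
move=> QC QX QD QM; apply: mpoly_alg_ind => // k.
by case/mxvec_indexP: k => i j; apply: QX.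
Qed.

Lemma mderivcf k i j : mderiv k (cf i j) = (k == mxvec_index i j)%:R.
Proof.
rewrite /cf mderivX mnm1E eq_sym; case: eqP => [->|_]; last by rewrite scale0r.
rewrite scale1r; set u := (_ - _)%MM; suff -> : u = 0%MM by rewrite mpolyX0.
by apply/mnmP => l; rewrite mnmBE subnn mnm0E.
Qed.

Lemma mxvec_index_eq (i j k l : 'I_n) :
  (mxvec_index i j == mxvec_index k l) = (i == k) && (j == l).
Proof.
apply/idP/andP => [|[/eqP-> /eqP->] //]; rewrite (can_eq (cast_ordK _)).
by rewrite (can_eq enum_rankK) => /eqP [-> ->].
Qed.

Lemma sum_delta (V : lmodType C) (F : 'I_n -> 'I_n -> V) a b :
  \sum_i \sum_j ((i == a) && (j == b))%:R *: F i j = F a b.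
Proof.
rewrite (bigD1 a) //= (bigD1 b) //= !eqxx scale1r big1 ?addr0.
  rewrite big1 ?addr0 // => i /negPf ia; rewrite big1 // => j _.
  by rewrite ia scale0r.
by move=> j /negPf jb; rewrite jb andbF scale0r.
Qed.

Lemma devE p M x : dev p M (M *m x) = ev (D x p) M.
Proof.
rewrite ev_sum; apply: eq_bigr => i _; rewrite ev_sum; apply: eq_bigr => j _.
by rewrite evM ev_ent.
Qed.

Lemma devDl p q M Y : dev (p + q) M Y = dev p M Y + dev q M Y.
Proof.
rewrite -big_split; apply: eq_bigr => i _; rewrite -big_split; apply: eq_bigr => j _.
by rewrite /= mderivD evD mulrDr.
Qed.

Lemma devM p q M Y : dev (p * q) M Y = dev p M Y * ev q M + ev p M * dev q M Y.
Proof.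
rewrite /dev mulr_suml mulr_sumr -big_split; apply: eq_bigr => i _.
rewrite mulr_suml mulr_sumr -big_split; apply: eq_bigr => j _.
by rewrite /= mderivM evD !evM mulrDr !mulrA; congr (_ + _); rewrite -!mulrA mulrCA.
Qed.

Lemma devC c M Y : dev c%:MP M Y = 0.
Proof. by rewrite /dev !big1 // => i _; rewrite big1 // => j _; rewrite mderivC ev0 mulr0. Qed.

Lemma dev_cf i j M Y : dev (cf i j) M Y = Y i j.
Proof.
rewrite /dev -[RHS](@sum_delta C^o (fun i j => Y i j)); apply: eq_bigr => k _.
apply: eq_bigr => l _; rewrite mderivcf mxvec_index_eq mulrC; congr (_ * _).
by case: (_ && _); rewrite ?ev0 ?ev1.
Qed.

Lemma devZ c p M Y : dev (c *: p) M Y = c * dev p M Y.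
Proof. by rewrite -mul_mpolyC devM devC mul0r add0r evC. Qed.

Lemma devB p q M Y : dev (p - q) M Y = dev p M Y - dev q M Y.
Proof. by rewrite devDl -scaleN1r devZ mulN1r. Qed.

Lemma dev_sum I (r : seq I) (Q : pred I) (F : I -> P) M Y :
  dev (\sum_(i <- r | Q i) F i) M Y = \sum_(i <- r | Q i) dev (F i) M Y.
Proof.
apply: (big_morph (fun p => dev p M Y) (fun p q => devDl p q M Y)).
by rewrite -mpolyC0 devC.
Qed.

Lemma DD x p q : D x (p + q) = D x p + D x q.
Proof.
rewrite -big_split; apply: eq_bigr => i _; rewrite -big_split; apply: eq_bigr => j _.
by rewrite /= mderivD mulrDr.
Qed.

Lemma DM x p q : D x (p * q) = D x p * q + p * D x q.
Proof.
rewrite /D mulr_suml mulr_sumr -big_split; apply: eq_bigr => i _.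
rewrite mulr_suml mulr_sumr -big_split; apply: eq_bigr => j _.
by rewrite /= mderivM mulrDr !mulrA [p * ent x i j]mulrC.
Qed.

Lemma DC x c : D x c%:MP = 0.
Proof. by rewrite /D !big1 // => i _; rewrite big1 // => j _; rewrite mderivC mulr0. Qed.

Lemma D_cf x i j : D x (cf i j) = ent x i j.
Proof.
rewrite -[RHS](sum_delta (fun i j => ent x i j)); apply: eq_bigr => k _.
apply: eq_bigr => l _; rewrite mderivcf mxvec_index_eq.
by case: (_ && _); rewrite ?mulr1 ?mulr0 ?scale1r ?scale0r.
Qed.

Lemma DZ x c p : D x (c *: p) = c *: D x p.
Proof. by rewrite -mul_mpolyC DM DC mul0r add0r mul_mpolyC. Qed.

Lemma D0 x : D x 0 = 0. Proof. by rewrite -[in LHS]mpolyC0 DC. Qed.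

Lemma DB x p q : D x (p - q) = D x p - D x q.
Proof. by rewrite DD -scaleN1r DZ scaleN1r. Qed.

Lemma D_sum x I (r : seq I) (Q : pred I) (F : I -> P) :
  D x (\sum_(i <- r | Q i) F i) = \sum_(i <- r | Q i) D x (F i).
Proof. exact: (big_morph (D x) (DD x) (D0 x)). Qed.

Lemma D_ent x Y i j : D x (ent Y i j) = ent (x *m Y) i j.
Proof.
rewrite D_sum (eq_bigr (fun k => \sum_l (Y k j * x l k) *: cf i l)); last first.
  move=> k _; rewrite DZ D_cf scaler_sumr; apply: eq_bigr => l _.
  by rewrite scalerA.
rewrite exchange_big; apply: eq_bigr => l _; rewrite -scaler_suml mxE.
by congr (_ *: _); apply: eq_bigr => k _; rewrite mulrC.
Qed.

Lemma D_linear p c x y : D (c *: x + y) p = c *: D x p + D y p.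
Proof.
rewrite /D scaler_sumr -big_split; apply: eq_bigr => i _.
rewrite scaler_sumr -big_split; apply: eq_bigr => j _ /=.
rewrite scalerAl -mulrDl; congr (_ * _).
rewrite /ent scaler_sumr -big_split; apply: eq_bigr => k _.
by rewrite !mxE scalerDl scalerA.
Qed.

(** The index [k] is decoded by the matrix unit [vec_mx (delta_mx 0 k)], whose nonzero entry selects
    the polynomial [F i j]. *)
Definition subst p (F : 'I_n -> 'I_n -> P) : P :=
  mmap (@mpolyC _ C) (fun k => let ij := vec_mx (delta_mx 0 k) in
    \sum_i \sum_j (ij i j : C) *: F i j) p.

Definition evm (F : 'I_n -> 'I_n -> P) M := \matrix_(i, j) ev (F i j) M.
Definition devm (F : 'I_n -> 'I_n -> P) M Y := \matrix_(i, j) dev (F i j) M Y.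

Lemma subst_cf F i j : subst (cf i j) F = F i j.
Proof.
rewrite /subst /cf mmapX mmap1U /= -[RHS](sum_delta F); apply: eq_bigr => k _.
apply: eq_bigr => l _; congr (_ *: _).
by rewrite mxE mxE eqxx /= mxvec_index_eq.
Qed.

Lemma substC F c : subst c%:MP F = c%:MP. Proof. exact: mmapC. Qed.
Lemma substD F p q : subst (p + q) F = subst p F + subst q F.
Proof. exact: mmapD. Qed.
Lemma substM F p q : subst (p * q) F = subst p F * subst q F.
Proof. by rewrite /subst rmorphM. Qed.

Lemma ev_subst p F M : ev (subst p F) M = ev p (evm F M).
Proof.
elim/mxpoly_ind: p => [c|i j|p q ep eq|p q ep eq].
- by rewrite substC !evC.
- by rewrite subst_cf ev_cf mxE.
- by rewrite substD !evD ep eq.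
- by rewrite substM !evM ep eq.
Qed.

Lemma dev_subst p F M Y : dev (subst p F) M Y = dev p (evm F M) (devm F M Y).
Proof.
elim/mxpoly_ind: p => [c|i j|p q ep eq|p q ep eq].
- by rewrite substC !devC.
- by rewrite subst_cf dev_cf mxE.
- by rewrite substD !devDl ep eq.
- by rewrite substM !devM ep eq !ev_subst.
Qed.

(** The pullback of [p] to a polynomial curve of matrices: an identity along the curve becomes one
    in [{poly C}], which can be tested at the natural numbers. *)
Definition pathev p (g : 'M[{poly C}]_n) : {poly C} := mmap (@polyC C) (mxvec g 0) p.

Lemma pathev_cf g i j : pathev (cf i j) g = g i j.
Proof. by rewrite /pathev mmapX mmap1U mxvecE. Qed.
Lemma pathevC c g : pathev c%:MP g = c%:P. Proof. exact: mmapC. Qed.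
Lemma pathevD p q g : pathev (p + q) g = pathev p g + pathev q g.
Proof. exact: mmapD. Qed.
Lemma pathevM p q g : pathev (p * q) g = pathev p g * pathev q g.
Proof. by rewrite /pathev rmorphM. Qed.

Definition at_t (t : C) (g : 'M[{poly C}]_n) := map_mx (horner_eval t) g.

Lemma horner_pathev p g t : (pathev p g).[t] = ev p (at_t t g).
Proof.
elim/mxpoly_ind: p => [c|i j|p q ep eq|p q ep eq].
- by rewrite pathevC hornerC evC.
- by rewrite pathev_cf ev_cf mxE.
- by rewrite pathevD hornerD evD ep eq.
- by rewrite pathevM hornerM evM ep eq.
Qed.

End PolyMatrix.

(** * Spectral projections *)

(** All eigenvalues are [0], so the characteristic polynomial is a power of ['X], and the trace is
    up to sign one of its lower coefficients. *)
Lemma nilpotent_trace (C : closedFieldType) n (A : 'M[C]_n.+1) k :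
  A ^+ k = 0 -> \tr A = 0.
Proof.
move=> Ak; have [r rE] := closed_field_poly_normal (char_poly A).
have lc : lead_coef (char_poly A) = 1 by apply/eqP/char_poly_monic.
have r0 z : z \in r -> z = 0.
  move=> zr; have : root (char_poly A) z by rewrite rE lc scale1r root_prod_XsubC.
  rewrite -eigenvalue_root_char => /eigenvalueP [v vA v0].
  have vk j : v *m (A ^+ j) = z ^+ j *: v.
    elim: j => [|j IH]; first by rewrite !expr0 mulmx1 scale1r.
    by rewrite exprSr -[A ^+ j * A]/(_ *m _) mulmxA IH -scalemxAl vA scalerA exprSr.
  have := vk k; rewrite Ak mulmx0 => /esym/eqP.
  by rewrite scaler_eq0 (negPf v0) orbF expf_eq0 => /andP [_ /eqP].
have cX : char_poly A = 'X^(size r).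
  rewrite rE lc scale1r (eq_big_seq (fun=> 'X)).
    by rewrite big_const_seq count_predT iter_mulr_1.
  by move=> z /r0 ->; rewrite subr0.
have sr : size r = n.+1.
  by have := size_char_poly A; rewrite cX size_polyXn => -[].
apply: oppr_inj; rewrite -char_poly_trace // cX coefXn sr oppr0.
by rewrite (_ : (n == n.+1) = false) //; apply/negbTE; rewrite neq_ltn ltnSn.
Qed.

(** In the rank factorization [col_base A *m row_base A], idempotence forces the product in the
    other order to be the identity of size [\rank A]. *)
Lemma idempotent_trace (F : fieldType) n (A : 'M[F]_n) :
  A *m A = A -> \tr A = (\rank A)%:R.
Proof.
move=> AA; have BA : row_base A *m col_base A = 1%:M.
  have e := mulmx_base A.
  have : col_base A *m (row_base A *m col_base A) *m row_base A =
         col_base A *m 1%:M *m row_base A by rewrite mulmx1 mulmxA -mulmxA e AA.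
  move/(row_free_inj (row_base_free A)) => h; apply/trmx_inj.
  have cf : row_free (col_base A)^T by rewrite /row_free mxrank_tr; apply: col_base_full.
  by apply/(row_free_inj cf); rewrite -!trmx_mul h.
by rewrite -{1}[A]mulmx_base mxtrace_mulC BA mxtrace1.
Qed.

Lemma poly_nat_zero (R : numDomainType) (p : {poly R}) :
  (forall k : nat, p.[k%:R] = 0) -> p = 0.
Proof.
move=> p0; apply/eqP/contraT => pn0.
have := max_poly_roots (rs := [seq i%:R | i <- iota 0 (size p)]) pn0.
rewrite size_map size_iota ltnn; apply.
  by apply/allP => _ /mapP [k _ ->]; apply/rootP.
rewrite map_inj_uniq ?iota_uniq // => i j /eqP.
by rewrite eqr_nat => /eqP.
Qed.

Section Spectral.
Variables (C : closedFieldType) (n : nat).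
Implicit Types (x y : 'M[C]_n.+1) (a b : C).

Definition eigs x : seq C := undup (sval (closed_field_poly_normal (char_poly x))).

Lemma eigsP x a : reflect (exists2 v : 'rV_n.+1, v *m x = a *: v & v != 0) (a \in eigs x).
Proof.
rewrite /eigs mem_undup; case: closed_field_poly_normal => r /= rE.
have lc : lead_coef (char_poly x) = 1 by apply/eqP/char_poly_monic.
rewrite -root_prod_XsubC -[X in root X]scale1r -lc -rE -eigenvalue_root_char.
exact: eigenvalueP.
Qed.

(** The exponent is the size of the matrices, which bounds every multiplicity in the characteristic
    polynomial. *)
Definition ppow a : {poly C} := ('X - a%:P) ^+ n.+1.

Lemma coprime_ppow a b : a != b -> coprimep (ppow a) (ppow b).
Proof. by move=> ab; apply/coprimep_expl/coprimep_expr; rewrite coprimep_XsubC root_XsubC eq_sym. Qed.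

Lemma horner_ppow x : horner_mx x (\prod_(a <- eigs x) ppow a) = 0.
Proof.
apply/eqP; rewrite -dvd_mxminpoly; apply: (dvdp_trans (mxminpoly_dvd_char x)).
rewrite /eigs; case: closed_field_poly_normal => r /= rE.
have lc : lead_coef (char_poly x) = 1 by apply/eqP/char_poly_monic.
have sr : size r = n.+1.
  by have := size_char_poly x; rewrite rE lc scale1r size_prod_XsubC => -[].
rewrite rE lc scale1r -(big_undup_iterop_count _ r).
apply: (big_ind2 (fun p q : {poly C} => p %| q)) => [|p p' q q' pp' qq'|a _].
- exact: dvdpp.
- exact: dvdp_mul.
rewrite Monoid.iteropE iter_mulr_1.
by apply: dvdp_exp2l; rewrite -sr count_size.
Qed.

Lemma dvdp_prod_coprime (s : seq C) (p : {poly C}) : uniq s ->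
  (forall a, a \in s -> ppow a %| p) -> \prod_(a <- s) ppow a %| p.
Proof.
elim: s => [|a s IH] /=; first by rewrite big_nil dvd1p.
move=> /andP [nas us] H; rewrite big_cons Gauss_dvdp ?H ?mem_head ?IH //.
  by move=> b bs; apply: H; rewrite in_cons bs orbT.
elim: s nas {IH us H} => [|b s IH]; first by rewrite big_nil coprimep1.
by rewrite in_cons negb_or => /andP [ab ?]; rewrite big_cons coprimepMr coprime_ppow ?IH.
Qed.

Lemma proj_poly_exists x a : exists e : {poly C},
  ppow a %| e - 1 /\ forall b, b \in eigs x -> b != a -> ppow b %| e.
Proof.
pose s := filter (predC1 a) (eigs x); pose q := \prod_(b <- s) ppow b.
have us : uniq s by rewrite filter_uniq ?undup_uniq.
have : coprimep (ppow a) q.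
  rewrite /q big_filter; elim/big_rec: _ => [|b p /= ba cp]; first exact: coprimep1.
  by rewrite coprimepMr cp coprime_ppow // eq_sym.
move=> /Bezout_eq1_coprimepP [[u v] /= uv]; exists (v * q); split.
  by rewrite -uv opprD addrCA subrr addr0 -mulNr dvdp_mull.
move=> b bx ba; apply: dvdp_mull; rewrite /q (bigD1_seq b) //=; last by rewrite mem_filter /= ba bx.
exact: dvdp_mulr.
Qed.


(** The Chinese remainder polynomial of the generalized eigenspace at [a]. It is chosen from a set
    depending on [x] only through [eigs x], so conjugate matrices get the same polynomials. *)
Definition eproj x a : {poly C} := xget 0
  [set e | ppow a %| e - 1 /\ forall b, b \in eigs x -> b != a -> ppow b %| e].

Lemma eprojP x a : ppow a %| eproj x a - 1 /\
  forall b, b \in eigs x -> b != a -> ppow b %| eproj x a.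
Proof. by rewrite /eproj; case: xgetP => // /(_ _); have [e] := proj_poly_exists x a => ? /(_ e). Qed.

Definition sproj x a := horner_mx x (eproj x a).

Lemma horner_prod_dvd x p : (forall a, a \in eigs x -> ppow a %| p) -> horner_mx x p = 0.
Proof.
move=> H; have /dvdpP [q ->] := dvdp_prod_coprime (undup_uniq _) H.
by rewrite rmorphM /= horner_ppow mulr0.
Qed.

Lemma sproj_sum x : \sum_(a <- eigs x) sproj x a = 1.
Proof.
apply/eqP; rewrite -subr_eq0 -(rmorph1 (horner_mx x)) -rmorph_sum -rmorphB /=.
apply/eqP/horner_prod_dvd => a ax; rewrite (bigD1_seq a) ?undup_uniq //= addrAC.
rewrite dvdp_add ?(eprojP x a).1 //; elim/big_rec: _ => [|b p ba IH]; first exact: dvdp0.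
by rewrite dvdp_add //; have [_] := eprojP x b; apply=> //; rewrite eq_sym.
Qed.

Lemma sproj_ortho x a b : a \in eigs x -> b \in eigs x -> a != b ->
  sproj x a * sproj x b = 0.
Proof.
move=> ax bx ab; rewrite -rmorphM /=; apply: horner_prod_dvd => c cx.
have [ca|ca] := eqVneq c a.
  by rewrite dvdp_mull //; have [_] := eprojP x b; apply=> //; rewrite ca.
by rewrite dvdp_mulr //; have [_] := eprojP x a; apply.
Qed.

Lemma sproj_idem x a : a \in eigs x -> sproj x a * sproj x a = sproj x a.
Proof.
move=> ax; rewrite -[RHS]mulr1 -(sproj_sum x) (bigD1_seq a) ?undup_uniq //= mulrDr.
rewrite mulr_sumr big_seq_cond big1 ?addr0 // => b /andP [bx ba].
by rewrite sproj_ortho // eq_sym.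
Qed.

Lemma sproj_nil x a : a \in eigs x -> (x - a%:M) ^+ n.+1 * sproj x a = 0.
Proof.
move=> ax; have -> : x - a%:M = horner_mx x ('X - a%:P).
  by rewrite rmorphB /= horner_mx_X horner_mx_C.
rewrite -rmorphXn -rmorphM /=; apply: horner_prod_dvd => c cx.
have [ca|ca] := eqVneq c a; first by rewrite ca dvdp_mulr.
by rewrite dvdp_mull //; have [_] := eprojP x a; apply.
Qed.

Lemma sproj_neq0 x a : a \in eigs x -> sproj x a != 0.
Proof.
move=> /eigsP [v vx v0]; apply: contraNneq v0 => e0.
have vp p : v *m horner_mx x p = p.[a] *: v.
  elim/poly_ind: p => [|p c IH]; first by rewrite rmorph0 mulmx0 horner0 scale0r.
  rewrite rmorphD rmorphM /= horner_mx_C horner_mx_X mulmxDr mulmxA IH -scalemxAl vx.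
  by rewrite mul_mx_scalar scalerA !hornerE scalerDl.
have := vp (eproj x a); rewrite -/(sproj x a) e0 mulmx0.
have /dvdpP [q /eqP] := (eprojP x a).1; rewrite subr_eq => /eqP ->.
rewrite hornerD hornerM horner_exp !hornerE subrr expr0n /= mulr0 add0r scale1r.
by move=> <-.
Qed.

Lemma sproj_comm x a : x * sproj x a = sproj x a * x.
Proof. by rewrite -[X in X * _]horner_mx_X -[X in _ = _ * X]horner_mx_X -!rmorphM /= mulrC. Qed.

(** This is [f] applied to the semisimple part of [x]: for additive [f] a replica in the sense of
    Chevalley, for [f] turning sums into products an element of the torus generated by that part. *)
Definition smap (f : C -> C) x := \sum_(a <- eigs x) f a *: sproj x a.

Lemma smap_proj f x a : a \in eigs x -> smap f x * sproj x a = f a *: sproj x a.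
Proof.
move=> ax; rewrite mulr_suml (bigD1_seq a) ?undup_uniq //= big_seq_cond big1 ?addr0.
  by rewrite -scalerAl sproj_idem.
by move=> b /andP [bx ba]; rewrite -scalerAl sproj_ortho // scaler0.
Qed.

Lemma proj_smap f x a : a \in eigs x -> sproj x a * smap f x = f a *: sproj x a.
Proof.
move=> ax; rewrite mulr_sumr (bigD1_seq a) ?undup_uniq //= big_seq_cond big1 ?addr0.
  by rewrite -scalerAr sproj_idem.
by move=> b /andP [bx ba]; rewrite -scalerAr sproj_ortho // 1?eq_sym // scaler0.
Qed.

Lemma smapM f g x : smap f x * smap g x = smap (fun a => f a * g a) x.
Proof.
rewrite {2}/smap mulr_sumr; apply: eq_big_seq => a ax.
by rewrite -scalerAr smap_proj // scalerA mulrC.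
Qed.

Lemma smap1 x : smap (fun=> 1) x = 1.
Proof. by rewrite -[RHS](sproj_sum x); apply: eq_bigr => a _; rewrite scale1r. Qed.

Lemma smap_horner f x : exists q, smap f x = horner_mx x q.
Proof.
exists (\sum_(a <- eigs x) f a *: eproj x a); rewrite rmorph_sum.
by apply: eq_bigr => a _; rewrite /= horner_mxZ.
Qed.

(** The nilpotent part in the Jordan-Chevalley decomposition. *)
Definition npart x := x - smap id x.

Lemma npart_nil x : npart x ^+ n.+1 = 0.
Proof.
rewrite -[LHS]mulr1 -(sproj_sum x) mulr_sumr big1_seq // => a /andP [_ ax].
have -> : npart x ^+ n.+1 * sproj x a = (x - a%:M) ^+ n.+1 * sproj x a; last first.
  exact: sproj_nil.
have ec : npart x * sproj x a = (x - a%:M) * sproj x a.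
  by rewrite !mulrBl smap_proj // -[a%:M * _]/(_ *m _) mul_scalar_mx.
have c : (x - a%:M) * sproj x a = sproj x a * (x - a%:M).
  by rewrite mulrBl mulrBr sproj_comm -[_ * a%:M]/(_ *m _) scalar_mxC.
suff H k : npart x ^+ k * sproj x a = (x - a%:M) ^+ k * sproj x a by [].
elim: k => [|k IH]; first by rewrite !expr0.
by rewrite !exprSr -!mulrA ec c !mulrA IH.
Qed.

Lemma trace_sproj x a : a \in eigs x -> \tr (x * sproj x a) = a * \tr (sproj x a).
Proof.
move=> ax; apply/eqP; rewrite -subr_eq0 -mxtraceZ -raddfB /= -mul_scalar_mx.
rewrite -[_%:M *m _]/(_ * _) -mulrBl; apply/eqP/(@nilpotent_trace _ _ _ n.+1).
have c : GRing.comm (x - a%:M) (sproj x a).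
  by rewrite /GRing.comm mulrBl mulrBr sproj_comm -[_ * a%:M]/(_ *m _) scalar_mxC.
have e k : sproj x a ^+ k.+1 = sproj x a.
  by elim: k => [|k IH] //; rewrite exprS IH sproj_idem.
by rewrite exprMn_comm // e sproj_nil.
Qed.

End Spectral.

Lemma trace_smap (C : numClosedFieldType) n (x : 'M[C]_n.+1) f :
  \tr (x * smap f x) = \sum_(a <- eigs x) a * f a * (\rank (sproj x a))%:R.
Proof.
rewrite mulr_sumr raddf_sum /=; apply: eq_big_seq => a ax.
rewrite -scalerAr mxtraceZ trace_sproj // mulrA [f a * a]mulrC; congr (_ * _).
by apply: idempotent_trace; apply: sproj_idem.
Qed.

(* The trace is the sum of the [|a|^2] over the eigenvalues [a] of [x]. *)
Lemma trace_conj_nilpotent (C : numClosedFieldType) n (x : 'M[C]_n.+1) :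
  \tr (x * smap Num.conj x) = 0 -> x ^+ n.+1 = 0.
Proof.
rewrite trace_smap => /eqP; rewrite psumr_eq0; last first.
  by move=> a _; rewrite mulr_ge0 ?mul_conjC_ge0 ?ler0n.
move=> /allP H; have e0 a : a \in eigs x -> a = 0.
  move=> ax; have := H a ax; rewrite /= mulf_eq0 mul_conjC_eq0 pnatr_eq0 mxrank_eq0.
  by rewrite (negPf (sproj_neq0 ax)) orbF => /eqP.
have s0 : smap id x = 0 by rewrite /smap big1_seq // => a /andP [_ /e0 ->]; rewrite scale0r.
by have := npart_nil x; rewrite /npart s0 subr0.
Qed.

(** * Lie algebras of matrix groups *)

Section Decomp.
Variables (C : fieldType) (A : lmodType C) (T : A -> A) (I : A -> Prop).
Hypotheses (TB : forall p q, T (p - q) = T p - T q) (TZ : forall c p, T (c *: p) = c *: T p).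
Hypotheses (I0 : I 0) (IB : forall p q, I p -> I q -> I (p - q))
  (IZ : forall c p, I p -> I (c *: p)) (IT : forall p, I p -> I (T p)).

Definition shift nu p := T p - nu *: p.

Lemma shiftB nu p q : shift nu (p - q) = shift nu p - shift nu q.
Proof. by rewrite /shift TB scalerBr !opprB addrACA [- _ - _]addrC addrACA. Qed.

Lemma iter_shiftB nu k p q :
  iter k (shift nu) (p - q) = iter k (shift nu) p - iter k (shift nu) q.
Proof. by elim: k => //= k ->; rewrite shiftB. Qed.

Lemma shift0 nu : shift nu 0 = 0. Proof. by have := shiftB nu 0 0; rewrite !subrr. Qed.

Lemma iter_shift0 nu k : iter k (shift nu) 0 = 0.
Proof. by elim: k => //= k ->; rewrite shift0. Qed.

Lemma iter_shiftD nu k p q :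
  iter k (shift nu) (p + q) = iter k (shift nu) p + iter k (shift nu) q.
Proof. by rewrite -{1}[q]opprK iter_shiftB -[- q]sub0r iter_shiftB iter_shift0 sub0r opprK. Qed.

Lemma shift_comm mu nu p : shift mu (shift nu p) = shift nu (shift mu p).
Proof.
rewrite /shift !TB !TZ !scalerBr !scalerA [nu * mu]mulrC !opprB.
by rewrite addrACA [- _ - _]addrC addrACA.
Qed.

Lemma iter_shift_comm mu nu k p : iter k (shift mu) (shift nu p) = shift nu (iter k (shift mu) p).
Proof. by elim: k => //= k ->; rewrite shift_comm. Qed.

Lemma I_add p q : I p -> I q -> I (p + q).
Proof. by move=> Ip Iq; rewrite -[q]opprK -[- q]sub0r; apply/IB/IB. Qed.

Lemma I_shift nu p : I p -> I (shift nu p).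
Proof. by move=> Ip; apply: IB; [apply: IT|apply: IZ]. Qed.

(** On vectors killed by a power of [shift nu], the operator [shift mu] is invertible: by induction
    [shift nu q] lies in [I] too, and [q] is a multiple of [shift mu q - shift nu q]. *)
Lemma shift_cancel mu nu e q : mu != nu -> iter e (shift nu) q = 0 ->
  I (shift mu q) -> I q.
Proof.
move=> mn; elim: e q => [|e IH] q; first by move=> /= ->.
rewrite iterSr => q1 Iq.
have : I (shift nu q) by apply: IH => //; rewrite shift_comm; apply: I_shift.
move=> Iq'; have -> : q = (nu - mu)^-1 *: (shift mu q - shift nu q).
  rewrite /shift opprB addrACA [- _ + _]addrC addrACA subrr add0r -scalerBl.
  by rewrite scalerA mulVf ?scale1r // subr_eq0 eq_sym.
by apply/IZ/IB.
Qed.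

Lemma iter_shift_cancel mu nu e k q : mu != nu -> iter e (shift nu) q = 0 ->
  I (iter k (shift mu) q) -> I q.
Proof.
move=> mn q0; elim: k => //= k IH /(@shift_cancel _ nu e) Iq; apply/IH/Iq => //.
by elim: k {IH Iq} => //= k IH; rewrite iter_shift_comm IH shift0.
Qed.

(** A [T]-stable subspace contains the generalized eigencomponents of its elements. In the main use
    [A] is a polynomial ring, so the argument is free of dimensions: a power of [shift nu] kills one
    component, and cancelling it recovers the others. *)
Lemma weight_components (vs : seq C) (q : C -> A) : uniq vs ->
  (forall nu, exists e, iter e (shift nu) (q nu) = 0) ->
  I (\sum_(nu <- vs) q nu) -> forall nu, nu \in vs -> I (q nu).
Proof.
elim: vs q => [|nu vs IH] q //= /andP [nvs us] qe; rewrite big_cons => Is.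
have [e q0] := qe nu; have Ivs mu : mu \in vs -> I (q mu).
  move=> mvs; have mn : nu != mu by apply: contraNneq nvs => ->.
  have [e' q'0] := qe mu; apply: (iter_shift_cancel (k := e) mn q'0).
  apply: (IH (fun mu => iter e (shift nu) (q mu))) => // [la|].
    have [e'' q''] := qe la; exists e''.
    by elim: e {q0} => //= e IHe; rewrite iter_shift_comm IHe shift0.
  suff : I (iter e (shift nu) (q nu + \sum_(j <- vs) q j)).
    rewrite iter_shiftD q0 add0r; congr I; elim: vs {IH nvs us Is mvs} => [|a s IHs].
      by rewrite !big_nil iter_shift0.
    by rewrite !big_cons iter_shiftD IHs.
  by elim: e {q0} => //= e; apply: I_shift.
move=> mu; rewrite in_cons => /orP [/eqP ->|/Ivs //].
have : I (\sum_(j <- vs) q j).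
  elim: vs {IH nvs us Is} Ivs => [|a s IHs] Ivs; first by rewrite big_nil.
  rewrite big_cons; apply: I_add; first by apply: Ivs; rewrite mem_head.
  by apply: IHs => b bs; apply: Ivs; rewrite in_cons bs orbT.
by move=> /(IB Is); rewrite addrK.
Qed.

End Decomp.

(** * Weights of right translations, replicas and one-parameter subgroups *)

Section Weights.
Variables (C : numClosedFieldType) (n : nat).
Local Notation M := ('M[C]_n.+1).
Local Notation P := {mpoly C[n.+1 * n.+1]}.
Implicit Types (x y g : M) (p q : P) (K : set M).

Definition additive_map (phi : C -> C) := forall a b, phi (a + b) = phi a + phi b.
Definition exponential (E : C -> C) := E 0 = 1 /\ forall a b, E (a + b) = E a * E b.

Local Notation shiftD x := (shift (D x)).

(* [q] has weight [nu] for the action of the semisimple part of [x] by right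
   translations, of all its replicas and of the torus elements they generate. *)
Definition has_weight x nu q :=
  [/\ exists k, iter k (shiftD x nu) q = 0,
      forall phi, additive_map phi -> D (smap phi x) q = phi nu *: q &
      forall E, exponential E -> forall g, ev q (g * smap E x) = E nu * ev q g].

Lemma shiftDM x mu nu p q :
  shiftD x (mu + nu) (p * q) = shiftD x mu p * q + p * shiftD x nu q.
Proof.
rewrite /shift DM mulrBl mulrBr scalerDl opprD addrACA.
by rewrite scalerAl scalerAr.
Qed.

Lemma iter_shiftDM x mu nu k l p q :
  iter k (shiftD x mu) p = 0 -> iter l (shiftD x nu) q = 0 ->
  iter (k + l) (shiftD x (mu + nu)) (p * q) = 0.
Proof.
move: {2}(k + l)%N (erefl (k + l)%N) => m.
have s0 := @iter_shift0 _ _ (D x) (@DB _ _ x).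
elim: m k l p q => [|m IH] [|k] [|l] p q mE p0 q0.
- by rewrite [p]p0 mul0r.
- by [].
- by [].
- by [].
- by [].
- by rewrite [p]p0 mul0r s0.
- by rewrite [q]q0 mulr0 s0.
have e1 : (k + l.+1)%N = m by case: mE.
have e2 : (k.+1 + l)%N = m by rewrite addSnnS.
rewrite mE iterSr shiftDM (iter_shiftD (@DB _ _ x)) -{1}e1 -e2.
by rewrite IH ?IH ?addr0 // -iterSr.
Qed.

Lemma has_weightM x mu nu p q : has_weight x mu p -> has_weight x nu q ->
  has_weight x (mu + nu) (p * q).
Proof.
move=> [[k p1] p2 p3] [[l q1] q2 q3]; split.
- by exists (k + l)%N; apply: iter_shiftDM.
- move=> phi phiA; rewrite DM p2 // q2 // phiA scalerDl.
  by rewrite scalerAl scalerAr.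
- by move=> E EE g; rewrite !evM p3 // q3 // EE.2 mulrACA.
Qed.

Lemma has_weightD x nu p q : has_weight x nu p -> has_weight x nu q ->
  has_weight x nu (p + q).
Proof.
move=> [[k p1] p2 p3] [[l q1] q2 q3]; split.
- exists (k + l)%N; have s0 := @iter_shift0 _ _ (D x) (@DB _ _ x).
  rewrite (iter_shiftD (@DB _ _ x)) (_ : iter _ _ q = 0) ?addr0; last by rewrite iterD q1 s0.
  by rewrite addnC iterD p1 s0.
- by move=> phi phiA; rewrite DD p2 // q2 // scalerDr.
- by move=> E EE g; rewrite !evD p3 // q3 // mulrDr.
Qed.

Lemma additive_map0 phi : additive_map phi -> phi 0 = 0.
Proof. by move=> phiA; apply: (addrI (phi 0)); rewrite -phiA !addr0. Qed.

Lemma has_weightC x c : has_weight x 0 c%:MP.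
Proof.
split.
- by exists 1%N; rewrite /= /shift DC scale0r subrr.
- by move=> phi /additive_map0 ->; rewrite DC scale0r.
- by move=> E [-> _] g; rewrite !evC mul1r.
Qed.

Lemma has_weight0 x nu : has_weight x nu 0.
Proof.
by split; [exists 0%N | move=> phi _; rewrite D0 scaler0 | move=> E _ g; rewrite !ev0 mulr0].
Qed.

Lemma has_weight_ent x a i j : a \in eigs x -> has_weight x a (ent (sproj x a) i j).
Proof.
move=> ax; split.
- exists n.+1; have e k : iter k (shiftD x a) (ent (sproj x a) i j) =
      ent ((x - a%:M) ^+ k * sproj x a) i j.
    elim: k => [|k IH]; first by rewrite expr0 mul1r.
    rewrite iterS IH /shift D_ent exprS -mulrA; set y := _ * sproj x a.
    rewrite mulrBl -[a%:M * y]/(_ *m _) mul_scalar_mx /ent scaler_sumr -sumrB.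
    by apply: eq_bigr => l _; rewrite !mxE scalerBl scalerA.
  by rewrite e sproj_nil // /ent big1 // => l _; rewrite mxE scale0r.
- move=> phi _; rewrite D_ent -[_ *m _]/(_ * _) smap_proj // /ent scaler_sumr.
  by apply: eq_bigr => l _; rewrite !mxE scalerA.
- move=> E _ g; rewrite !ev_ent -[_ *m _]/(_ * _) -mulrA smap_proj // -scalerAr.
  by rewrite mxE.
Qed.

(** A coordinate function is the sum over the eigenvalues [a] of the entries of the matrix times
    [sproj x a], which have weight [a]; weights add in products. *)
Lemma weight_decomposition x p : exists l : seq (C * P),
  p = \sum_(t <- l) t.2 /\ forall t, t \in l -> has_weight x t.1 t.2.
Proof.
elim/mxpoly_ind: p => [c|i j|p q [l [-> lw]] [m [-> mw]]|p q [l [-> lw]] [m [-> mw]]].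
- exists [:: (0, c%:MP)]; rewrite big_seq1; split=> // t.
  by rewrite inE => /eqP -> /=; apply: has_weightC.
- exists [seq (a, ent (sproj x a) i j) | a <- eigs x]; rewrite big_map /=; split.
    rewrite /ent exchange_big /=; under eq_bigr => k _ do rewrite -scaler_suml.
    rewrite (eq_bigr (fun k => ((k == j)%:R : C) *: cf C i k)) => [|k _].
      by rewrite (bigD1 j) //= eqxx scale1r big1 ?addr0 // => k /negPf ->; rewrite scale0r.
    by congr (_ *: _); have /matrixP/(_ k j) := sproj_sum x; rewrite summxE mxE.
  by move=> t /mapP [a ax ->]; apply: has_weight_ent.
- exists (l ++ m); rewrite big_cat; split=> // t.
  by rewrite mem_cat => /orP [/lw|/mw].
- exists [seq (s.1 + t.1, s.2 * t.2) | s <- l, t <- m].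
  rewrite big_allpairs_dep /= mulr_suml; split.
    by apply: eq_bigr => s _; rewrite mulr_sumr.
  by move=> u /allpairsP [[s t] [sl tm ->]]; apply: has_weightM; [apply: lw|apply: mw].
Qed.

Lemma weight_family x p : exists (vs : seq C) (q : C -> P), [/\ uniq vs,
  p = \sum_(nu <- vs) q nu & forall nu, has_weight x nu (q nu)].
Proof.
have [l [-> lw]] := weight_decomposition x p.
exists (undup [seq t.1 | t <- l]), (fun nu => \sum_(t <- l | t.1 == nu) t.2).
split; first exact: undup_uniq.
  rewrite (exchange_big_dep predT) //=; apply: eq_big_seq => t tl.
  rewrite -big_filter (_ : [seq _ <- _ | _] = [:: t.1]) ?big_seq1 //.
  apply/perm_small_eq => //; rewrite uniq_perm ?filter_uniq ?undup_uniq // => a.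
  by rewrite mem_filter mem_undup inE [a == _]eq_sym andb_idr // => /eqP <-; apply: map_f.
move=> nu; rewrite big_seq_cond.
apply: (big_ind (has_weight x nu)); first exact: has_weight0.
  by move=> ? ? ? ?; apply: has_weightD.
by move=> t /andP [/lw + /eqP <-].
Qed.

Definition vanish K p := forall g, K g -> ev p g = 0.
Definition zclosed_mx K := forall g, (forall p, vanish K p -> ev p g = 0) -> K g.
(** The Zariski tangent space at [1] of the ideal of [K]. *)
Definition lie K x := forall p, vanish K p -> dev p 1 x = 0.
Definition mulclosed K := K 1 /\ forall g h, K g -> K h -> K (g * h).

Lemma vanish0 K : vanish K 0. Proof. by move=> g _; rewrite ev0. Qed.
Lemma vanishB K p q : vanish K p -> vanish K q -> vanish K (p - q).
Proof. by move=> Kp Kq g Kg; rewrite evB Kp // Kq // subrr. Qed.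
Lemma vanishZ K c p : vanish K p -> vanish K (c *: p).
Proof. by move=> Kp g Kg; rewrite evZ Kp // mulr0. Qed.
Lemma vanishM K p q : vanish K q -> vanish K (p * q).
Proof. by move=> Kp g Kg; rewrite evM Kp // mulr0. Qed.

Lemma dev1E p x : dev p 1 x = ev (D x p) 1.
Proof. by rewrite -devE mul1mx. Qed.

(** Left translation by an element of [K] carries the ideal of [K] into itself, so the condition at
    [1] propagates to every point of [K]. *)
Lemma lieP K x : mulclosed K -> lie K x -> forall p, vanish K p -> vanish K (D x p).
Proof.
move=> [_ KM] Kx p Kp g Kg; pose F i j : P := \sum_k g i k *: cf C k j.
have eF h : evm F h = g * h.
  apply/matrixP => i j; rewrite !mxE ev_sum; apply: eq_bigr => k _.
  by rewrite evZ ev_cf.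
have dF h y : devm F h y = g * y.
  apply/matrixP => i j; rewrite !mxE dev_sum; apply: eq_bigr => k _.
  by rewrite devZ dev_cf.
have -> : ev (D x p) g = dev p (evm F 1) (devm F 1 x) by rewrite eF dF mulr1 -devE.
by rewrite -dev_subst; apply: Kx => h Kh; rewrite ev_subst eF; apply/Kp/KM.
Qed.

Lemma lie_ev K x : (forall p, vanish K p -> ev (D x p) 1 = 0) -> lie K x.
Proof. by move=> H p /H; rewrite dev1E. Qed.

Lemma lie_linear K c x y : lie K x -> lie K y -> lie K (c *: x + y).
Proof. by move=> Kx Ky; apply: lie_ev => p Kp; rewrite D_linear evD evZ -!dev1E Kx // Ky // mulr0 addr0. Qed.

Lemma lie0 K : lie K 0.
Proof. by move=> p _; rewrite /dev big1 // => i _; rewrite big1 // => j _; rewrite mxE mul0r. Qed.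

Lemma lieZ K c x : lie K x -> lie K (c *: x).
Proof. by move=> Kx; rewrite -[_ *: _]addr0; apply: lie_linear => //; apply: lie0. Qed.

Lemma lieD K x y : lie K x -> lie K y -> lie K (x + y).
Proof. by move=> Kx Ky; rewrite -[x]scale1r; apply: lie_linear. Qed.

Lemma lieB K x y : lie K x -> lie K y -> lie K (x - y).
Proof. by move=> Kx Ky; apply: lieD => //; rewrite -scaleN1r; apply: lieZ. Qed.

Lemma lieS K L x : K `<=` L -> lie K x -> lie L x.
Proof. by move=> KL Kx p Lp; apply: Kx => g /KL; apply: Lp. Qed.

Lemma weights_vanish K x vs (q : C -> P) : mulclosed K -> lie K x -> uniq vs ->
  (forall nu, has_weight x nu (q nu)) -> vanish K (\sum_(nu <- vs) q nu) ->
  forall nu, nu \in vs -> vanish K (q nu).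
Proof.
move=> KM Kx us qw Ks.
apply: (weight_components (@DB _ _ x) (fun c p => DZ x c p) (@vanish0 K)
  (@vanishB K) (@vanishZ K) (lieP KM Kx) us) => // nu.
by have [] := qw nu.
Qed.

(** The ideal of [K] is stable under [D x], hence contains the weight components of its members, and
    [D (smap phi x)] is a scalar on each of them. *)
Lemma lie_smap K x phi : mulclosed K -> lie K x -> additive_map phi ->
  lie K (smap phi x).
Proof.
move=> KM Kx phiA; apply: lie_ev => p; have [vs [q [us -> qw]]] := weight_family x p.
move=> /(weights_vanish KM Kx us qw) Kq; rewrite D_sum ev_sum big1_seq // => nu /andP [_ nuv].
by have [_ -> // _] := qw nu; rewrite evZ Kq ?mulr0 //; case: KM.
Qed.

Lemma lie_npart K x : mulclosed K -> lie K x -> lie K (npart x).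
Proof. by move=> KM Kx; apply: lieB => //; apply: lie_smap => // a b. Qed.

(** On a component of weight [nu] the value at [smap E x] is [E nu] times the value at [1], which is
    [0] for components of an element of the ideal. *)
Lemma group_smap K x E : mulclosed K -> zclosed_mx K -> lie K x -> exponential E ->
  K (smap E x).
Proof.
move=> KM KC Kx EE; apply: KC => p; have [vs [q [us -> qw]]] := weight_family x p.
move=> /(weights_vanish KM Kx us qw) Kq; rewrite ev_sum big1_seq // => nu /andP [_ nuv].
by have [_ _ qE] := qw nu; rewrite -[smap E x]mul1r qE // Kq ?mulr0 //; case: KM.
Qed.

(** An abstract stand-in for exponential functions, none being at hand over an arbitrary closed
    field; the powers make a Vandermonde argument possible. *)
Definition separating (S : set (C -> C)) :=
  [/\ forall E, S E -> exponential E,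
      forall E m, S E -> S (fun a => E a ^+ m) &
      forall vs : seq C, uniq vs -> exists2 E, S E & {in vs &, injective E}].

(** By linearity the sums vanish with any polynomial in [E a] in place of the powers; take the one
    whose roots are the other values of [E]. *)
Lemma vandermonde (vs : seq C) (c E : C -> C) : uniq vs -> {in vs &, injective E} ->
  (forall m, \sum_(a <- vs) E a ^+ m * c a = 0) -> forall a, a \in vs -> c a = 0.
Proof.
move=> us Ei H a av.
have Hp (p : {poly C}) : \sum_(b <- vs) p.[E b] * c b = 0.
  under eq_bigr => b _ do rewrite horner_coef mulr_suml.
  rewrite exchange_big big1 // => i _; under eq_bigr => b _ do rewrite -mulrA.
  by rewrite -mulr_sumr H mulr0.
pose q := \prod_(b <- vs | b != a) ('X - (E b)%:P).
have q0 b : b \in vs -> b != a -> q.[E b] = 0.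
  move=> bv ba; rewrite horner_prod -big_filter (bigD1_seq b) /=.
  - by rewrite !hornerE subrr !mul0r.
  - by rewrite mem_filter ba.
  - by rewrite filter_uniq.
have := Hp q; rewrite (bigD1_seq a) //= [X in _ + X]big1_seq ?addr0; last first.
  by move=> b /andP [ba bv]; rewrite q0 // mul0r.
move/eqP; rewrite mulf_eq0 => /orP [|/eqP //]; rewrite horner_prod prodf_seq_eq0.
case/hasP => b bv /= /andP [ba]; rewrite !hornerE subr_eq0 => /eqP /Ei e.
by rewrite e ?eqxx // in ba.
Qed.

(** Evaluating an element of the ideal at the powers of one separating element shows that each of
    its weight components vanishes at [1]. *)
Lemma lie_of_smap K x S : separating S -> (forall E, S E -> K (smap E x)) ->
  lie K (smap id x).
Proof.
move=> [Sexp Spow Ssep] KE; apply: lie_ev => p.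
have [vs [q [us -> qw]]] := weight_family x p => Kq.
have [E SE Ei] := Ssep vs us.
have q0 : forall nu, nu \in vs -> ev (q nu) 1 = 0.
  apply: (vandermonde us Ei) => m; rewrite -[RHS](Kq _ (KE _ (Spow E m SE))).
  rewrite ev_sum; apply: eq_bigr => nu _.
  by have [_ _ qE] := qw nu; rewrite -[smap _ x]mul1r qE //; apply/Sexp/Spow.
rewrite D_sum ev_sum big1_seq // => nu /andP [_ nuv].
by have [_ -> // _] := qw nu; rewrite evZ q0 // mulr0.
Qed.

(** The curve [exp (t y)], cut after the power [n] in view of the condition [y ^+ n.+1 = 0] on its
    uses. *)
Definition expath y : 'M[{poly C}]_n.+1 :=
  \matrix_(i, j) \poly_(k < n.+1) ((y ^+ k) i j / k`!%:R).
Definition expm (t : C) y : M := \sum_(k < n.+1) (t ^+ k / k`!%:R) *: y ^+ k.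

Lemma at_expath t y : at_t t (expath y) = expm t y.
Proof.
apply/matrixP => i j; rewrite !mxE /horner_eval horner_poly summxE.
by apply: eq_bigr => k _; rewrite !mxE mulrC mulrA mulrAC.
Qed.

Lemma expm0 y : expm 0 y = 1.
Proof.
rewrite /expm big_ord_recl /= !expr0 mul1r invr1 scale1r big1 ?addr0 // => i _.
by rewrite expr0n mul0r scale0r.
Qed.

Lemma deriv_expath y i j : y ^+ n.+1 = 0 ->
  (expath y i j)^`() = \sum_k y k j *: expath y i k.
Proof.
move=> yn; apply/polyP => m; rewrite coef_deriv coef_sum mxE coef_poly.
rewrite (eq_bigr (fun k => if (m < n.+1)%N then y k j * ((y ^+ m) i k / m`!%:R) else 0)).
  case: (ltnP m n.+1) => mn; last by rewrite big1_eq ltnNge (leqW mn) mul0rn.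
  have -> : \sum_k y k j * ((y ^+ m) i k / m`!%:R) = (y ^+ m.+1) i j / m`!%:R.
    rewrite exprSr mxE mulr_suml; apply: eq_bigr => k _.
    by rewrite mulrC mulrAC.
  move: mn; rewrite ltnS leq_eqVlt => /orP [/eqP ->|mn].
    by rewrite ltnn mul0rn yn mxE mul0r.
  rewrite ltnS mn factS natrM invfM -mulrnAr; congr (_ * _).
  by rewrite -mulrnAl -[_ *+ _]mulr_natr mulVf ?mul1r // pnatr_eq0.
by move=> k _; rewrite coefZ mxE coef_poly; case: ifP; rewrite ?mulr0.
Qed.

Lemma deriv_pathev_exp y p : y ^+ n.+1 = 0 ->
  (pathev p (expath y))^`() = pathev (D y p) (expath y).
Proof.
move=> yn; elim/mxpoly_ind: p => [c|i j|p q ep eq|p q ep eq].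
- by rewrite DC -mpolyC0 !pathevC derivC.
- rewrite pathev_cf D_cf deriv_expath // /ent.
  rewrite (big_morph (fun p => pathev p (expath y)) (id1 := 0) (op1 := +%R)).
  + by apply: eq_bigr => k _; rewrite -mul_mpolyC pathevM pathevC pathev_cf mul_polyC.
  + by move=> ? ?; rewrite pathevD.
  + by rewrite -mpolyC0 pathevC.
- by rewrite pathevD derivD DD pathevD ep eq.
- by rewrite pathevM derivM DM pathevD !pathevM ep eq.
Qed.

(** The [k]-th derivative at [0] of [p] along the curve is the [k]-fold [D y] of [p] at [1], which
    is [0]; in characteristic [0] this kills the polynomial in [t]. *)
Lemma group_expm K y t : mulclosed K -> zclosed_mx K -> lie K y -> y ^+ n.+1 = 0 ->
  K (expm t y).
Proof.
move=> KM KC Ky yn; apply: KC => p Kp; rewrite -at_expath -horner_pathev.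
suff -> : pathev p (expath y) = 0 by rewrite horner0.
have it k : (pathev p (expath y))^`(k) = pathev (iter k (D y) p) (expath y).
  by elim: k => [|k IH]; rewrite ?derivn0 // derivnS IH deriv_pathev_exp.
apply/polyP => k; have := congr1 (horner_eval 0) (it k).
rewrite /horner_eval horner_pathev at_expath expm0 horner_coef0 coef_derivn addn0.
have -> : ev (iter k (D y) p) 1 = 0.
  suff : vanish K (iter k (D y) p) by apply; case: KM.
  by elim: k => //= k IH; apply: lieP.
by move/eqP; rewrite ffactnn mulrn_eq0 -leqn0 leqNgt fact_gt0 coef0 => /eqP.
Qed.

Lemma lie_of_expm K y : (forall t, K (expm t y)) -> y ^+ n.+1 = 0 -> lie K y.
Proof.
move=> Ke yn; apply: lie_ev => p Kp; rewrite -(expm0 y) -at_expath -horner_pathev.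
rewrite -deriv_pathev_exp //; suff -> : pathev p (expath y) = 0 by rewrite deriv0 horner0.
by apply: poly_nat_zero => t; rewrite horner_pathev at_expath Kp.
Qed.

End Weights.

(** * Subspaces given by predicates, and linear forms *)

Section VectorSpaces.
Variables (F : fieldType) (V : vectType F).

(** A [{vspace V}] of largest dimension inside [S] is all of [S]; this bridges predicates, in which
    subspaces are stated below, and dimension arguments. *)
Lemma vspace_of_set (S : set V) : S 0 -> (forall c u v, S u -> S v -> S (c *: u + v)) ->
  exists U : {vspace V}, forall v, v \in U <-> S v.
Proof.
move=> S0 SL; pose Q d := `[< exists U : {vspace V}, (forall v, v \in U -> S v) /\ \dim U = d >].
have exQ : exists d, Q d.
  exists 0%N; apply/asboolP; exists 0%VS; split; last exact: dimv0.
  by move=> v; rewrite memv0 => /eqP ->.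
have bQ d : Q d -> (d <= \dim {:V})%N.
  by move=> /asboolP [U [_ <-]]; apply/dimvS/subvf.
case: (ex_maxnP exQ bQ) => d /asboolP [U [US Ud]] dmax; exists U => v; split; first exact: US.
move=> Sv; apply: contrapT => /negP nvU.
have : (\dim (U + <[v]>) <= \dim U)%N.
  rewrite Ud; apply: dmax; apply/asboolP; exists (U + <[v]>)%VS; split=> //.
  move=> _ /memv_addP [u uU [_ /vlineP [c ->] ->]]; rewrite addrC.
  by apply: SL => //; apply: US.
move=> le; have : (U + <[v]> == U)%VS.
  by rewrite eq_sym eqEdim addvSl.
by move=> /eqP UE; case/negP: nvU; rewrite memvE -UE addvSr.
Qed.

Lemma separate_vspace (U : {vspace V}) v : v \notin U ->
  exists f : {linear V -> F^o}, (forall u, u \in U -> f u = 0) /\ f v != 0.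
Proof.
move=> vU; pose g := daddv_pi U^C U; have dU : (U^C :&: U = 0)%VS by rewrite capvC capv_compl.
have gv : g v != 0.
  apply: contraNneq vU => gv; have := daddv_pi_add dU (w := v).
  rewrite addvC addv_complf memvf => /(_ isT); rewrite -/g gv add0r => <-.
  exact: memv_pi.
have [i gi] : exists i, vector.coord (vbasis {:V}) i (g v) != 0.
  apply: contrapT => H; case/eqP: gv; rewrite (coord_vbasis (memvf (g v))) big1 // => i _.
  by apply/eqP; rewrite scaler_eq0; apply/orP; left; apply/negPn/negP => h; apply: H; exists i.
pose f (u : V) : F^o := vector.coord (vbasis {:V}) i (g u).
have fl : linear f by move=> c u w; rewrite /f !linearP.
pose f' := HB.pack_for {linear V -> F^o} f (GRing.isLinear.Build _ _ _ _ f fl).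
exists f'; split=> [u uU|//]; rewrite /= /f.
have -> : g u = 0.
  have := daddv_pi_add dU (w := u); rewrite addvC addv_complf memvf => /(_ isT).
  rewrite -/g [X in _ + X]daddv_pi_id //; last by rewrite capvC.
  by move=> e; apply: (addIr u); rewrite e add0r.
by rewrite linear0.
Qed.

End VectorSpaces.

(** * The Lie algebra of an irreducible group determines the group *)

Section Crux.
Variables (C : numClosedFieldType) (n : nat).
Local Notation M := ('M[C]_n.+1).
Local Notation N := (n.+1 * n.+1)%N.
Local Notation P := {mpoly C[N]}.
Implicit Types (x y g : M) (p q : P).

Definition irreducible_mx (K : set M) :=
  forall p q, vanish K (p * q) -> vanish K p \/ vanish K q.

Variable (K : set M).
Hypotheses (KM : mulclosed K) (KI : irreducible_mx K).

Definition cf1 i j : P := cf C i j - ((1 : M) i j)%:MP.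

Lemma ev_cf1 i j : ev (cf1 i j) 1 = 0.
Proof. by rewrite evB ev_cf evC subrr. Qed.

Lemma taylor1 p : exists c : 'I_n.+1 -> 'I_n.+1 -> P,
  p = (ev p 1)%:MP + \sum_i \sum_j c i j * cf1 i j.
Proof.
elim/mxpoly_ind: p => [c|i j|p q [c cE] [d dE]|p q [c cE] [d dE]].
- exists (fun _ _ => 0); rewrite evC big1 ?addr0 // => i _.
  by rewrite big1 // => j _; rewrite mul0r.
- exists (fun k l => ((k == i) && (l == j))%:R); rewrite ev_cf.
  rewrite (eq_bigr (fun k => \sum_l ((k == i) && (l == j))%:R *: cf1 k l)).
    by rewrite sum_delta addrC subrK.
  move=> k _; apply: eq_bigr => l _.
  by case: (_ && _); rewrite ?mul1r ?mul0r ?scale1r ?scale0r.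
- exists (fun i j => c i j + d i j); rewrite evD mpolyCD {1}cE {1}dE addrACA.
  congr (_ + _); rewrite -big_split; apply: eq_bigr => i _; rewrite -big_split.
  by apply: eq_bigr => j _; rewrite mulrDl.
- exists (fun i j => c i j * q + (ev p 1)%:MP * d i j).
  rewrite evM mpolyCM {1}cE mulrDl {1}dE mulrDr -addrA; congr (_ + _).
  rewrite mulr_sumr mulr_suml addrC -big_split; apply: eq_bigr => i _ /=.
  rewrite mulr_sumr mulr_suml -big_split; apply: eq_bigr => j _ /=.
  by rewrite mulrDl mulrAC mulrA.
Qed.

(* [mpow j] is the sum of the j-th power of the maximal ideal of the point [1]
   and of the ideal of [K]. *)
Fixpoint mpow j p := if j is j'.+1 then
  exists (c : 'I_n.+1 -> 'I_n.+1 -> P) q, [/\ vanish K q, forall i j, mpow j' (c i j) &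
    p = \sum_i \sum_j c i j * cf1 i j + q] else True.

Lemma mpow_vanish j q : vanish K q -> mpow j q.
Proof.
elim: j q => //= j IH q Kq; exists (fun _ _ => 0), q; split=> //.
  by move=> _ _; apply/IH/vanish0.
by rewrite big1 ?add0r // => i _; rewrite big1 // => k _; rewrite mul0r.
Qed.

Lemma mpowD j p q : mpow j p -> mpow j q -> mpow j (p + q).
Proof.
elim: j p q => //= j IH p q [c [p1 [Kp1 cm ->]]] [d [q1 [Kq1 dm ->]]].
exists (fun i j => c i j + d i j), (p1 + q1); split.
- by move=> g Kg; rewrite evD Kp1 // Kq1 // addr0.
- by move=> i k; apply: IH.
- rewrite addrACA; congr (_ + _); rewrite -big_split; apply: eq_bigr => i _.
  by rewrite -big_split; apply: eq_bigr => k _; rewrite mulrDl.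
Qed.

Lemma mpowMl j p q : mpow j q -> mpow j (p * q).
Proof.
elim: j p q => //= j IH p q [d [q1 [Kq1 dm ->]]].
exists (fun i j => p * d i j), (p * q1); split.
- exact: vanishM.
- by move=> i k; apply: IH.
- rewrite mulrDr mulr_sumr; congr (_ + _); apply: eq_bigr => i _.
  by rewrite mulr_sumr; apply: eq_bigr => k _; rewrite mulrA.
Qed.

Lemma mpowN j p : mpow j p -> mpow j (- p).
Proof. by move=> mp; rewrite -mulN1r; apply: mpowMl. Qed.

Lemma mpow_sum j (I : Type) (r : seq I) (Q : pred I) (F : I -> P) :
  (forall i, Q i -> mpow j (F i)) -> mpow j (\sum_(i <- r | Q i) F i).
Proof.
move=> H; apply: big_ind => //; first by apply/mpow_vanish/vanish0.
by move=> ? ?; apply: mpowD.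
Qed.

Lemma mpowM j k p q : mpow j p -> mpow k q -> mpow (j + k) (p * q).
Proof.
elim: j p => [|j IH] p; first by move=> _; apply: mpowMl.
move=> /= [c [p1 [Kp1 cm ->]]] mq; exists (fun i j => c i j * q), (p1 * q); split.
- by rewrite mulrC; apply: vanishM.
- by move=> i l; apply: IH.
- rewrite mulrDl mulr_suml; congr (_ + _); apply: eq_bigr => i _.
  by rewrite mulr_suml; apply: eq_bigr => l _; rewrite mulrAC.
Qed.

Lemma mpow1 p : ev p 1 = 0 -> mpow 1 p.
Proof.
move=> p1; have [c cE] := taylor1 p; exists c, 0; split=> //; first exact: vanish0.
by rewrite {1}cE p1 mpolyC0 add0r addr0.
Qed.

Lemma dev_cf1 i j x : dev (cf1 i j) 1 x = x i j.
Proof. by rewrite devB dev_cf devC subr0. Qed.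

Lemma mpow2 p : ev p 1 = 0 -> (forall x, dev p 1 x = 0) -> mpow 2 p.
Proof.
move=> p1 dp; have [c cE] := taylor1 p; rewrite p1 mpolyC0 add0r in cE.
exists c, 0; split; rewrite ?addr0 //; first exact: vanish0.
move=> a b; apply: mpow1; have := dp (delta_mx a b); rewrite cE dev_sum => <-.
rewrite -[LHS](@sum_delta _ _ C^o (fun i j => ev (c i j) 1)); apply: eq_bigr => i _.
rewrite dev_sum; apply: eq_bigr => j _.
by rewrite devM ev_cf1 mulr0 add0r dev_cf1 mxE mulrC.
Qed.

Definition linpoly (f : M -> C) : P := \sum_i \sum_j f (delta_mx i j) *: cf1 i j.

Lemma ev_linpoly f : ev (linpoly f) 1 = 0.
Proof. by rewrite ev_sum big1 // => i _; rewrite ev_sum big1 // => j _; rewrite evZ ev_cf1 mulr0. Qed.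

Lemma dev_linpoly (f : {linear M -> C^o}) x : dev (linpoly f) 1 x = f x.
Proof.
rewrite {2}(matrix_sum_delta x) linear_sum dev_sum; apply: eq_bigr => i _.
rewrite linear_sum dev_sum; apply: eq_bigr => j _.
by rewrite devZ dev_cf1 linearZ mulrC.
Qed.

(** Double duality: a linear form outside the space of differentials at [1] of the ideal is
    separated from that space by a matrix, which then belongs to [lie K], where the form
    vanishes. *)
Lemma lie_annihilator (f : {linear M -> C^o}) : (forall x, lie K x -> f x = 0) ->
  exists2 p, vanish K p & forall x, dev p 1 x = f x.
Proof.
pose pr (W x : M) : C := \sum_i \sum_j x i j * W i j.
have prC W x : pr W x = pr x W.
  by apply: eq_bigr => i _; apply: eq_bigr => j _; rewrite mulrC.
have fE (h : {linear M -> C^o}) x : h x = pr (\matrix_(i, j) h (delta_mx i j)) x.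
  rewrite {1}(matrix_sum_delta x) linear_sum; apply: eq_bigr => i _.
  by rewrite linear_sum; apply: eq_bigr => j _; rewrite linearZ mxE.
pose S (W : M) := exists2 p, vanish K p & forall x, dev p 1 x = pr W x.
have [||U US] := @vspace_of_set _ _ S.
- exists 0; first exact: vanish0.
  move=> x; rewrite -mpolyC0 devC /pr big1 // => i _.
  by rewrite big1 // => j _; rewrite mxE mulr0.
- move=> c W W' [p Kp pW] [q Kq qW']; exists (c *: p + q).
    by move=> g Kg; rewrite evD evZ Kp // Kq // mulr0 addr0.
  move=> x; rewrite devDl devZ pW qW' /pr mulr_sumr -big_split; apply: eq_bigr => i _ /=.
  rewrite mulr_sumr -big_split; apply: eq_bigr => j _ /=.
  by rewrite !mxE mulrDr mulrCA.
move=> f0; set Wf : M := \matrix_(i, j) f (delta_mx i j).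
have [/US [p Kp pf]|/separate_vspace [h [hU]]] := boolP (Wf \in U).
  by exists p => // x; rewrite pf -fE.
pose x0 : M := \matrix_(i, j) h (delta_mx i j).
have hE W : h W = pr W x0 by rewrite fE prC.
rewrite hE -fE f0 ?eqxx // => p Kp.
pose W : M := \matrix_(i, j) ev (mderiv (mxvec_index i j) p) 1.
have pW x : dev p 1 x = pr W x.
  by apply: eq_bigr => i _; apply: eq_bigr => j _; rewrite mxE.
by rewrite pW -hE; apply/hU/US; exists p.
Qed.

(** Vanishing at [1] to infinite order along the left-invariant fields of [lie K]. *)
Definition jet_zero p := forall l : seq M, (forall x, x \in l -> lie K x) ->
  ev (foldr (@D C n.+1) p l) 1 = 0.

Lemma jet_zeroD x p : lie K x -> jet_zero p -> jet_zero (D x p).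
Proof.
move=> Kx Jp l lK; rewrite -foldr_rcons; apply: Jp => y.
by rewrite mem_rcons in_cons => /orP [/eqP ->|/lK].
Qed.

Lemma euler_field : exists r (z : 'I_r -> P) (X : 'I_r -> M),
  [/\ forall a, ev (z a) 1 = 0, forall a, lie K (X a) &
    forall i j, mpow 2 (\sum_a z a * D (X a) (cf1 i j) - cf1 i j)].
Proof.
have [||k kP] := @vspace_of_set _ _ (lie K).
- exact: lie0.
- by move=> c x y; apply: lie_linear.
have [r [X Xk Xf]] : exists r, exists2 X : r.-tuple M, <<X>>%VS = k & free X.
  by exists (\dim k), (vbasis k); [apply: span_basis; apply: vbasisP|apply: basis_free; apply: vbasisP].
have XK a : lie K X`_a.
  have [lt|ge] := ltnP a (size X); last by rewrite nth_default //; apply: lie0.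
  by apply/kP; rewrite -Xk memv_span // mem_nth.
pose Z (a : 'I_r) : M -> C^o := vector.coord X a.
exists r, (fun a => linpoly (Z a)), (fun a : 'I_r => X`_a); split=> [a|a|i j].
- exact: ev_linpoly.
- exact: XK.
pose f (x : M) : C^o := \sum_(a < r) X`_a i j * Z a x - x i j.
have fl : linear f.
  move=> c x y; rewrite /f scalerBr scaler_sumr !mxE addrACA -opprD -big_split.
  congr (_ - _); apply: eq_bigr => a _.
  by rewrite /Z linearP mulrDr; congr (_ + _); rewrite scalerAr.
pose f' := HB.pack_for {linear M -> C^o} f (GRing.isLinear.Build _ _ _ _ f fl).
have [p Kp pf] : exists2 p, vanish K p & forall x, dev p 1 x = f' x.
  apply: lie_annihilator => x /kP; rewrite -Xk => xX; rewrite /= /f {2}(coord_span xX).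
  rewrite summxE; apply/eqP; rewrite subr_eq0; apply/eqP; apply: eq_bigr => a _.
  by rewrite mxE mulrC.
have DX (a : 'I_r) : D X`_a (cf1 i j) = (X`_a i j)%:MP + \sum_l X`_a l j *: cf1 i l.
  rewrite DB DC subr0 D_cf /ent.
  rewrite (eq_bigr (fun l => X`_a l j *: cf1 i l + X`_a l j *: ((1 : M) i l)%:MP)); last first.
    by move=> l _; rewrite -scalerDr subrK.
  rewrite big_split addrC /=; congr (_ + _).
  rewrite (bigD1 i) //= mxE eqxx big1 ?addr0 => [|l li]; last first.
    by rewrite mxE eq_sym (negPf li) mpolyC0 scaler0.
  by rewrite -mul_mpolyC -mpolyCM mulr1.
under eq_bigr => a _ do rewrite DX mulrDr.
rewrite big_split addrAC; apply: mpowD; last first.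
  apply: mpow_sum => a _; rewrite mulr_sumr; apply: mpow_sum => l _.
  rewrite -mul_mpolyC; apply: (@mpowM 1 1); first exact/mpow1/ev_linpoly.
  by apply/mpowMl/mpow1/ev_cf1.
rewrite -[X in mpow 2 X](subrK p); apply: mpowD; last exact: mpow_vanish.
apply: mpow2 => [|x].
  rewrite evB Kp ?subr0; last by case: KM.
  rewrite evB ev_cf1 subr0 ev_sum big1 // => a _.
  by rewrite evM ev_linpoly mul0r.
rewrite devB devB pf dev_cf1 dev_sum; apply/eqP; rewrite subr_eq0 /= /f; apply/eqP.
congr (_ - _); apply: eq_bigr => a _.
by rewrite devM devC mulr0 addr0 evC dev_linpoly mulrC.
Qed.

(** The Euler field multiplies [mpow j] by [j] modulo [mpow j.+1], but it sends [p] into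
    [mpow j.+1], because the derivatives of [p] are again [jet_zero]. So [j] times [p] is in
    [mpow j.+1], and [j] is invertible except at the start, where [p] vanishes at [1]. *)
Lemma jet_zero_mpow p j : jet_zero p -> mpow j p.
Proof.
have [r [z [X [z1 XK EX]]]] := euler_field.
pose E p := \sum_a z a * D (X a) p.
have ED p1 q : E (p1 + q) = E p1 + E q.
  by rewrite -big_split; apply: eq_bigr => a _; rewrite DD mulrDr.
have EM p1 q : E (p1 * q) = E p1 * q + p1 * E q.
  rewrite mulr_suml mulr_sumr -big_split; apply: eq_bigr => a _.
  by rewrite /= DM mulrDr; congr (_ + _); [apply: mulrA|apply: mulrCA].
have Esum (I : Type) (s : seq I) (F : I -> P) : E (\sum_(i <- s) F i) = \sum_(i <- s) E (F i).
  apply: (big_morph E ED); rewrite /E big1 // => a _.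
  by rewrite D0 mulr0.
have EK q : vanish K q -> vanish K (E q).
  move=> Kq g Kg; rewrite ev_sum big1 // => a _.
  by rewrite evM (lieP KM (XK a) Kq) // mulr0.
have Eshift u v k : E (v * u) - v * u *+ k.+1 = (E v - v *+ k) * u + v * (E u - u).
  rewrite EM mulrBl mulrBr mulrS opprD mulrnAl [RHS]addrACA; congr (_ + _).
  exact: addrC.
have Em j1 q : mpow j1 q -> mpow j1.+1 (E q - q *+ j1).
  elim: j1 q => [|j1 IH] q.
    by move=> _; rewrite subr0; apply: mpow_sum => a _; rewrite mulrC; apply/mpowMl/mpow1.
  move=> [c [i [Ki cm ->]]]; rewrite ED mulrnDl opprD addrACA; apply: mpowD; last first.
    apply: mpow_vanish; apply: vanishB; first exact: EK.
    by rewrite -scaler_nat; apply: vanishZ.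
  rewrite Esum -sumrMnl -sumrB; apply: mpow_sum => a _.
  rewrite Esum -sumrMnl -sumrB; apply: mpow_sum => b _.
  rewrite Eshift.
  apply: mpowD; last by rewrite -addn2; apply: mpowM; [apply: cm|apply: EX].
  by rewrite -addn1; apply: mpowM; [apply: IH; apply: cm|apply: mpow1; apply: ev_cf1].
elim: j p => [//|j IH] p Jp; have [->|j0] := posnP j.
  by apply: mpow1; apply: (Jp [::]).
have mE : mpow j.+1 (E p).
  apply: mpow_sum => a _; rewrite -[j.+1]/(1 + j)%N; apply: mpowM; first exact: mpow1.
  exact/IH/jet_zeroD.
have /(Em j)/mpowN := IH p Jp; rewrite opprB => /mpowD /(_ mE); rewrite subrK => mj.
have -> : p = (j%:R^-1 : C)%:MP * (p *+ j).
  by rewrite mul_mpolyC -scaler_nat scalerA mulVf ?scale1r // pnatr_eq0 -lt0n.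
exact: mpowMl.
Qed.

(* Perdry's proof of Krull's intersection theorem. *)
Lemma krull_intersection p : (forall j, mpow j p) -> vanish K p.
Proof.
move=> mp.
have [Y YP] : exists Y : 'I_N -> P, (forall i j, exists k, cf1 i j = Y k) /\
    forall k, ev (Y k) 1 = 0.
  exists (fun k => 'X_k - ((mxvec 1 0 k : C))%:MP); split=> [i j|k].
    by exists (mxvec_index i j); rewrite mxvecE.
  by rewrite evB /ev mevalXU mevalC subrr.
have [YS Y1] := YP.
(* As in a Rees algebra, a form of degree [j] is sent to a multiple of ['X^j] with coefficient in
   the [j]-th power of the maximal ideal. *)
have [phi [phiD phiM phiC phiX]] : exists phi : {mpoly P[N]} -> {poly P},
    [/\ {morph phi : a b / a + b}, {morph phi : a b / a * b},
      forall a, phi a%:MP = a%:P & forall k, phi 'X_k = Y k *: 'X].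
  exists (mmap (@polyC P) (fun k => Y k *: 'X)); split=> [a b|a b|a|k].
  - exact: mmapD.
  - by rewrite rmorphM.
  - exact: mmapC.
  - by rewrite mmapX mmap1U.
have phi_sum (I : Type) (s : seq I) (F : I -> {mpoly P[N]}) :
    phi (\sum_(i <- s) F i) = \sum_(i <- s) phi (F i).
  by apply: (big_morph phi phiD); rewrite -mpolyC0 phiC.
have phi1 a k : ev (phi a)`_k.+1 1 = 0.
  elim/mpoly_alg_ind: a k => [c|i|a b ea eb|a b ea eb] k.
  - by rewrite phiC coefC ev0.
  - rewrite phiX coefZ coefX; case: (_ == _); last by rewrite mulr0 ev0.
    by rewrite mulr1 Y1.
  - by rewrite phiD coefD evD ea eb addr0.
  - rewrite phiM coefM ev_sum big1 // => -[[|i] lti] _ /=; rewrite evM.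
      by rewrite subn0 eb mulr0.
    by rewrite ea mul0r.
have lift j q : mpow j q -> exists Q i, [/\ vanish K i & phi Q = (q - i) *: 'X^j].
  elim: j q => [|j IH] q.
    move=> _; exists q%:MP, 0; split; first exact: vanish0.
    by rewrite phiC subr0 expr0 -mul_polyC mulr1.
  move=> /= [c [i [Ki cm ->]]].
  have /choice [Q QP] : forall ab, exists Q : {mpoly P[N]}, exists i, [/\ vanish K i &
      phi Q = (c ab.1 ab.2 - i) *: 'X^j].
    by move=> ab; apply: IH.
  have /choice [d dP] := QP.
  have /choice [k kP] : forall ab : 'I_n.+1 * 'I_n.+1, exists k, cf1 ab.1 ab.2 = Y k.
    by move=> ab; apply: YS.
  exists (\sum_ab Q ab * 'X_(k ab)), (i + \sum_ab d ab * cf1 ab.1 ab.2); split.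
    move=> g Kg; rewrite evD Ki // add0r ev_sum big1 // => ab _.
    by rewrite evM; have [-> // _] := dP ab; rewrite mul0r.
  rewrite pair_bigA /= opprD addrA addrK -sumrB.
  rewrite phi_sum scaler_suml; apply: eq_bigr => ab _.
  rewrite phiM phiX; have [_ ->] := dP ab; rewrite -kP -mulrBl.
  by rewrite -scalerAl -scalerAr scalerA exprSr.
have /choice [Q QP] : forall j, exists Q : {mpoly P[N]}, exists i,
    [/\ vanish K i & phi Q = (p - i) *: 'X^j] by move=> j; apply/lift/mp.
have /choice [i iP] := QP.
(* Some lift [Q m] depends on the earlier ones; the coefficient of ['X^m] then expresses [p], modulo
   the ideal of [K], as a multiple of itself by a polynomial vanishing at [1]. *)
have [m [c cE]] := @noetherian_mpoly _ N (@noetherian_mpoly _ N (@noetherian_field C)) Q.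
have := congr1 (fun a => (phi a)`_m) cE => /=.
have [_ ->] := iP m; rewrite coefZ coefXn eqxx mulr1 phi_sum coef_sum.
rewrite (eq_bigr (fun k : 'I_m => (phi (c k))`_(m - k) * (p - i k))); last first.
  move=> k _; rewrite phiM; have [_ ->] := iP k.
  by rewrite -scalerAr coefZ coefMXn ltnNge ltnW //= mulrC.
move=> e; pose a := \sum_(k < m) (phi (c k))`_(m - k).
have a1 : ev a 1 = 0.
  rewrite ev_sum big1 // => k _; have : (0 < m - k)%N by rewrite subn_gt0.
  by case: (m - k)%N.
have : vanish K ((1 - a) * p).
  have -> : (1 - a) * p = i m - \sum_(k < m) (phi (c k))`_(m - k) * i k.
    rewrite mulrBl mul1r mulr_suml -[p in LHS](subrK (i m)) {1}e addrAC.
    rewrite -sumrB -addrC; congr (_ + _); rewrite -sumrN; apply: eq_bigr => k _.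
    by rewrite mulrBr addrAC subrK subrr sub0r.
  apply: vanishB; first by have [] := iP m.
  move=> g Kg; rewrite ev_sum big1 // => k _; rewrite evM.
  by have [-> // _] := iP k; rewrite mulr0.
case/KI => // /(_ 1); rewrite evB ev1 a1 subr0 => /(_ KM.1) /eqP.
by rewrite oner_eq0.
Qed.

Theorem jet_zero_vanish p : jet_zero p -> vanish K p.
Proof. by move=> Jp; apply: krull_intersection => j; apply: jet_zero_mpow. Qed.

End Crux.

(** * The Zariski topology of an affine group *)

Section Zariski.
Context {R : realType} {G : affine_group R}.
Local Notation C := R[i].
Implicit Types (A B X Y Z K : set G) (f g : G -> C) (a b x y : G).

Definition reg f := regular_fun (@coord R G) f.

Lemma regC (c : C) : reg (fun=> c).
Proof. by exists (mpolyC _ c) => t; rewrite /eval_at mevalC. Qed.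

Lemma reg_coord j : reg (fun x => coord x 0 j).
Proof. by exists (mpolyX _ (mnm1 j)) => t; rewrite /eval_at mevalXU. Qed.

Lemma regD f g : reg f -> reg g -> reg (fun x => f x + g x).
Proof. by move=> [p fp] [q gq]; exists (p + q) => t; rewrite /eval_at mevalD -[meval _ p]fp -[meval _ q]gq. Qed.

Lemma regM f g : reg f -> reg g -> reg (fun x => f x * g x).
Proof. by move=> [p fp] [q gq]; exists (p * q) => t; rewrite /eval_at mevalM -[meval _ p]fp -[meval _ q]gq. Qed.

Lemma regZ c f : reg f -> reg (fun x => c * f x).
Proof. by move=> rf; apply: regM => //; apply: regC. Qed.

Lemma regB f g : reg f -> reg g -> reg (fun x => f x - g x).
Proof.
move=> rf rg; have := regD rf (regZ (-1) rg).
by congr reg; apply/funext => x; rewrite mulN1r.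
Qed.

Lemma reg_sum (I : Type) (r : seq I) (P : pred I) (F : I -> G -> C) :
  (forall i, reg (F i)) -> reg (fun x => \sum_(i <- r | P i) F i x).
Proof.
move=> rF; elim: r => [|i r IH].
  by under eq_fun => x do rewrite big_nil; apply: regC.
under eq_fun => x do rewrite big_cons.
by case: (P i) => //; apply: regD.
Qed.

Lemma reg_prod (I : Type) (r : seq I) (P : pred I) (F : I -> G -> C) :
  (forall i, reg (F i)) -> reg (fun x => \prod_(i <- r | P i) F i x).
Proof.
move=> rF; elim: r => [|i r IH].
  by under eq_fun => x do rewrite big_nil; apply: regC.
under eq_fun => x do rewrite big_cons.
by case: (P i) => //; apply: regM.
Qed.

Lemma reg_meval n (p : {mpoly C[n]}) (F : 'I_n -> G -> C) :
  (forall k, reg (F k)) -> reg (fun x => meval (fun k => F k x) p).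
Proof.
move=> rF; elim/mpoly_alg_ind: p => [c|i|p q rp rq|p q rp rq].
- by under eq_fun => x do rewrite mevalC; apply: regC.
- by under eq_fun => x do rewrite mevalXU; apply: rF.
- by under eq_fun => x do rewrite mevalD; apply: regD.
- by under eq_fun => x do rewrite mevalM; apply: regM.
Qed.

Definition regmap (phi : G -> G) := forall j, reg (fun x => coord (phi x) 0 j).

Lemma reg_comp f phi : reg f -> regmap phi -> reg (fun x => f (phi x)).
Proof.
move=> [p fp] rphi; under eq_fun => x do rewrite fp.
exact: (@reg_meval _ p (fun k x => coord (phi x) 0 k)).
Qed.

Lemma regmap_id : regmap id. Proof. exact: reg_coord. Qed.

Lemma regmapC a : regmap (fun=> a). Proof. by move=> j; apply: regC. Qed.

Lemma regmapM phi psi : regmap phi -> regmap psi -> regmap (fun x => phi x * psi x)%g.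
Proof.
move=> rphi rpsi j; have [p pE] := mul_regular (a := G) j.
under eq_fun => x do rewrite (pE (phi x, psi x)) /eval_at.
apply: (@reg_meval _ p (fun k x => row_mx (coord (phi x)) (coord (psi x)) 0 k)) => k.
under eq_fun => x do rewrite mxE.
by case: (split k) => l; [apply: rphi|apply: rpsi].
Qed.

Lemma regmapV phi : regmap phi -> regmap (fun x => (phi x)^-1)%g.
Proof. by move=> rphi j; apply: (reg_comp (f := fun x => coord x^-1%g 0 j)) => //; apply: inv_regular. Qed.

Lemma regmapJ phi psi : regmap phi -> regmap psi -> regmap (fun x => phi x ^ psi x)%g.
Proof. by move=> rphi rpsi; apply: regmapM; [apply: regmapV|apply: regmapM]. Qed.

Definition zvanish X f := reg f /\ forall x, X x -> f x = 0.
Definition zclosure X : set G := [set x | forall f, zvanish X f -> f x = 0].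

Lemma zclosedP X : zclosed X <-> zclosure X `<=` X.
Proof.
split=> [[S ->] x Hx p Sp|H]; first by apply: (Hx (fun x => eval_at p (coord x))); split; [exists p|move=> y /(_ p Sp)].
exists [set p | zvanish X (fun x => eval_at p (coord x))].
apply/seteqP; split=> [x Xx p [_ /(_ x Xx)] //|x Hx]; apply: H => f [[p fp] fX].
by rewrite fp; apply: Hx; split=> [|y /fX]; [exists p|rewrite fp].
Qed.

Lemma zclosed_zeros (S : set (G -> C)) : (forall f, S f -> reg f) ->
  zclosed [set x | forall f, S f -> f x = 0].
Proof.
by move=> Sr; apply/zclosedP => x Hx f Sf; apply: (Hx f); split=> [|y /(_ f Sf) //]; apply: Sr.
Qed.

Lemma sub_zclosure X : X `<=` zclosure X. Proof. by move=> x Xx f [_ /(_ x Xx)]. Qed.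

Lemma zclosure_closed X : zclosed (zclosure X).
Proof. by apply: zclosed_zeros => f [rf _]. Qed.

Lemma zclosure_min X Y : zclosed Y -> X `<=` Y -> zclosure X `<=` Y.
Proof.
move=> /zclosedP Yc XY x Hx; apply: Yc => f [rf fY]; apply: (Hx f); split=> // y /XY.
exact: fY.
Qed.

Lemma zclosed0 : zclosed (set0 : set G).
Proof.
apply/zclosedP => x /(_ (fun=> 1)) H; suff /eqP : (1 : C) = 0 by rewrite oner_eq0.
by apply: H; split=> //; apply: regC.
Qed.

Lemma zclosedT : zclosed (setT : set G). Proof. exact/zclosedP. Qed.

Lemma zclosed_bigcap (I : Type) (F : I -> set G) : (forall i, zclosed (F i)) ->
  zclosed [set x | forall i, F i x].
Proof.
move=> Fc; apply/zclosedP => x Hx i; have /zclosedP := Fc i; apply.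
move=> f [rf fF]; apply: (Hx f); split=> // y /(_ i); exact: fF.
Qed.

Lemma zclosedI A B : zclosed A -> zclosed B -> zclosed (A `&` B).
Proof.
move=> Ac Bc; apply/zclosedP => x Hx; split.
  by have /zclosedP := Ac; apply=> f [rf fA]; apply: (Hx f); split=> // y [/fA].
by have /zclosedP := Bc; apply=> f [rf fA]; apply: (Hx f); split=> // y [_ /fA].
Qed.

Lemma zclosedU A B : zclosed A -> zclosed B -> zclosed (A `|` B).
Proof.
move=> /zclosedP Ac /zclosedP Bc; apply/zclosedP => x Hx.
have [xA|nA] := pselect (zclosure A x); first by left; apply: Ac.
right; apply: Bc => g [rg gB]; apply: contrapT => gx; apply: nA => f [rf fA].
have /eqP : f x * g x = 0.
  apply: (Hx (fun x => f x * g x)); split; first exact: regM.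
  by move=> y [/fA ->|/gB ->]; rewrite ?mul0r ?mulr0.
by rewrite mulf_eq0 => /orP [/eqP|/eqP].
Qed.

Lemma zclosed_preim phi A : regmap phi -> zclosed A -> zclosed [set x | A (phi x)].
Proof.
move=> rphi /zclosedP Ac; apply/zclosedP => x Hx; apply: Ac => f [rf fA].
apply: (Hx (fun x => f (phi x))); split; first exact: reg_comp.
by move=> y /fA.
Qed.

Lemma zclosed_eq f g : reg f -> reg g -> zclosed [set x | f x = g x].
Proof.
move=> rf rg; apply/zclosedP => x Hx; apply/eqP; rewrite -subr_eq0; apply/eqP.
by apply: (Hx (fun x => f x - g x)); split=> [|y ->]; [apply: regB|apply: subrr].
Qed.

Lemma zclosed_set1 a : zclosed [set a].
Proof.
apply/zclosedP => x Hx; apply: coord_inj; apply/rowP => j; apply/eqP.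
rewrite -subr_eq0; apply/eqP; apply: (Hx (fun x => coord x 0 j - coord a 0 j)).
by split=> [|y ->]; [apply: regB; [apply: reg_coord|apply: regC]|rewrite subrr].
Qed.

(** Otherwise choose [p k] vanishing on [X k.+1] but not on [X k]: some [p N] is in the ideal of the
    earlier ones, which all vanish on [X N]. *)
Lemma dcc (X : nat -> set G) : (forall k, zclosed (X k)) -> (forall k, X k.+1 `<=` X k) ->
  exists k, X k `<=` X k.+1.
Proof.
move=> Xc Xd; apply: contrapT => H.
have /choice [p pP] : forall k, exists p : {mpoly C[ambient G]},
    (forall x, X k.+1 x -> eval_at p (coord x) = 0) /\
    exists2 x, X k x & eval_at p (coord x) != 0.
  move=> k; apply: contrapT => np; apply: H; exists k => x Xx.
  have /zclosedP := Xc k.+1; apply=> f [[p fp] fX]; apply: contrapT => /eqP fx.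
  apply: np; exists p; split=> [y /fX|]; first by rewrite fp.
  by exists x; rewrite -?fp.
have [N [c cE]] := @noetherian_mpoly _ (ambient G) (@noetherian_field C) p.
have [_ [x Xx /eqP]] := pP N; apply; rewrite cE /eval_at.
rewrite (big_morph _ (mevalD _) (meval0 _)) big1 // => i _.
rewrite mevalM -[X in _ * X]/(eval_at _ _); have [-> //] := pP i; first by rewrite mulr0.
have mono j k : (j <= k)%N -> X k `<=` X j.
  elim: k => [|k IH]; first by rewrite leqn0 => /eqP ->.
  by rewrite leq_eqVlt => /orP [/eqP ->//|/IH] h y /Xd /h.
exact: (mono _ _ (ltn_ord i)).
Qed.

Definition finite_irred X := exists (m : nat) (Z : nat -> set G),
  [/\ forall i, (i < m)%N -> zclosed (Z i), forall i, (i < m)%N -> zirreducible (Z i) &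
      forall x, X x <-> exists2 i, (i < m)%N & Z i x].

Lemma finite_irredU X Y : finite_irred X -> finite_irred Y -> finite_irred (X `|` Y).
Proof.
move=> [m [Z [Zc Zi ZX]]] [l [W [Wc Wi WY]]].
exists (m + l)%N, (fun i => if (i < m)%N then Z i else W (i - m)%N).
have lt i : (i < m + l)%N -> (i < m)%N = false -> (i - m < l)%N.
  by move=> il im; rewrite ltn_subLR // leqNgt im.
split=> [i il|i il|x].
- by case im: (i < m)%N; [apply: Zc|apply: Wc; apply: lt].
- by case im: (i < m)%N; [apply: Zi|apply: Wi; apply: lt].
split=> [[/ZX [i im Zx]|/WY [i im Wx]]|[i il]].
- by exists i; rewrite ?im // (leq_trans im) ?leq_addr.
- by exists (m + i)%N; rewrite ?ltn_add2l // ltnNge leq_addr /= addKn.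
- case im: (i < m)%N => Hx; first by left; apply/ZX; exists i.
  by right; apply/WY; exists (i - m)%N => //; apply: lt.
Qed.

(** Noetherian induction: a closed set that is not a finite union of irreducible ones properly
    contains another such set, against [dcc]. *)
Lemma closed_finite_irred X : zclosed X -> finite_irred X.
Proof.
move=> Xc; apply: contrapT => nX.
have step Y : zclosed Y /\ ~ finite_irred Y ->
    exists Y', [/\ zclosed Y', ~ finite_irred Y', Y' `<=` Y & ~ Y `<=` Y'].
  move=> [Yc nY]; have [Y0|/set0P [y Yy]] := eqVneq Y set0.
    by case: nY; exists 0%N, (fun=> set0); split=> // x; split=> [|[]//]; rewrite Y0.
  have : ~ zirreducible Y.
    move=> Yi; apply: nY; exists 1%N, (fun=> Y); split=> // x.
    by split=> [?|[]//]; exists 0%N.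
  move=> nYi; apply: contrapT => nY'; apply: nYi; split; first by exists y.
  move=> A B Ac Bc YAB; apply: contrapT => /not_orP [nA nB].
  have fin Z : zclosed Z -> ~ Y `<=` Z -> finite_irred (Y `&` Z).
    move=> Zc nZ; apply: contrapT => nf; apply: nY'; exists (Y `&` Z).
    by split=> [||x []//|YZ] //; [apply: zclosedI|apply: nZ => x /YZ []].
  apply: nY; have -> : Y = (Y `&` A) `|` (Y `&` B).
    apply/seteqP; split=> [x Yx|x [[]|[]] //].
    by have [] := YAB x Yx => ?; [left|right].
  by apply: finite_irredU; apply: fin.
pose bad := {Y : set G | zclosed Y /\ ~ finite_irred Y}.
have /choice [s sP] : forall Y : bad, exists Y' : bad,
    sval Y' `<=` sval Y /\ ~ sval Y `<=` sval Y'.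
  move=> [Y bY]; have [Y' [Y'c nY' sub nsub]] := step Y bY.
  by exists (exist _ Y' (conj Y'c nY')).
pose Xs k := sval (iter k s (exist _ X (conj Xc nX))).
have [k] := @dcc Xs (fun k => (svalP (iter k s _)).1) (fun k => (sP _).1).
exact: (sP _).2.
Qed.

End Zariski.

(** * Irreducible sets and the identity component *)

Section Components.
Context {R : realType} {G : affine_group R}.
Local Notation C := R[i].
Implicit Types (A B X Y Z K : set G) (f g : G -> C) (a b x y : G).

Lemma zirreducibleP X : zirreducible X <-> X !=set0 /\ forall f g, reg f -> reg g ->
  (forall x, X x -> f x * g x = 0) -> (forall x, X x -> f x = 0) \/ (forall x, X x -> g x = 0).
Proof.
split=> -[X0 H]; split=> //.
  move=> f g rf rg fg.
  have zc h : reg h -> zclosed [set x | h x = 0].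
    by move=> rh; apply: zclosed_eq => //; apply: regC.
  apply: H; [exact: zc|exact: zc|move=> x /fg /eqP].
  by rewrite mulf_eq0 => /orP [] /eqP; [left|right].
move=> A B Ac Bc XAB; apply: contrapT => /not_orP [nA nB].
have wit Z : zclosed Z -> ~ X `<=` Z -> exists f, zvanish Z f /\ exists2 x, X x & f x <> 0.
  move=> /zclosedP Zc XZ; apply: contrapT => nf; apply: XZ => x Xx; apply: Zc => f zf.
  by apply: contrapT => fx; apply: nf; exists f; split=> //; exists x.
have [f [[rf fA] [x Xx fx]]] := wit A Ac nA; have [g [[rg gB] [y Xy gy]]] := wit B Bc nB.
have [] // := H f g rf rg; last first.
- by move=> /(_ y Xy).
- by move=> /(_ x Xx).
by move=> z /XAB [/fA ->|/gB ->]; rewrite ?mul0r ?mulr0.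
Qed.

Lemma zirreducible_image X phi : regmap phi -> zirreducible X -> zirreducible (phi @` X).
Proof.
move=> rphi [[x Xx] H]; split; first by exists (phi x), x.
move=> A B Ac Bc XAB.
have [|||XA|XB] := H [set x | A (phi x)] [set x | B (phi x)].
- exact: zclosed_preim.
- exact: zclosed_preim.
- by move=> y Xy; apply: XAB; exists y.
- by left=> _ [y Xy <-]; apply: XA.
- by right=> _ [y Xy <-]; apply: XB.
Qed.

Lemma zirreducible_closure X : zirreducible X -> zirreducible (zclosure X).
Proof.
move=> [[x Xx] H]; split; first by exists x; apply: sub_zclosure.
move=> A B Ac Bc XAB; have [||y /sub_zclosure /XAB //|XA|XB] := H A B => //.
  by left; apply: zclosure_min.
by right; apply: zclosure_min.
Qed.

Definition prodset X Y : set G := [set z | exists x y, [/\ X x, Y y & z = (x * y)%g]].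

(** The argument is by slices: each [x * Y] lies in [A] or in [B], the [x] for which it lies in [A]
    form a closed set, and [X] is irreducible. *)
Lemma zirreducible_prod X Y : zirreducible X -> zirreducible Y -> zirreducible (prodset X Y).
Proof.
move=> [[x0 Xx0] HX] [[y0 Yy0] HY]; split; first by exists (x0 * y0)%g, x0, y0.
move=> A B Ac Bc XAB.
have Fc Z : zclosed Z -> zclosed [set x | forall y : {y | Y y}, Z (x * sval y)%g].
  move=> Zc; apply: (@zclosed_bigcap _ _ _ (fun y : {y | Y y} => [set x | Z (x * sval y)%g])).
  by move=> y; apply: zclosed_preim => //; apply: regmapM; [apply: regmap_id|apply: regmapC].
have [x Xx|XA|XB] := HX _ _ (Fc A Ac) (Fc B Bc).
- have zc Z : zclosed Z -> zclosed [set y | Z (x * y)%g].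
    by move=> Zc; apply: zclosed_preim => //; apply: regmapM; [apply: regmapC|apply: regmap_id].
  have [y Yy|YA|YB] := HY _ _ (zc A Ac) (zc B Bc).
  + by apply: XAB; exists x, y.
  + by left=> -[y Yy]; apply: YA.
  + by right=> -[y Yy]; apply: YB.
- by left=> _ [x [y [Xx Yy ->]]]; apply: (XA x Xx (exist _ y Yy)).
- by right=> _ [x [y [Xx Yy ->]]]; apply: (XB x Xx (exist _ y Yy)).
Qed.

Lemma subgroup1 K : subgroup K -> K 1%g. Proof. by case. Qed.
Lemma subgroupV K x : subgroup K -> K x -> K x^-1%g.
Proof. by move=> [K1 KD] Kx; rewrite -[(x^-1)%g]mul1g; apply: KD. Qed.
Lemma subgroupM K x y : subgroup K -> K x -> K y -> K (x * y)%g.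
Proof. by move=> sK Kx Ky; rewrite -[y]invgK; apply: (sK.2) => //; apply: subgroupV. Qed.
Lemma subgroupJ K x y : subgroup K -> K x -> K y -> K (x ^ y)%g.
Proof. by move=> sK Kx Ky; apply: subgroupM => //; [apply: subgroupV|apply: subgroupM]. Qed.
Lemma subgroupX K x m : subgroup K -> K x -> K (x ^+ m)%g.
Proof.
move=> sK Kx; elim: m => [|m IH]; first by rewrite expg0; apply: subgroup1.
by rewrite expgS; apply: subgroupM.
Qed.

Lemma zclosed_mull a Z : zclosed Z -> zclosed [set y | Z (a * y)%g].
Proof. by move=> Zc; apply: zclosed_preim => //; apply: regmapM; [apply: regmapC|apply: regmap_id]. Qed.

(** The properties through which the identity component is used. Finite index appears as a common
    exponent [m], the form suited to taking roots in one-parameter subgroups. *)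
Definition is_component K K0 :=
  [/\ K0 `<=` K, subgroup K0, zclosed K0, zirreducible K0 &
   [/\ forall Y, zirreducible Y -> Y 1%g -> Y `<=` K -> Y `<=` K0,
      forall Y, zconnected Y -> Y 1%g -> Y `<=` K -> Y `<=` K0 &
      exists2 m, (0 < m)%N & forall x, K x -> K0 (x ^+ m)%g]].

Lemma component_exists K : subgroup K -> zclosed K -> exists K0, is_component K K0.
Proof.
move=> sK Kc; have [m [Z [Zc Zi ZK]]] := closed_finite_irred Kc.
pose cand Y := [/\ zclosed Y, zirreducible Y, Y 1%g & Y `<=` K].
have candM X Y : cand X -> cand Y -> cand (zclosure (prodset X Y)).
  move=> [Xc Xi X1 XK] [Yc Yi Y1 YK]; split.
  - exact: zclosure_closed.
  - exact/zirreducible_closure/zirreducible_prod.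
  - by apply: sub_zclosure; exists 1%g, 1%g; rewrite mulg1.
  - by apply: zclosure_min => // _ [x [y [/XK Kx /YK Ky ->]]]; apply: subgroupM.
have cand1 : cand [set 1%g].
  split=> // [||_ ->]; [exact: zclosed_set1| |exact: subgroup1].
  split; first by exists 1%g.
  by move=> A B _ _ /(_ 1%g erefl) [?|?]; [left|right] => _ ->.
(* The irreducible pieces of [K] through [1] are multiplied together, with a closure at each
   step. *)
have [K0 [cK0 K0Z]] : exists K0, cand K0 /\
    forall i, (i < m)%N -> Z i 1%g -> Z i `<=` K0.
  suff : forall l, (l <= m)%N -> exists K0, cand K0 /\
    forall i, (i < l)%N -> Z i 1%g -> Z i `<=` K0 by move=> /(_ m); apply.
  elim=> [_|l IH lm]; first by exists [set 1%g].
  have [Y [cY YZ]] := IH (ltnW lm).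
  have [Zl|nZl] := pselect (Z l 1%g); last first.
    exists Y; split=> // i; rewrite ltnS leq_eqVlt => /orP [/eqP ->|/YZ] //.
  have cZ : cand (Z l).
    by split; [apply: Zc|apply: Zi| |move=> x Zx; apply/ZK; exists l].
  exists (zclosure (prodset Y (Z l))); split; first exact: candM.
  move=> i; rewrite ltnS leq_eqVlt => /orP [/eqP ->|il] Zi1 x Zx; apply: sub_zclosure.
    by exists 1%g, x; rewrite mul1g; split=> //; case: cY.
  by exists x, 1%g; rewrite mulg1; split=> //; apply: (YZ i).
have [K0c K0i K01 K0K] := cK0.
have max Y : zirreducible Y -> Y 1%g -> Y `<=` K -> Y `<=` K0.
  move=> Yi Y1 YK.
  have [i im YZ] : exists2 i, (i < m)%N & Y `<=` Z i.
    have : forall l, (l <= m)%N -> (forall x, Y x -> exists2 i, (i < l)%N & Z i x) ->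
        exists2 i, (i < l)%N & Y `<=` Z i.
      elim=> [_ H|l IH lm H]; first by have [] := H 1%g Y1.
      have [A [Ac AE]] : exists A, zclosed A /\ forall x, A x <-> exists2 i, (i < l)%N & Z i x.
        elim: l lm {IH H} => [|l IH] lm.
          by exists set0; split; [apply: zclosed0|move=> x; split=> // -[]].
        have [A [Ac AE]] := IH (ltnW lm); exists (A `|` Z l); split.
          by apply: zclosedU => //; apply: Zc; apply: ltnW.
        move=> x; split=> [[/AE [i il Zx]|Zx]| [i ]].
        - by exists i => //; apply: ltnW.
        - by exists l.
        - by rewrite ltnS leq_eqVlt => /orP [/eqP -> Zx|il Zx]; [right|left; apply/AE; exists i].
      have [x Yx|YA|YZ] := Yi.2 A (Z l) Ac (Zc l lm).
      + have [i ] := H x Yx; rewrite ltnS leq_eqVlt => /orP [/eqP -> Zx|il Zx]; first by right.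
        by left; apply/AE; exists i.
      + have [x Yx|i il YZ] := IH (ltnW lm); first by apply/AE/YA.
        by exists i => //; apply: ltnW.
      + by exists l.
    by apply=> // x /YK /ZK.
  by apply: (subset_trans YZ); apply: K0Z => //; apply: YZ.
have sK0 : subgroup K0.
  split=> // x y Kx Ky.
  have inv : K0 y^-1%g.
    have := max [set (z^-1)%g | z in K0]; apply; last by exists y.
    - by apply: zirreducible_image => //; apply/regmapV/regmap_id.
    - by exists 1%g => //; rewrite invg1.
    - by move=> _ [z /K0K Kz <-]; apply: subgroupV.
  have := max (prodset K0 K0); apply; last by exists x, y^-1%g.
  - exact: zirreducible_prod.
  - by exists 1%g, 1%g; rewrite mulg1.
  - by move=> _ [u [v [/K0K Ku /K0K Kv ->]]]; apply: subgroupM.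
(* Translated by one of its points [z i], the piece [Z i] is irreducible through [1], hence lies in
   [K0]: finitely many cosets cover [K]. *)
have cosets : exists z : nat -> G, forall x, K x -> exists2 i, (i < m)%N & K0 ((z i)^-1 * x)%g.
  have /choice [z zP] : forall i, exists z, (i < m)%N -> Z i z.
    by move=> i; case: (ltnP i m) => [/Zi [[z Zz] _]|_]; [exists z|exists 1%g].
  exists z => x /ZK [i im Zx]; exists i => //.
  have := max [set ((z i)^-1 * y)%g | y in Z i]; apply; last by exists x.
  - by apply: zirreducible_image; [apply: regmapM; [apply: regmapC|apply: regmap_id]|apply: Zi].
  - by exists (z i); [apply: zP|rewrite mulVg].
  - move=> _ [y Zy <-]; apply: subgroupM => //; [apply: subgroupV => //|]; apply/ZK.
      by exists i => //; apply: zP.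
    by exists i.
have [z zP] := cosets.
exists K0; split=> //; split=> //.
  (* [D] is the union of the cosets other than [K0]; it is closed, so connectedness keeps [Y] inside
     [K0]. *)
  move=> Y Yc Y1 YK; pose D := [set x | exists2 i, (i < m)%N & ~ K0 (z i) /\ K0 ((z i)^-1 * x)%g].
  have Dc : zclosed D.
    rewrite (_ : D = [set x | exists2 i, (i < m)%N & (~ K0 (z i) /\ K0 ((z i)^-1 * x)%g)]) //.
    elim: m {Zc Zi ZK K0Z zP cosets} @D => [|l IH] /=.
      by rewrite (_ : mkset _ = set0); [apply: zclosed0|apply/seteqP; split=> // x []].
    have [Kl|nKl] := pselect (K0 (z l)).
      rewrite (_ : mkset _ = [set x | exists2 i, (i < l)%N & ~ K0 (z i) /\ K0 ((z i)^-1 * x)%g]) //.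
      apply/seteqP; split=> x [i ].
        by rewrite ltnS leq_eqVlt => /orP [/eqP -> [/(_ Kl)]|il Hx] //; exists i.
      by move=> il Hx; exists i => //; apply: ltnW.
    rewrite (_ : mkset _ = [set x | exists2 i, (i < l)%N & ~ K0 (z i) /\ K0 ((z i)^-1 * x)%g] `|`
      [set x | K0 ((z l)^-1 * x)%g]); first by apply: zclosedU => //; apply: zclosed_mull.
    apply/seteqP; split=> x.
      by move=> [i ]; rewrite ltnS leq_eqVlt => /orP [/eqP -> [_]|il Hx]; [right|left; exists i].
    by move=> [[i il Hx]|Hx]; [exists i => //; apply: ltnW|exists l].
  have [||//|YD] := Yc K0 D K0c Dc.
  - move=> x /YK /zP [i im Hx]; have [Kz|nKz] := pselect (K0 (z i)); last by right; exists i.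
    by left; rewrite -[x](mulVKg (z i)); apply: subgroupM.
  - apply/seteqP; split=> // x [[_ K0x] [i im [nKz Hx]]]; apply: nKz.
    rewrite -[z i]invgK; apply: subgroupV => //.
    by rewrite -[(_)^-1%g](mulgK x); apply: subgroupM => //; apply: subgroupV.
  have [i _ [nK]] := YD _ Y1; rewrite mulg1 => KV; case: nK.
  by rewrite -[z i]invgK; apply: subgroupV.
(* Among the powers of [x] with exponents from [0] to [m] two share a coset, so a power with
   exponent between [1] and [m] lies in [K0], and that exponent divides the factorial. *)
exists m`!; first exact: fact_gt0.
move=> x Kx; have /choice [c cP] : forall k : 'I_m.+1, exists i : 'I_m, K0 ((z i)^-1 * x ^+ k)%g.
  move=> k; have [i im Hx] := zP (x ^+ k)%g (subgroupX k sK Kx).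
  by exists (Ordinal im).
have [k [l [kl ckl]]] : exists k l : 'I_m.+1, (k < l)%N /\ c k = c l.
  have /injectivePn [k [l kl ckl]] : ~~ injectiveb c.
    by apply: contraL isT => /injectiveP /leq_card; rewrite !card_ord ltnn.
  by have [lt|lt|/val_inj e] := ltngtP k l; [exists k, l|exists l, k|rewrite e eqxx in kl].
have Kd : K0 (x ^+ (l - k))%g.
  have -> : (x ^+ (l - k) = ((z (c k))^-1 * x ^+ k)^-1 * ((z (c l))^-1 * x ^+ l))%g.
    rewrite ckl invgM invgK mulgA mulgK.
    by rewrite -[in RHS](subnKC (ltnW kl)) expgnDr mulKg.
  by apply: subgroupM => //; apply: subgroupV.
have dv : (l - k %| m`!)%N.
  apply: dvdn_fact; rewrite subn_gt0 kl /=.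
  by rewrite (leq_trans (leq_subr _ _)) // -ltnS.
by rewrite -(divnK dv) mulnC expgnA; apply: subgroupX.
Qed.

Lemma zirreducible_connected X : zirreducible X -> zconnected X.
Proof. by move=> [_ H] A B Ac Bc XAB _; apply: H. Qed.

Lemma connected_irreducible K : closed_connected_subgroup K -> zirreducible K.
Proof.
move=> [sK Kc Kn]; have [K0 [K0K sK0 K0c K0i [_ H _]]] := component_exists sK Kc.
suff -> : K = K0 by [].
by apply/seteqP; split=> //; apply: H => //; apply: subgroup1.
Qed.

Lemma component_connected K K0 : is_component K K0 -> closed_connected_subgroup K0.
Proof. by move=> [_ ? ? /zirreducible_connected ? _]. Qed.

End Components.

(** * Algebraic dependence and the finiteness of Krull dimension *)

(** A count: the [m ^ k] products of the [f i] with exponents below [m] lie in a space of dimension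
    at most [B ^ N], which is smaller. *)
Lemma mpoly_dependent (F : fieldType) N k (f : 'I_k -> {mpoly F[N]}) : (N < k)%N ->
  exists2 q : {mpoly F[k]}, q != 0 & mmap (@mpolyC N F) f q = 0.
Proof.
move=> Nk; pose dle d (p : {mpoly F[N]}) := forall m, m \in msupp p -> (mdeg m <= d)%N.
have dle1 d : dle d 1.
  by move=> m; rewrite msupp1 inE => /eqP ->; rewrite mdeg0.
have dleM d e p q : dle d p -> dle e q -> dle (d + e)%N (p * q).
  move=> dp eq m /msuppM_le /allpairsP [[m1 m2] /= [m1p m2q ->]].
  by rewrite mdegD leq_add ?dp ?eq.
pose d := \max_(i < k) msize (f i).
have fd i : dle d (f i).
  by move=> m /msize_mdeg_lt /ltnW le; apply: (leq_trans le); apply: (leq_bigmax i).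
(* Since [B <= m * (k * d).+1] and [m] exceeds [(k * d).+1 ^ N], it follows that
   [B ^ N < m ^ N.+1 <= m ^ k]. *)
pose m := ((k * d).+1 ^ N).+1; pose B := (k * (m * d)).+1.
pose mon (a : {ffun 'I_k -> 'I_m}) := \prod_i f i ^+ a i.
have bnd a : dle (k * (m * d))%N (mon a).
  have X i e : dle (e * d)%N (f i ^+ e).
    by elim: e => [|e IH]; rewrite ?expr0 ?exprS ?mulSn; [apply: dle1|apply: dleM].
  have H (s : seq 'I_k) : dle (size s * (m * d))%N (\prod_(i <- s) f i ^+ a i).
    elim: s => [|i s IH]; first by rewrite big_nil; apply: dle1.
    rewrite big_cons /= mulSn; apply: dleM => // mm /X le.
    by rewrite (leq_trans le) // leq_mul2r ltnW ?orbT.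
  by have := H (index_enum _); rewrite (_ : size _ = k) // -[RHS]size_enum_ord enumT.
have card : (B ^ N < m ^ k)%N.
  have BN : (B ^ N <= m ^ N * (k * d).+1 ^ N)%N.
    have le : (B <= m * (k * d).+1)%N by rewrite /B mulnS mulnCA addnC -addn1 leq_add2l.
    by rewrite -expnMn; case: (posnP N) => [->|N0]; rewrite ?expn0 ?leq_exp2r.
  apply: (leq_ltn_trans BN); apply: (@leq_trans (m ^ N * m)).
    by rewrite ltn_mul2l expn_gt0 /= ltnSn.
  by rewrite -expnSr leq_pexp2l.
pose I := {ffun 'I_k -> 'I_m}; pose J := {ffun 'I_N -> 'I_B}.
pose A : 'M[F]_(#|{: I}|, #|{: J}|) := \matrix_(a, b)
  (mon (enum_val a : I))@_[multinom ((enum_val b : J) i : nat) | i < N].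
have : kermx A != 0.
  rewrite kermx_eq0 /row_free neq_ltn (leq_ltn_trans (rank_leq_col A)) //.
  by rewrite !card_ffun !card_ord.
move=> /rowV0Pn [v vA v0]; have {}vA : v *m A = 0 by apply/sub_kermxP.
pose X (a : I) : 'X_{1..k} := [multinom (a i : nat) | i < k].
have XI : injective X.
  move=> a b /mnmP e; apply/ffunP => i; apply: val_inj.
  by have := e i; rewrite !mnmE.
pose q := \sum_(a < #|{: I}|) v 0 a *: 'X_[X (enum_val a)].
have qE : mmap (@mpolyC N F) f q = \sum_(a < #|{: I}|) v 0 a *: mon (enum_val a).
  rewrite raddf_sum /=; apply: eq_bigr => a _.
  rewrite mmapZ mul_mpolyC mmapX; congr (_ *: _); apply: eq_bigr => i _.
  by rewrite mnmE.
exists q.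
  apply: contraNneq v0 => q0; apply/eqP/rowP => a; rewrite mxE.
  have : q@_(X (enum_val a)) = 0 by rewrite q0 mcoeff0.
  rewrite raddf_sum /= (bigD1 a) //= mcoeffZ mcoeffX eqxx mulr1 big1 ?addr0 //.
  move=> b ba; rewrite mcoeffZ mcoeffX.
  by case: eqP => [/XI /enum_val_inj e|_]; [rewrite e eqxx in ba|rewrite mulr0].
rewrite qE; apply/mpolyP => mu; rewrite mcoeff0 raddf_sum /=.
have [/forallP muB|/forallPn [i muB]] := boolP [forall i, (mu i < B)%N].
  pose b : J := [ffun i => Ordinal (muB i)].
  have vb := congr1 (fun M : 'rV_#|{: J}| => M 0 (enum_rank b)) vA.
  rewrite !mxE in vb; rewrite -[RHS]vb.
  apply: eq_bigr => a _; rewrite mcoeffZ mxE enum_rankK; congr (_ * _@__).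
  by apply/mnmP => i; rewrite mnmE ffunE.
rewrite big1 // => a _; rewrite mcoeffZ; case: (boolP (mu \in msupp (mon (enum_val a)))).
  move/bnd => le; case/negP: muB; rewrite ltnS; apply: leq_trans le.
  by rewrite mdegE (bigD1 i) //= leq_addr.
by rewrite mcoeff_msupp negbK => /eqP ->; rewrite mulr0.
Qed.

Lemma meval_muni (A : comNzRingType) l (v : 'I_l.+1 -> A) (q : {mpoly A[l.+1]}) :
  meval v q = (map_poly (meval (fun i => v (widen_ord (leqnSn l) i))) (muni q)).[v ord_max].
Proof.
pose e : {mpoly A[l]} -> A := meval (fun i => v (widen_ord (leqnSn l) i)).
rewrite -/e.
have [phi [[phiD phiM phiC phiX] phiE]] : exists phi : {poly {mpoly A[l]}} -> A,
    [/\ {morph phi : a b / a + b}, {morph phi : a b / a * b},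
      forall a, phi a%:P = e a & phi 'X = v ord_max] /\
    forall Q, (map_poly e Q).[v ord_max] = phi Q.
  exists (fun Q => (map_poly e Q).[v ord_max]); split=> //; split=> [a b|a b|a|].
  - by rewrite raddfD hornerD.
  - by rewrite rmorphM hornerM.
  - by rewrite map_polyC hornerC.
  - by rewrite map_polyX hornerX.
rewrite phiE {phiE}; elim/mpoly_alg_ind: q => [c|i|p q ep eq|p q ep eq].
- by rewrite muniC phiC /e !mevalC.
- rewrite mevalXU /muni mmapX mmap1U /=; case: splitP => j ij.
    by rewrite phiC /e mevalXU; congr v; apply: val_inj.
  rewrite phiX; congr v; apply: val_inj.
  by rewrite /= -[LHS]/(nat_of_ord (cast_ord (esym (addn1 l)) i)) ij ord1 addn0.
- by rewrite mevalD muniD phiD ep eq.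
- by rewrite mevalM muniM phiM ep eq.
Qed.

Section Dimension.
Context {R : realType} {G : affine_group R}.
Local Notation C := R[i].

(** Functions [f i] vanishing on [Z i] but not on [Z i.+1] are algebraically independent on the top
    of the chain, so they are at most as many as the coordinates. *)
Lemma krull_bound k (Z : nat -> set G) :
  (forall i, (i <= k)%N -> zclosed (Z i) /\ zirreducible (Z i)) ->
  (forall i, (i < k)%N -> Z i `<` Z i.+1) -> (k <= ambient G)%N.
Proof.
move=> Zci Zlt; rewrite leqNgt; apply/negP => Nk.
have /choice [f fP] : forall i, exists f : {mpoly C[ambient G]}, (i < k)%N ->
    (forall x, Z i x -> eval_at f (coord x) = 0) /\
    ~ (forall x, Z i.+1 x -> eval_at f (coord x) = 0).
  move=> i; case: (ltnP i k) => [ik|_]; last by exists 0.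
  have [_ nZ] := Zlt i ik; apply: contrapT => nf; apply: nZ => x Zx.
  have /zclosedP := (Zci i (ltnW ik)).1; apply=> g [[p gp] gZ]; apply: contrapT => gx.
  apply: nf; exists p => _; split=> [y /gZ|/(_ x Zx)]; first by rewrite gp.
  by rewrite -gp.
(* Order a relation on [Z l.+1] by powers of the last function. Its constant term vanishes on [Z l],
   hence is [0] by induction; the rest is divisible by the last function, which cancels because
   [Z l.+1] is irreducible. *)
have indep l (q : {mpoly C[l]}) : (l <= k)%N ->
    (forall x, Z l x -> meval (fun i => eval_at (f i) (coord x)) q = 0) -> q = 0.
  elim: l q => [|l IH] q lk qZ.
    have [x Zx] := (Zci 0%N isT).2.1; have q0 := qZ x Zx.
    have : forall q : {mpoly C[0]}, (meval (fun i => eval_at (f i) (coord x)) q)%:MP = q.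
      by elim/mpoly_alg_ind => [c|[]//|p p' ep ep'|p p' ep ep'];
        rewrite ?mevalC // ?mevalD ?mevalM ?mpolyCD ?mpolyCM ?ep ?ep'.
    by move=> /(_ q) <-; rewrite q0 mpolyC0.
  have [[Zlc _] [Zl1c /zirreducibleP [_ Zirr]]] := (Zci l (ltnW lk), Zci l.+1 lk).
  have [f0 f1] := fP l lk.
  pose e x : {mpoly C[l]} -> C := meval (fun i : 'I_l => eval_at (f i) (coord x)).
  suff H : forall Q : {poly {mpoly C[l]}}, (forall x, Z l.+1 x ->
      (map_poly (e x) Q).[eval_at (f l) (coord x)] = 0) -> Q = 0.
    have : muni q = 0 by apply: H => x /qZ; rewrite meval_muni.
    by have [phi phiK] := muni_retract C l; move=> /(congr1 phi); rewrite phiK rmorph0.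
  elim/poly_ind => [//|Q c IHQ H].
  have mapE x : map_poly (e x) (Q * 'X + c%:P) = map_poly (e x) Q * 'X + (e x c)%:P.
    by rewrite rmorphD rmorphM /= map_polyX map_polyC.
  have c0 : c = 0.
    apply: IH; first exact: ltnW.
    move=> x Zx; have /(_ _) := H x; rewrite mapE !hornerE f0 // mulr0 add0r; apply.
    by have [+ _] := Zlt l lk; apply.
  rewrite c0 addr0; rewrite c0 in H mapE; have [||x Zx|Q0|//] := Zirr
      (fun x => (map_poly (e x) Q).[eval_at (f l) (coord x)]) (fun x => eval_at (f l) (coord x)).
  - under eq_fun => x do rewrite (horner_coef_wide _ (size_poly _ _)).
    apply: reg_sum => i; apply: regM.
      under eq_fun => x do rewrite coef_map.
      by apply: reg_meval => k'; exists (f k').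
    elim: (nat_of_ord i) => [|j IHj]; first by under eq_fun => x do rewrite expr0; apply: regC.
    by under eq_fun => x do rewrite exprS; apply: regM => //; exists (f l).
  - by exists (f l).
  - by have := H x Zx; rewrite mapE !hornerE /e meval0 addr0.
  - by rewrite IHQ ?mul0r.
have [q q0 qf] := mpoly_dependent (fun i : 'I_k => f i) Nk.
case/eqP: q0; apply: (@indep k) => // x _.
suff E p : meval (fun i => eval_at (f i) (coord x)) p =
    meval (coord x 0) (mmap (@mpolyC (ambient G) C) (fun i : 'I_k => f i) p).
  by rewrite E qf meval0.
elim/mpoly_alg_ind: p => [c|i|p p' ep ep'|p p' ep ep'].
- by rewrite mmapC !mevalC.
- by rewrite mmapX mmap1U mevalXU.
- by rewrite mmapD !mevalD ep ep'.
- by rewrite mevalM [mmap _ _ _]rmorphM mevalM ep ep'.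
Qed.

End Dimension.

(** * Faithful linear representations *)

Section Linearization.
Context {R : realType} {G : affine_group R}.
Local Notation C := R[i].
Local Notation N := (ambient G).

(* [rho_coord] makes [rho] a closed embedding of [G]. *)
Record linear_model n := LinearModel {
  rho :> G -> 'M[C]_n.+1;
  rho1 : rho 1%g = 1;
  rhoM : forall x y, rho (x * y)%g = rho x * rho y;
  rho_reg : forall i j, reg (fun g => rho g i j);
  rho_coord : exists l : 'I_N -> {mpoly C[n.+1 * n.+1]}, forall g j, coord g 0 j = ev (l j) (rho g)
}.

(** Kernels that are finite sums of products of one-variable functions; they express that translates
    of a function span a finite-dimensional space. *)
Definition finite_rank (T U : Type) (h : T -> U -> C) := exists k (a : 'I_k -> T -> C) (b : 'I_k -> U -> C),
  forall t u, h t u = \sum_i a i t * b i u.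

Lemma finite_rankM1 T U (a : T -> C) (b : U -> C) : finite_rank (fun t u => a t * b u).
Proof. by exists 1%N, (fun=> a), (fun=> b) => t u; rewrite big_ord1. Qed.

Lemma finite_rankD T U (h h' : T -> U -> C) : finite_rank h -> finite_rank h' ->
  finite_rank (fun t u => h t u + h' t u).
Proof.
move=> [k [a [b hE]]] [l [a' [b' hE']]].
exists (k + l)%N, (fun i => match split i with inl j => a j | inr j => a' j end),
  (fun i => match split i with inl j => b j | inr j => b' j end) => t u.
rewrite big_split_ord hE hE'; congr (_ + _); apply: eq_bigr => i _.
  by rewrite (unsplitK (inl i)).
by rewrite (unsplitK (inr i)).
Qed.

Lemma finite_rank_sum T U (I : Type) (r : seq I) (h : I -> T -> U -> C) :
  (forall i, finite_rank (h i)) -> finite_rank (fun t u => \sum_(i <- r) h i t u).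
Proof.
move=> H; elim: r => [|i r IH].
  exists 0%N, (fun _ _ => 0), (fun _ _ => 0) => t u.
  by rewrite big_nil big_ord0.
have [k [a [b E]]] := finite_rankD (H i) IH.
by exists k, a, b => t u; rewrite big_cons E.
Qed.

Lemma finite_rankM T U (h h' : T -> U -> C) : finite_rank h -> finite_rank h' ->
  finite_rank (fun t u => h t u * h' t u).
Proof.
move=> [k [a [b hE]]] [l [a' [b' hE']]].
have [m [c [d E]]] := finite_rank_sum (index_enum 'I_k) (fun i =>
  finite_rank_sum (index_enum 'I_l) (fun j =>
    finite_rankM1 (fun t => a i t * a' j t) (fun u => b i u * b' j u))).
exists m, c, d => t u; rewrite -E hE hE' mulr_suml; apply: eq_bigr => i _.
by rewrite mulr_sumr; apply: eq_bigr => j _; rewrite mulrACA.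
Qed.

(** The translates of the coordinate functions, together with the constant [1], which makes their
    span nonzero and so of dimension [n.+1]. *)
Definition row_fun (t : option 'I_N * G) (x : G) : C :=
  if t.1 is Some j then coord (t.2 * x)%g 0 j else 1.

Lemma finite_rank_row_fun : finite_rank row_fun.
Proof.
have H j : finite_rank (fun (t : option 'I_N * G) x => coord (t.2 * x)%g 0 j).
  have [p pE] := mul_regular (a := G) j.
  suff [k [a [b E]]] : finite_rank (fun (t : option 'I_N * G) x =>
      meval (row_mx (coord t.2) (coord x) 0) p).
    by exists k, a, b => t x; rewrite -E (pE (t.2, x)).
  elim/mpoly_alg_ind: p {pE} => [c|i|p q [k [a [b E]]] [l [a' [b' E']]]|p q [k [a [b E]]] [l [a' [b' E']]]].
  - have [k [a [b E]]] := finite_rankM1 (fun _ : option 'I_N * G => c) (fun _ : G => 1).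
    by exists k, a, b => t x; rewrite -E mevalC mulr1.
  - case: (splitP i) => i' ii.
      have [k [a [b E]]] := finite_rankM1 (fun t : option 'I_N * G => coord t.2 0 i') (fun _ : G => 1).
      exists k, a, b => t x; rewrite -E mevalXU mulr1 (_ : i = lshift _ i') ?row_mxEl //.
      exact: val_inj.
    have [k [a [b E]]] := finite_rankM1 (fun t : option 'I_N * G => 1) (fun x : G => coord x 0 i').
    exists k, a, b => t x; rewrite -E mevalXU mul1r (_ : i = rshift _ i') ?row_mxEr //.
    exact: val_inj.
  - have [m [c [d F]]] := finite_rankD (ex_intro _ k (ex_intro _ a (ex_intro _ b E)))
      (ex_intro _ l (ex_intro _ a' (ex_intro _ b' E'))).
    by exists m, c, d => t x; rewrite -F mevalD.
  - have [m [c [d F]]] := finite_rankM (ex_intro _ k (ex_intro _ a (ex_intro _ b E)))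
      (ex_intro _ l (ex_intro _ a' (ex_intro _ b' E'))).
    by exists m, c, d => t x; rewrite -F mevalM.
have H1 : finite_rank (fun (t : option 'I_N * G) (x : G) => if t.1 == None then 1 else 0 : C).
  have [k [a [b E]]] := finite_rankM1 (fun t : option 'I_N * G => if t.1 == None then 1 else 0 : C)
    (fun _ : G => 1).
  by exists k, a, b => t x; rewrite -E mulr1.
have H2 : finite_rank (fun (t : option 'I_N * G) (x : G) =>
    \sum_j (if t.1 == Some j then 1 else 0 : C) * coord (t.2 * x)%g 0 j).
  apply: finite_rank_sum => j; apply: finite_rankM => //.
  have [k [a [b E]]] := finite_rankM1 (fun t : option 'I_N * G => if t.1 == Some j then 1 else 0 : C)
    (fun _ : G => 1).
  by exists k, a, b => t x; rewrite -E mulr1.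
have [k [a [b E]]] := finite_rankD H1 H2.
exists k, a, b => -[[j|] y] x; rewrite -E /row_fun /=.
  rewrite add0r (bigD1 j) //= eqxx mul1r big1 ?addr0 // => i ij.
  by rewrite (_ : (Some j == Some i) = false) ?mul0r // (inj_eq Some_inj) eq_sym (negPf ij).
by rewrite big1 ?addr0 // => i _; rewrite mul0r.
Qed.

(** [G] acts by translations on the span of the [row_fun t]. An invertible matrix of values
    [row_fun (t i) (x j)] of largest size exhibits a basis of it. The coordinates of [G] belong to
    this span, so they are linear in the entries of the representation. *)
Lemma linear_model_exists : exists n, inhabited (linear_model n).
Proof.
have [k [a [b E]]] := finite_rank_row_fun.
pose mx d (t : 'I_d -> option 'I_N * G) (x : 'I_d -> G) := \matrix_(i, j) row_fun (t i) (x j).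
pose Q d := `[< exists t x, mx d t x \in unitmx >].
have Q1 : Q 1%N.
  apply/asboolP; exists (fun=> (None, 1%g)), (fun=> 1%g).
  rewrite (_ : mx _ _ _ = 1%:M) ?unitmx1 //.
  by apply/matrixP => i j; rewrite !mxE /row_fun !ord1.
have Qk d : Q d -> (d <= k)%N.
  move=> /asboolP [t [x u]]; rewrite -(mxrank_unit u).
  have -> : mx d t x = (\matrix_(i, j) a j (t i)) *m (\matrix_(i, j) b i (x j)).
    by apply/matrixP => i j; rewrite !mxE E; apply: eq_bigr => l _; rewrite !mxE.
  exact: mulmx_max_rank.
case: (ex_maxnP (ex_intro _ 1%N Q1) Qk) => -[|n] Qn nmax; first by have := nmax _ Q1.
have /asboolP [t [x u]] := Qn; pose M := mx _ t x.
pose w (y : G) : 'cV[C]_n.+1 := \col_i row_fun (t i) y.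
pose lam (s : option 'I_N * G) : 'rV[C]_n.+1 := (\row_j row_fun s (x j)) *m invmx M.
(* Otherwise the matrix bordered by [s] and [y] would be invertible, against maximality. *)
have lamP s y : row_fun s y = (lam s *m w y) 0 0.
  apply: contrapT => /eqP ne.
  have : Q (n.+1 + 1)%N.
    apply/asboolP; exists (fun i => match split i with inl j => t j | inr _ => s end).
    exists (fun i => match split i with inl j => x j | inr _ => y end).
    set B := mx _ _ _.
    have BE : B = block_mx M (w y) (\row_j row_fun s (x j)) (row_fun s y)%:M.
      apply/matrixP => i j; rewrite !mxE; case: (split i) => i'; rewrite !mxE;
        case: (split j) => j'; rewrite !mxE //.
      by rewrite !ord1 mulr1n.
    rewrite -row_free_unit -kermx_eq0; apply/eqP/row_matrixP => i; rewrite row0.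
    have : row i (kermx B) *m B = 0 by apply/sub_kermxP/row_sub.
    move: (row i _) => v; rewrite -[v]hsubmxK BE mul_row_block -row_mx0.
    move=> /eq_row_mx [e1 e2].
    have v1 : lsubmx v = - (rsubmx v *m lam s).
      rewrite /lam mulmxA -[lsubmx v](mulmxK u) -/M; move/eqP: e1.
      by rewrite addr_eq0 => /eqP ->; rewrite mulNmx.
    have v2 : rsubmx v = 0.
      move: e2; rewrite v1 mulNmx -mulmxA [lam s *m _]mx11_scalar !mul_mx_scalar.
      rewrite addrC -scalerBl => /eqP; rewrite scaler_eq0 subr_eq0 (negPf ne) /=.
      by move/eqP.
    by rewrite v1 v2 mul0mx oppr0 row_mx0.
  by move/nmax; rewrite addn1 ltnn.
pose rh g : 'M[C]_n.+1 := \matrix_(i, j) lam ((t i).1, ((t i).2 * g)%g) 0 j.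
have row_mul s g y : row_fun s (g * y)%g = row_fun (s.1, s.2 * g)%g y.
  by case: s => [[j|] z]; rewrite /row_fun /= ?mulgA.
have wM g y : w (g * y)%g = rh g *m w y.
  apply/colP => i; rewrite mxE row_mul lamP [LHS]mxE [RHS]mxE; apply: eq_bigr => j _.
  by rewrite [rh g i j]mxE.
have wx : \matrix_(i, j) w (x j) i 0 = M by apply/matrixP => i j; rewrite !mxE.
have uniq_w (A B : 'M[C]_n.+1) : (forall y, A *m w y = B *m w y) -> A = B.
  move=> AB; rewrite -[A](mulmxK u) -[B](mulmxK u); congr (_ *m _).
  apply/matrixP => i j; have /colP/(_ i) := AB (x j).
  by rewrite !mxE => e; rewrite (eq_bigr (fun k => A i k * w (x j) k 0)) ?e;
    [apply: eq_bigr => l _; rewrite !mxE|move=> l _; rewrite !mxE].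
exists n; constructor; exists rh.
- by apply: uniq_w => y; rewrite -wM mul1g mul1mx.
- move=> g h; apply: uniq_w => y; rewrite -wM -mulgA !wM mulmxA //.
- move=> i j; under eq_fun => g do rewrite !mxE.
  apply: reg_sum => l; apply: regM; last exact: regC.
  under eq_fun => g do rewrite mxE -row_mul /row_fun.
  case: (t i).1 => [m|]; last exact: regC.
  apply: (reg_comp (f := fun x => coord x 0 m)); first exact: reg_coord.
  by apply: regmapM; [apply: regmapC|apply: regmapM; [apply: regmap_id|apply: regmapC]].
- exists (fun j => \sum_k \sum_l (lam (Some j, 1%g) 0 k * w 1%g l 0) *: cf C k l) => g j.
  have := lamP (Some j, 1%g) g; rewrite /row_fun /= mul1g => ->.
  rewrite -[g in LHS]mulg1 wM mxE ev_sum; apply: eq_bigr => m _.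
  rewrite ev_sum [(_ *m _) m 0]mxE mulr_sumr; apply: eq_bigr => l _.
  by rewrite evZ ev_cf mulrAC mulrA.
Qed.

End Linearization.

(** * The Lie algebra of a subgroup *)

Section PolyMatrices.
Variables (C : comNzRingType) (n : nat).
Local Notation P := {mpoly C[n * n]}.

Definition evx a b (F : 'M[P]_(a, b)) (M : 'M[C]_n) := map_mx (fun p => ev p M) F.
Definition devx a b (F : 'M[P]_(a, b)) (M Y : 'M[C]_n) := map_mx (fun p => dev p M Y) F.
Definition cstx a b (A : 'M[C]_(a, b)) : 'M[P]_(a, b) := map_mx (@mpolyC _ C) A.
Definition idx : 'M[P]_n := \matrix_(i, j) cf C i j.

Lemma evxM a b c (F : 'M_(a, b)) (H : 'M_(b, c)) M : evx (F *m H) M = evx F M *m evx H M.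
Proof.
by apply/matrixP => i j; rewrite !mxE ev_sum; apply: eq_bigr => k _; rewrite !mxE evM.
Qed.

Lemma devxM a b c (F : 'M_(a, b)) (H : 'M_(b, c)) M Y :
  devx (F *m H) M Y = devx F M Y *m evx H M + evx F M *m devx H M Y.
Proof.
apply/matrixP => i j; rewrite !mxE dev_sum -big_split.
by apply: eq_bigr => k _; rewrite !mxE devM.
Qed.

Lemma evx_cst a b (A : 'M_(a, b)) M : evx (cstx A) M = A.
Proof. by apply/matrixP => i j; rewrite !mxE evC. Qed.
Lemma devx_cst a b (A : 'M_(a, b)) M Y : devx (cstx A) M Y = 0.
Proof. by apply/matrixP => i j; rewrite !mxE devC. Qed.
Lemma evx_id M : evx idx M = M.
Proof. by apply/matrixP => i j; rewrite !mxE ev_cf. Qed.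
Lemma devx_id M Y : devx idx M Y = Y.
Proof. by apply/matrixP => i j; rewrite !mxE dev_cf. Qed.

End PolyMatrices.

(** * Linear forms and associative subalgebras of matrices *)

Section LinForm.
Variables (C : numClosedFieldType) (n : nat).
Local Notation M := ('M[C]_n.+1).
Local Notation P := {mpoly C[n.+1 * n.+1]}.

Definition linform (f : M -> C) : P := \sum_i \sum_j f (delta_mx i j) *: cf C i j.

Lemma ev_linform (f : {linear M -> C^o}) x : ev (linform f) x = f x.
Proof.
rewrite {2}(matrix_sum_delta x) linear_sum ev_sum; apply: eq_bigr => i _.
rewrite linear_sum ev_sum; apply: eq_bigr => j _.
by rewrite evZ ev_cf linearZ mulrC.
Qed.

Lemma D_linform (f : {linear M -> C^o}) x :
  D x (linform f) = linform (fun y => f (y * x)).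
Proof.
rewrite /linform D_sum; apply: eq_bigr => i _; rewrite D_sum.
rewrite (eq_bigr (fun j => \sum_k (f (delta_mx i j) * x k j) *: cf C i k)); last first.
  move=> j _; rewrite DZ D_cf /ent scaler_sumr; apply: eq_bigr => k _.
  by rewrite scalerA.
rewrite exchange_big; apply: eq_bigr => k _; rewrite -scaler_suml; congr (_ *: _).
have -> : delta_mx i k * x = \sum_j x k j *: delta_mx i j.
  apply/matrixP => a b; rewrite summxE mxE (bigD1 k) //= big1 ?addr0; last first.
    by move=> l lk; rewrite mxE (negPf lk) andbF mul0r.
  rewrite (bigD1 b) //= big1 ?addr0; last first.
    by move=> l lb; rewrite !mxE [b == l]eq_sym (negPf lb) andbF mulr0.
  by rewrite !mxE !eqxx !andbT mulrC.
rewrite linear_sum; apply: eq_bigr => j _.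
by rewrite linearZ mulrC.
Qed.

Definition linear_set (V : lmodType C) (S : set V) :=
  S 0 /\ forall c u v, S u -> S v -> S (c *: u + v).

Definition subalgebra (S : set M) := [/\ linear_set S, S 1 & forall x y, S x -> S y -> S (x * y)].

Lemma linear_setP (V : vectType C) (S : set V) v : linear_set S ->
  (forall f : {linear V -> C^o}, (forall u, S u -> f u = 0) -> f v = 0) -> S v.
Proof.
move=> [S0 SL] H; have [U US] := vspace_of_set S0 SL.
apply/US/contraT => /separate_vspace [f [fU]]; rewrite H ?eqxx // => u /US.
exact: fU.
Qed.

Lemma linear_setZ (V : lmodType C) (S : set V) c v : linear_set S -> S v -> S (c *: v).
Proof. by move=> [S0 SL] Sv; rewrite -[_ *: _]addr0; apply: SL. Qed.
Lemma linear_setD (V : lmodType C) (S : set V) u v : linear_set S -> S u -> S v -> S (u + v).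
Proof. by move=> [S0 SL] Su Sv; rewrite -[u]scale1r; apply: SL. Qed.
Lemma linear_setB (V : lmodType C) (S : set V) u v : linear_set S -> S u -> S v -> S (u - v).
Proof. by move=> LS Su Sv; apply: linear_setD => //; rewrite -scaleN1r; apply: linear_setZ. Qed.
Lemma linear_set_sum (V : lmodType C) (S : set V) (I : eqType) (s : seq I) (F : I -> V) :
  linear_set S -> (forall i, i \in s -> S (F i)) -> S (\sum_(i <- s) F i).
Proof.
move=> LS; elim: s => [|i s IH] H; first by rewrite big_nil; case: LS.
rewrite big_cons; apply: linear_setD => //; first by apply: H; rewrite mem_head.
by apply: IH => j js; apply: H; rewrite in_cons js orbT.
Qed.

Lemma subalgebra_horner S x q : subalgebra S -> S x -> S (horner_mx x q).
Proof.
move=> [SL S1 SM] Sx; elim/poly_ind: q => [|q c IH]; first by rewrite rmorph0; case: SL.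
rewrite rmorphD rmorphM /= horner_mx_X horner_mx_C; apply: linear_setD => //.
  exact: SM.
by rewrite -[c]mulr1 -scale_scalar_mx; apply: linear_setZ.
Qed.

Lemma subalgebra_smap S x f : subalgebra S -> S x -> S (smap f x).
Proof. by have [q ->] := smap_horner f x; apply: subalgebra_horner. Qed.

Lemma subalgebraX S x k : subalgebra S -> S x -> S (x ^+ k).
Proof. by move=> [SL S1 SM] Sx; elim: k => [|k IH]; rewrite ?expr0 ?exprS //; apply: SM. Qed.

Lemma subalgebra_expm S x t : subalgebra S -> S x -> S (expm t x).
Proof.
move=> SA Sx; have [SL _ _] := SA; apply: linear_set_sum => // k _.
by apply: linear_setZ => //; apply: subalgebraX.
Qed.

Lemma subalgebra_npart S x : subalgebra S -> S x -> S (npart x).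
Proof. by move=> SA Sx; apply: linear_setB; [case: SA| |apply: subalgebra_smap]. Qed.

Lemma subalgebra_commutant (S : set M) : subalgebra [set x | forall y, S y -> x * y = y * x].
Proof.
split; first split.
- by move=> y _; rewrite mul0r mulr0.
- by move=> c u v Hu Hv y Sy; rewrite mulrDl mulrDr -scalerAl -scalerAr Hu ?Hv.
- by move=> y _; rewrite mul1r mulr1.
- by move=> u v Hu Hv y Sy; rewrite -mulrA Hv // !mulrA Hu.
Qed.

Lemma smapX (x : M) E m : smap E x ^+ m = smap (fun a => E a ^+ m) x.
Proof.
elim: m => [|m IH]; first by rewrite expr0 -[LHS](smap1 x); apply: eq_bigr => a _; rewrite expr0.
by rewrite exprS IH smapM; apply: eq_bigr => a _; rewrite exprS.
Qed.

End LinForm.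

(** * Real exponentials of the eigenvalues *)

Section Separating.
Variable R : realType.
Local Notation C := R[i].

(** Taking real parts lets the real exponential serve; the parameter [c] restores the separation of
    distinct complex numbers. *)
Definition real_exp (c z : C) : C := (sequences.expR (complex.Re (c * z)))%:C.

Lemma real_exp_exponential c : exponential (real_exp c).
Proof.
split=> [|a b]; rewrite /real_exp; first by rewrite mulr0 exp.expR0.
by rewrite mulrDr raddfD exp.expRD rmorphM.
Qed.

Lemma real_expX c a m : real_exp c a ^+ m = real_exp (c *+ m) a.
Proof.
elim: m => [|m IH]; first by rewrite expr0 /real_exp mul0r exp.expR0.
by rewrite exprS IH /real_exp mulrS mulrDl raddfD exp.expRD rmorphM.
Qed.

Lemma real_exp_separating : separating (range real_exp).
Proof.
split=> [_ [c _ <-]|_ m [c _ <-]|vs us]; first exact: real_exp_exponential.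
  by exists (c *+ m) => //; apply/funext => a; rewrite real_expX.
(* For [c = 1 + k i], the real part of [c * (a - b)] is [Re (a - b) - k * Im (a - b)], a nonzero
   polynomial in [k] when [a != b]; some natural number avoids all the roots. *)
pose p : {poly R} := \prod_(ab <- [seq (a, b) | a <- vs, b <- vs] | ab.1 != ab.2)
  ((complex.Re (ab.1 - ab.2))%:P - (complex.Im (ab.1 - ab.2)) *: 'X).
have [k pk] : exists k : nat, p.[k%:R] != 0.
  apply: contrapT => nk; have : p = 0.
    by apply: poly_nat_zero => k; apply/eqP/negPn/negP => h; apply: nk; exists k.
  move/eqP; rewrite prodf_seq_eq0 => /hasP [[a b] _ /= /andP [ab /eqP /polyP e]].
  case/negP: ab; rewrite -subr_eq0 eq_complex; have := (e 0%N, e 1%N).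
  rewrite !coefB !coefC !coefZ !coefX /= mulr0 mulr1 subr0 sub0r => -[-> /eqP].
  by rewrite oppr_eq0 => /eqP ->; rewrite !eqxx.
exists (real_exp (1 +i* k%:R)) => [|a b av bv]; first by exists (1 +i* k%:R).
move=> /complexI /exp.expR_inj /eqP; rewrite -subr_eq0 -raddfB -mulrBr => /eqP e.
apply: contrapT => /eqP ab; case/eqP: pk; rewrite horner_prod.
apply/eqP; rewrite prodf_seq_eq0; apply/hasP; exists (a, b).
  by apply/allpairsP; exists (a, b).
rewrite /= ab /= !hornerE; move: e; case: (a - b) => u v /=.
by rewrite mul1r => e; rewrite mulrC e.
Qed.

End Separating.

Section SubstMatrix.
Variables (C : comNzRingType) (n : nat).
Local Notation P := {mpoly C[n * n]}.

Definition substx (p : P) (F : 'M[P]_n) : P := subst p (fun i j => F i j).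

Lemma ev_substx p F M : ev (substx p F) M = ev p (evx F M).
Proof. by rewrite ev_subst; congr (ev p _); apply/matrixP => i j; rewrite !mxE. Qed.

Lemma dev_substx p F M Y : dev (substx p F) M Y = dev p (evx F M) (devx F M Y).
Proof. by rewrite dev_subst; congr (dev p _ _); apply/matrixP => i j; rewrite !mxE. Qed.

Lemma evxB a b (F H : 'M[P]_(a, b)) M : evx (F - H) M = evx F M - evx H M.
Proof. by apply/matrixP => i j; rewrite !mxE evB. Qed.

Lemma devxB a b (F H : 'M[P]_(a, b)) M Y : devx (F - H) M Y = devx F M Y - devx H M Y.
Proof. by apply/matrixP => i j; rewrite !mxE devB. Qed.

Lemma evx_conj (A B M : 'M[C]_n) : evx (cstx n A *m idx C n *m cstx n B) M = A *m M *m B.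
Proof. by rewrite !evxM !evx_cst evx_id. Qed.

Lemma devx_conj (A B M Y : 'M[C]_n) :
  devx (cstx n A *m idx C n *m cstx n B) M Y = A *m Y *m B.
Proof.
by rewrite devxM devx_cst mulmx0 addr0 devxM devx_cst mul0mx add0r devx_id !evx_cst.
Qed.

End SubstMatrix.

(** * Differentiation along a subgroup *)

Section GroupLie.
Context {R : realType} {G : affine_group R} {n : nat}.
Variable r : @linear_model R G n.
Local Notation C := R[i].
Local Notation M := ('M[C]_n.+1).
Local Notation P := {mpoly C[n.+1 * n.+1]}.
Local Notation cst := (@cstx C n.+1 _ _).
Implicit Types (X Y K U : set G) (x y : M) (g h : G).

Lemma rhoV g : r g * r g^-1%g = 1. Proof. by rewrite -rhoM mulgV rho1. Qed.
Lemma rhoVl g : r g^-1%g * r g = 1. Proof. by rewrite -rhoM mulVg rho1. Qed.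

Lemma reg_ev p : reg (fun g => ev p (r g)).
Proof.
apply: (@reg_meval _ _ _ p (fun k g => mxvec (r g) 0 k)) => k.
by case/mxvec_indexP: k => i j; under eq_fun => g do rewrite mxvecE; apply: rho_reg.
Qed.

Lemma regE f : reg f -> exists p, forall g, f g = ev p (r g).
Proof.
move=> [q fq]; have [l lE] := rho_coord r.
suff [p pE] : exists p, forall g, eval_at q (coord g) = ev p (r g).
  by exists p => g; rewrite fq pE.
elim/mpoly_alg_ind: q {fq} => [c|j|q q' [p E] [p' E']|q q' [p E] [p' E']].
- by exists c%:MP => g; rewrite evC /eval_at mevalC.
- by exists (l j) => g; rewrite -lE /eval_at mevalXU.
- by exists (p + p') => g; rewrite evD -E -E' /eval_at mevalD.
- by exists (p * p') => g; rewrite evM -E -E' /eval_at mevalM.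
Qed.

Lemma reg_mxE a b (F : G -> 'M[C]_(a, b)) : (forall i j, reg (fun g => F g i j)) ->
  exists Q : 'M[P]_(a, b), forall g, F g = evx Q (r g).
Proof.
move=> rF; have /choice [Q QE] : forall ij, exists p, forall g, F g ij.1 ij.2 = ev p (r g).
  by move=> [i j]; apply: regE.
by exists (\matrix_(i, j) Q (i, j)) => g; apply/matrixP => i j; rewrite !mxE -QE.
Qed.

(** The image is closed among all matrices: the polynomials [l j] extract from a matrix [x] in the
    closure coordinates satisfying the equations of [G], hence a point of [G] sent to [x]. *)
Lemma zclosed_rho X : zclosed X -> zclosed_mx (r @` X).
Proof.
move=> Xc x Hx; have [l lE] := rho_coord r.
pose cx : 'rV[C]_(ambient G) := \row_j ev (l j) x.
have lift (q : {mpoly C[ambient G]}) : exists p, (forall g, ev p (r g) = eval_at q (coord g)) /\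
    ev p x = eval_at q cx.
  elim/mpoly_alg_ind: q => [c|j|q q' [p [E e]] [p' [E' e']]|q q' [p [E e]] [p' [E' e']]].
  - by exists c%:MP; split=> [g|]; rewrite evC /eval_at mevalC.
  - by exists (l j); split=> [g|]; rewrite -?lE /eval_at mevalXU // mxE.
  - by exists (p + p'); split=> [g|]; rewrite evD ?E ?E' ?e ?e' /eval_at mevalD.
  - by exists (p * p'); split=> [g|]; rewrite evM ?E ?E' ?e ?e' /eval_at mevalM.
have [S SE] := coord_closed G.
have : range (@Defs.coord R G) cx.
  rewrite SE => q Sq; have [p [pE <-]] := lift q; apply: Hx => _ [g Xg <-].
  rewrite pE; have : range (@Defs.coord R G) (coord g) by exists g.
  by rewrite SE => /(_ q Sq).
move=> [g _ gx]; have rg : r g = x.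
  apply/matrixP => i j; have [q qE] := rho_reg r i j.
  have [p [pE pe]] := lift q; rewrite qE gx -pe; apply/eqP; rewrite -subr_eq0.
  have := Hx (p - cf C i j); rewrite evB ev_cf => -> //.
  by move=> _ [h Xh <-]; rewrite evB ev_cf pE -qE subrr.
exists g => //; have /zclosedP := Xc; apply=> f [/regE [p fp] fX].
by rewrite fp rg; apply: Hx => _ [h Xh <-]; rewrite -fp fX.
Qed.

Lemma zirreducible_rho X : zirreducible X -> irreducible_mx (r @` X).
Proof.
move=> /zirreducibleP [_ H] p q pq; have [h Xh|pX|qX] := H _ _ (reg_ev p) (reg_ev q).
- by rewrite -evM; apply: pq; exists h.
- by left=> _ [g Xg <-]; apply: pX.
- by right=> _ [g Xg <-]; apply: qX.
Qed.

Lemma mulclosed_rho X : subgroup X -> mulclosed (r @` X).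
Proof.
move=> sX; split; first by exists 1%g; [apply: subgroup1|rewrite rho1].
by move=> _ _ [g Xg <-] [h Xh <-]; exists (g * h)%g; [apply: subgroupM|rewrite rhoM].
Qed.

Definition lieg X := lie (r @` X).

Lemma lieg_linear X : linear_set (lieg X).
Proof. by split; [apply: lie0|move=> c u v; apply: lie_linear]. Qed.

Lemma liegS X Y x : X `<=` Y -> lieg X x -> lieg Y x.
Proof. by move=> XY; apply: lieS => _ [g Xg <-]; exists g => //; apply: XY. Qed.

(** Differentiation at [1] of a linear condition valid along [X], tested against the linear forms
    vanishing on [S]. *)
Lemma lieg_chain a b X x (F : 'M[P]_(a, b)) (S : set 'M[C]_(a, b)) : lieg X x ->
  linear_set S -> (forall g, X g -> S (evx F (r g))) -> S (devx F 1 x).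
Proof.
move=> Xx LS FS; apply: (linear_setP LS) => f fS.
have fE (A : 'M[C]_(a, b)) : f A = \sum_i \sum_j A i j * f (delta_mx i j).
  rewrite {1}(matrix_sum_delta A) linear_sum; apply: eq_bigr => i _.
  by rewrite linear_sum; apply: eq_bigr => j _; rewrite linearZ.
pose p : P := \sum_i \sum_j f (delta_mx i j) *: F i j.
have : dev p 1 x = 0.
  apply: Xx => _ [g Xg <-]; rewrite -[RHS](fS _ (FS g Xg)) fE ev_sum.
  apply: eq_bigr => i _; rewrite ev_sum; apply: eq_bigr => j _.
  by rewrite evZ mxE mulrC.
move=> p0; rewrite -[RHS]p0 fE dev_sum; apply: eq_bigr => i _.
by rewrite dev_sum; apply: eq_bigr => j _; rewrite devZ mxE mulrC.
Qed.

Lemma lieg_sub X (S : set M) x : linear_set S -> (forall g, X g -> S (r g)) ->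
  lieg X x -> S x.
Proof.
move=> LS XS Xx; rewrite -[x](devx_id 1); apply: (lieg_chain Xx LS) => g Xg.
by rewrite evx_id; apply: XS.
Qed.

Lemma lieg_map X Y x (F : 'M[P]_n.+1) : lieg X x ->
  (forall g, X g -> exists2 h, Y h & evx F (r g) = r h) -> evx F 1 = 1 ->
  lieg Y (devx F 1 x).
Proof.
move=> Xx FY F1 p Yp; have <- : dev (substx p F) 1 x = dev p 1 (devx F 1 x).
  by rewrite dev_substx F1.
apply: Xx => _ [g Xg <-].
by rewrite ev_substx; have [h Yh ->] := FY g Xg; apply: Yp; exists h.
Qed.

(** The value of the differential comes from differentiating [g * g^-1 = 1] along [X]. *)
Lemma rho_inv_poly : exists V : 'M[P]_n.+1, (forall g, evx V (r g) = r g^-1%g) /\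
  forall X x, lieg X x -> devx V 1 x = - x.
Proof.
have [|V VE] := reg_mxE (F := fun g => r g^-1%g).
  by move=> i j; apply: (reg_comp (f := fun g => r g i j)); [apply: rho_reg|apply/regmapV/regmap_id].
exists V; split=> // X x Xx; have V1 : evx V 1 = 1 by rewrite -(rho1 r) -VE invg1 rho1.
have := @lieg_chain _ _ X x (idx C n.+1 *m V - cst 1%:M) [set 0] Xx.
have -> : devx (idx C n.+1 *m V - cst 1%:M) 1 x = x + devx V 1 x.
  by rewrite devxB devx_cst subr0 devxM devx_id evx_id V1 mulmx1 mul1mx.
move=> H; apply/eqP; rewrite -addr_eq0 addrC; apply/eqP; apply: H.
  by split=> // c u v -> ->; rewrite scaler0 addr0.
move=> g _; rewrite evxB evx_cst evxM evx_id -VE.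
by rewrite -[_ *m _]/(_ * _) rhoV subrr.
Qed.

Definition Ad g x := r g^-1%g * x * r g.

Lemma Ad_linear g c x y : Ad g (c *: x + y) = c *: Ad g x + Ad g y.
Proof. by rewrite /Ad mulrDr mulrDl -scalerAr -scalerAl. Qed.
Lemma AdM g x y : Ad g (x * y) = Ad g x * Ad g y.
Proof. by rewrite /Ad -!mulrA [r g * _]mulrA rhoV mul1r. Qed.
Lemma Ad_mul g h x : Ad (g * h)%g x = Ad h (Ad g x).
Proof. by rewrite /Ad invgM !rhoM !mulrA. Qed.
Lemma Ad1 x : Ad 1%g x = x. Proof. by rewrite /Ad invg1 rho1 mul1r mulr1. Qed.
Lemma AdK g x : Ad g^-1%g (Ad g x) = x. Proof. by rewrite -Ad_mul mulgV Ad1. Qed.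
Lemma AdKV g x : Ad g (Ad g^-1%g x) = x. Proof. by rewrite -Ad_mul mulVg Ad1. Qed.
Lemma AdB g x y : Ad g (x - y) = Ad g x - Ad g y.
Proof. by rewrite /Ad mulrBr mulrBl. Qed.
Lemma AdX g x k : Ad g (x ^+ k) = Ad g x ^+ k.
Proof.
elim: k => [|k IH]; last by rewrite !exprS AdM IH.
by rewrite !expr0 /Ad mulr1 rhoVl.
Qed.

Lemma Ad_trace g x y : \tr (Ad g x * Ad g y) = \tr (x * y).
Proof.
rewrite -AdM /Ad -[_ * r g]/(_ *m r g) mxtrace_mulC -[_ *m _]/(_ * _).
by rewrite !mulrA rhoV mul1r.
Qed.

Lemma Ad_fixP g x : Ad g x = x <-> x * r g = r g * x.
Proof.
split=> [E|E]; first by rewrite -{2}E /Ad !mulrA rhoV mul1r.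
by rewrite /Ad -mulrA E mulrA rhoVl mul1r.
Qed.

(* The derivative of [Ad] is the bracket. *)
Lemma lieg_bracket X (S : set M) x w : linear_set S -> (forall g, X g -> S (Ad g w)) ->
  lieg X x -> S (w * x - x * w).
Proof.
move=> LS XS Xx; have [V [VE dV]] := rho_inv_poly.
have V1 : evx V 1 = 1 by rewrite -(rho1 r) VE invg1 rho1.
have [W [WE dW]] : exists W : 'M[P]_n.+1, (forall y, evx W y = w) /\ forall y, devx W 1 y = 0.
  by exists (cst w); split=> y; rewrite ?evx_cst ?devx_cst.
have -> : w * x - x * w = devx (V *m W *m idx C n.+1) 1 x.
  rewrite devxM devxM dW devx_id evx_id (dV X) // evxM V1 WE.
  by rewrite mulmx0 addr0 mul1mx mulmx1 mulNmx addrC.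
apply: (lieg_chain Xx LS) => g Xg; rewrite evxM evxM evx_id VE WE.
exact: XS.
Qed.

Lemma lieg_Ad X Y g x : (forall h, X h -> Y (h ^ g)%g) -> lieg X x -> lieg Y (Ad g x).
Proof.
move=> XY Xx; pose F := cst (r g^-1%g) *m idx C n.+1 *m cst (r g).
have -> : Ad g x = devx F 1 x.
  by rewrite devx_conj.
apply: (lieg_map Xx) => [h Xh|].
  exists (h ^ g)%g; first exact: XY.
  by rewrite evx_conj !rhoM mulrA.
by rewrite evx_conj mulmx1 -[_ *m _]/(_ * _) rhoVl.
Qed.

(** [Ad v - 1] is the differential at the identity of [g^-1 * g ^ v] as a function of [g]. *)
Lemma lieg_commutator X U v x : (forall g, X g -> U (g^-1 * g ^ v)%g) -> lieg X x ->
  lieg U (Ad v x - x).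
Proof.
move=> XU Xx; have [V [VE dV]] := rho_inv_poly.
have V1 : evx V 1 = 1 by rewrite -(rho1 r) VE invg1 rho1.
pose H := cst (r v^-1%g) *m idx C n.+1 *m cst (r v).
have HE y : evx H y = r v^-1%g * y * r v by rewrite /H evx_conj.
have H1 : evx H 1 = 1 by rewrite HE mulr1 rhoVl.
have dH : devx H 1 x = Ad v x by rewrite /H devx_conj.
move: H HE H1 dH => H HE H1 dH.
have -> : Ad v x - x = devx (V *m H) 1 x.
  by rewrite devxM (dV X) // H1 V1 dH mul1mx mulmx1 addrC.
apply: (lieg_map Xx) => [h Xh|].
  exists (h^-1 * h ^ v)%g; first exact: XU.
  by rewrite evxM VE HE !rhoM -[_ *m _]/(_ * _) !mulrA.
by rewrite evxM V1 H1 mulmx1.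
Qed.

(** Multiplicativity turns the vanishing of the differential at [1] into that of [D x p] on all of
    [X], so [p - 1] has zero jet along [X]. *)
Lemma trivial_character X p : closed_connected_subgroup X ->
  (forall g h, X g -> X h -> ev p (r (g * h)%g) = ev p (r g) * ev p (r h)) ->
  ev p 1 = 1 -> (forall x, lieg X x -> dev p 1 x = 0) ->
  forall g, X g -> ev p (r g) = 1.
Proof.
move=> cX pM p1 dp g Xg; have [sX _ _] := cX.
have XM := mulclosed_rho sX; have Xi := zirreducible_rho (connected_irreducible cX).
suff : vanish (r @` X) (p - 1%:MP).
  by move=> /(_ (r g)); rewrite evB evC => H; apply/eqP; rewrite -subr_eq0 H //; exists g.
apply: (jet_zero_vanish XM Xi) => l lX.
elim/last_ind: l lX => [|l x IH] lX; first by rewrite /= evB evC p1 subrr.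
rewrite foldr_rcons DB DC subr0.
have Dp : vanish (r @` X) (D x p).
  have Xx : lieg X x by apply: lX; rewrite mem_rcons mem_head.
  move=> _ [h Xh <-]; rewrite -devE -[RHS](mulr0 (ev p (r h))) -(dp x Xx).
  pose F := cst (r h) *m idx C n.+1.
  have : dev (substx p F - (ev p (r h))%:MP * p) 1 x = 0.
    apply: Xx => _ [k Xk <-]; rewrite evB evM evC ev_substx evxM evx_cst evx_id.
    by rewrite -[_ *m _]/(_ * _) -rhoM pM // subrr.
  rewrite devB devM devC mul0r add0r evC dev_substx devxM devx_cst devx_id.
  by rewrite evxM !evx_cst evx_id mul0mx add0r mulmx1 => /eqP; rewrite subr_eq0 => /eqP.
have : vanish (r @` X) (foldr (@D C n.+1) (D x p) l).
  elim: l lX {IH} => [|y l IH] lX; first exact: Dp.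
  apply: (lieP XM); first by apply: lX; rewrite mem_head.
  apply: IH => z; rewrite mem_rcons in_cons => zl; apply: lX.
  by rewrite mem_rcons !in_cons; case/orP: zl => ->; rewrite ?orbT.
by apply; case: XM.
Qed.

End GroupLie.

(** * Exponentials inside algebraic subgroups *)

Section Exponentials.
Context {R : realType} {G : affine_group R} {n : nat}.
Variable r : @linear_model R G n.
Local Notation C := R[i].
Local Notation M := ('M[C]_n.+1).
Implicit Types (X Y K U : set G) (x y : M) (g h : G).
Local Notation lieg := (lieg r).

Lemma rho_inj : injective r.
Proof.
move=> g h e; have [l lE] := rho_coord r.
by apply: coord_inj; apply/rowP => j; rewrite !lE e.
Qed.

(** [D x] precomposes a linear form with right multiplication by [x]. For [x] in [S] this preserves
    the forms vanishing on [S], which contains [1]; so these forms have zero jet. *)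
Lemma rho_subalgebra X (S : set M) : closed_connected_subgroup X -> subalgebra S ->
  (forall x, lieg X x -> S x) -> forall g, X g -> S (r g).
Proof.
move=> cX [LS S1 SM] XS g Xg; have [sX _ _] := cX.
apply: (linear_setP LS) => f fS.
suff : vanish (r @` X) (linform f) by move=> /(_ (r g)); rewrite ev_linform; apply; exists g.
apply: (jet_zero_vanish (mulclosed_rho r sX) (zirreducible_rho (connected_irreducible cX))).
move=> l lX; suff [h [-> hS]] : exists h : {linear M -> C^o},
    foldr (@D C n.+1) (linform f) l = linform h /\ forall y, S y -> h y = 0.
  by rewrite ev_linform hS.
elim: l lX => [|x l IH] lX; first by exists f.
have [|h [hE hS]] := IH; first by move=> y yl; apply: lX; rewrite in_cons yl orbT.
have hl : linear (fun y : M => h (y * x) : C^o).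
  by move=> c u v; rewrite mulrDl -scalerAl linearP.
exists (HB.pack_for {linear M -> C^o} (fun y : M => h (y * x) : C^o)
  (GRing.isLinear.Build _ _ _ _ _ hl)).
split; first by rewrite [LHS](congr1 (D x) hE) D_linform.
move=> y Sy; apply: hS; apply: SM => //; apply: XS; apply: lX; exact: mem_head.
Qed.

Lemma lieg_smap X x phi : subgroup X -> lieg X x -> additive_map phi -> lieg X (smap phi x).
Proof. by move=> sX; apply/lie_smap/mulclosed_rho. Qed.

Lemma lieg_npart X x : subgroup X -> lieg X x -> lieg X (npart x).
Proof. by move=> sX; apply/lie_npart/mulclosed_rho. Qed.

Lemma smap_in_group X x E : subgroup X -> zclosed X -> lieg X x -> exponential E ->
  exists2 g, X g & r g = smap E x.
Proof. by move=> sX Xc Xx; apply: (group_smap (mulclosed_rho r sX) (zclosed_rho Xc) Xx). Qed.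

Lemma expm_in_group X x t : subgroup X -> zclosed X -> lieg X x -> x ^+ n.+1 = 0 ->
  exists2 g, X g & r g = expm t x.
Proof. by move=> sX Xc Xx; apply: (group_expm _ (mulclosed_rho r sX) (zclosed_rho Xc) Xx). Qed.

Lemma lieg_of_exp K x : (forall c, exists2 g, K g & r g = smap (@real_exp R c) x) ->
  (forall t, exists2 g, K g & r g = expm t (npart x)) -> lieg K x.
Proof.
move=> Ks Kn; rewrite -[x](subrK (smap id x)) -/(npart x).
apply: lieD; first exact: (@lie_of_expm _ _ _ (npart x) Kn (npart_nil x)).
by apply: (lie_of_smap (real_exp_separating R)) => _ [c _ <-]; apply: Ks.
Qed.

(** The exponentials of both parts of [x] are polynomials in [x], hence stay in [S]. This computes
    Lie algebras of centralizers and of groups preserving a flag. *)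
Lemma lieg_subalgebra X (S : set M) x : subgroup X -> zclosed X -> subalgebra S ->
  lieg X x -> S x -> lieg (X `&` [set g | S (r g)]) x.
Proof.
move=> sX Xc SA Xx Sx; apply: lieg_of_exp => [c|t].
  have [g Xg gE] := smap_in_group sX Xc Xx (real_exp_exponential c).
  by exists g => //; split=> //=; rewrite gE; apply: subalgebra_smap.
have [g Xg gE] := expm_in_group t sX Xc (lieg_npart sX Xx) (npart_nil x).
by exists g => //; split=> //=; rewrite gE; apply: (subalgebra_expm t SA); apply: subalgebra_npart.
Qed.

Lemma expm_irreducible X y : subgroup X -> zclosed X -> lieg X y -> y ^+ n.+1 = 0 ->
  zirreducible [set g | X g /\ exists t, r g = expm t y].
Proof.
move=> sX Xc Xy yn; apply/zirreducibleP; split.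
  by exists 1%g; split; [exact: subgroup1 sX|exists 0; rewrite rho1 expm0].
move=> f f' /(regE r) [p fE] /(regE r) [q f'E] H.
have ptE (s : {mpoly C[n.+1 * n.+1]}) t g : r g = expm t y ->
    ev s (r g) = (pathev s (expath y)).[t].
  by move=> ->; rewrite horner_pathev at_expath.
have : pathev p (expath y) * pathev q (expath y) = 0.
  apply: poly_nat_zero => t; rewrite hornerM.
  have [g Xg gE] := expm_in_group t%:R sX Xc Xy yn.
  by rewrite -(ptE p _ g gE) -(ptE q _ g gE) -fE -f'E H //; split=> //; exists t%:R.
move/eqP; rewrite mulf_eq0 => /orP [/eqP p0|/eqP q0]; [left|right] => g [_ [t gE]].
  by rewrite fE (ptE _ _ _ gE) p0 horner0.
by rewrite f'E (ptE _ _ _ gE) q0 horner0.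
Qed.

Lemma expm_in_component X X0 y t : subgroup X -> zclosed X -> is_component X X0 ->
  lieg X y -> y ^+ n.+1 = 0 -> exists2 g, X0 g & r g = expm t y.
Proof.
move=> sX Xc [_ _ _ _ [H _ _]] Xy yn.
have [g Xg gE] := expm_in_group t sX Xc Xy yn; exists g => //.
apply: (H [set g | X g /\ exists t, r g = expm t y]); last by split=> //; exists t.
- exact: expm_irreducible.
- by split; [apply: subgroup1|exists 0; rewrite rho1 expm0].
- by move=> ? [].
Qed.

Lemma rhoX g m : r (g ^+ m)%g = r g ^+ m.
Proof.
elim: m => [|m IH]; first by rewrite expg0 rho1 expr0.
by rewrite expgS rhoM IH exprS.
Qed.

Lemma lieg_component X X0 x : subgroup X -> zclosed X -> is_component X X0 ->
  lieg X x -> lieg X0 x.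
Proof.
move=> sX Xc X0P Xx; apply: lieg_of_exp => [c|t]; last first.
  by apply: (expm_in_component _ sX Xc X0P); [apply: lieg_npart|apply: npart_nil].
have [_ _ _ _ [_ _ [m m0 mP]]] := X0P.
(* Dividing the parameter by [m] gives an [m]-th root of the wanted element, and [m]-th powers fall
   into the component. *)
have [g Xg gE] := smap_in_group sX Xc Xx (real_exp_exponential (c / m%:R)).
exists (g ^+ m)%g; first exact: mP.
rewrite rhoX gE smapX; congr smap; apply/funext => a; rewrite real_expX.
by rewrite -[(c / _) *+ m]mulr_natr divfK // pnatr_eq0 -lt0n.
Qed.

Lemma binomial_poly i : exists b : {poly C}, forall k : nat, b.[k%:R] = 'C(k, i)%:R.
Proof.
elim: i => [|i [b bE]]; first by exists 1 => k; rewrite hornerE bin0.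
exists ((i.+1%:R)^-1 *: (b * ('X - i%:R%:P))) => k; rewrite hornerZ hornerM hornerXsubC bE.
apply: (mulfI (_ : i.+1%:R != 0)); first by rewrite pnatr_eq0.
rewrite mulVKf ?pnatr_eq0 // -natrM mul_bin_left.
have [le|lt] := leqP i k; first by rewrite natrM natrB // mulrC.
by rewrite bin_small // mul0r muln0.
Qed.

Lemma unipotent_power (N : M) j i i' :
  ((N + 1) ^+ j) i i' = \sum_(l < j.+1) 'C(j, l)%:R * (N ^+ l) i i'.
Proof.
rewrite addrC exprDn_comm; last by rewrite /GRing.comm mulr1 mul1r.
rewrite summxE; apply: eq_bigr => l _.
by rewrite expr1n mul1r mulmxnE mulr_natl.
Qed.

(** By the binomial formula the entries of [r g ^+ l], hence those of [a g ^+ l] for any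
    representation [a], are polynomial in [l]. For an eigenvalue [z] of [a g] this yields a nonzero
    polynomial [q] with [q (l + 1) = z q l], and leading coefficients give [z = 1]. *)
Lemma unipotent_rho g k : (r g - 1) ^+ k = 0 -> unipotent g.
Proof.
move=> gk m a [a1 aM areg]; case: m a a1 aM areg => [|m] a a1 aM areg.
  by exists 1%N; apply/matrixP => -[].
have aX j : a (g ^+ j)%g = a g ^+ j.
  elim: j => [|j IH]; first by rewrite expg0 a1 expr0.
  by rewrite expgS aM IH exprS.
have /choice [b bE] := binomial_poly.
pose path : 'M[{poly C}]_n.+1 := \matrix_(i, j) \sum_(l < k) ((r g - 1) ^+ l) i j *: b l.
have pathE j : at_t j%:R path = r g ^+ j.
  apply/matrixP => i i'.
  have -> : (r g ^+ j) i i' = \sum_(l < j.+1) 'C(j, l)%:R * ((r g - 1) ^+ l) i i'.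
    by rewrite -unipotent_power subrK.
  rewrite !mxE /horner_eval horner_sum.
  pose F l := 'C(j, l)%:R * ((r g - 1) ^+ l) i i'.
  transitivity (\sum_(l < k) F l); first by apply: eq_bigr => l _; rewrite hornerZ bE mulrC.
  transitivity (\sum_(l < j.+1) F l); last by [].
  have cut u v : (forall l, (u <= l)%N -> F l = 0) -> \sum_(l < u) F l = \sum_(l < u + v) F l.
    move=> F0; rewrite big_split_ord /= [X in _ + X]big1 ?addr0 // => l _.
    by rewrite F0 // leq_addr.
  rewrite (cut k j.+1) => [|l kl]; last first.
    by rewrite /F -(subnK kl) exprD gk mulr0 mxE mulr0.
  by rewrite addnC [RHS](cut j.+1 k) // => l jl; rewrite /F bin_small // mul0r.
have polyk i j : exists Q : {poly C}, forall l : nat, (a g ^+ l) i j = Q.[l%:R].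
  have [p pE] := regE r (areg i j); exists (pathev p path) => l.
  by rewrite horner_pathev pathE -rhoX -pE aX.
have eig z : z \in eigs (a g) -> z = 1.
  move=> /eigsP [v va v0]; have [i vi] : exists i, v 0 i != 0.
    apply: contrapT => H; case/eqP: v0; apply/rowP => i; rewrite mxE.
    by apply/eqP/negPn/negP => h; apply: H; exists i.
  have /choice [Q QE] : forall j, exists Q : {poly C}, forall l : nat, (a g ^+ l) j i = Q.[l%:R].
    by move=> j; apply: polyk.
  pose q := \sum_j v 0 j *: Q j.
  have qE l : q.[l%:R] = z ^+ l * v 0 i.
    have vl : v *m (a g ^+ l) = z ^+ l *: v.
      elim: l => [|l IH]; first by rewrite !expr0 mulmx1 scale1r.
      by rewrite exprSr -[_ * a g]/(_ *m _) mulmxA IH -scalemxAl va scalerA exprSr.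
    have /rowP/(_ i) := vl; rewrite !mxE => <-; rewrite horner_sum.
    by apply: eq_bigr => j _; rewrite hornerZ QE.
  have q0 : q != 0 by apply: contraNneq vi => q0; have := qE 0%N; rewrite q0 horner0 expr0 mul1r => <-.
  have : z *: q - (q \Po ('X + 1%:P)) = 0.
    apply: poly_nat_zero => l; rewrite (hornerD (z *: q)) hornerN hornerZ horner_comp.
    by rewrite hornerD hornerX hornerC natr1 !qE exprS mulrA subrr.
  move/eqP; rewrite subr_eq0 => /eqP /(congr1 lead_coef).
  rewrite lead_coefZ lead_coef_comp ?size_XaddC // lead_coefXaddC expr1n mulr1.
  by move/eqP; rewrite -subr_eq0 -{2}[lead_coef q]mul1r -mulrBl mulf_eq0 lead_coef_eq0 (negPf q0) orbF subr_eq0 => /eqP.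
exists m.+1; rewrite -[RHS](npart_nil (a g)); congr (_ ^+ _); congr (_ - _).
rewrite /smap -[LHS](sproj_sum (a g)); apply: eq_big_seq => z /eig ->.
by rewrite scale1r.
Qed.

End Exponentials.

(** * Engel's theorem and flags *)

Section Bracket.
Variables (C : fieldType) (n : nat).
Local Notation M := ('M[C]_n.+1).
Implicit Types (x y z a b : M).

Definition bracket x y := x * y - y * x.

Lemma bracketDl x y z : bracket (x + y) z = bracket x z + bracket y z.
Proof. by rewrite /bracket mulrDl mulrDr opprD addrACA. Qed.
Lemma bracketDr x y z : bracket z (x + y) = bracket z x + bracket z y.
Proof. by rewrite /bracket mulrDl mulrDr opprD addrACA. Qed.
Lemma bracketZl c x z : bracket (c *: x) z = c *: bracket x z.
Proof. by rewrite /bracket -scalerAl -scalerAr scalerBr. Qed.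
Lemma bracketZr c x z : bracket z (c *: x) = c *: bracket z x.
Proof. by rewrite /bracket -scalerAl -scalerAr scalerBr. Qed.
Lemma bracketC x y : bracket x y = - bracket y x.
Proof. by rewrite /bracket opprB. Qed.
Lemma bracketxx x : bracket x x = 0. Proof. exact: subrr. Qed.
Lemma bracket0r x : bracket x 0 = 0. Proof. by rewrite /bracket mul0r mulr0 subrr. Qed.
Lemma bracketBr x y z : bracket z (x - y) = bracket z x - bracket z y.
Proof. by rewrite bracketDr -scaleN1r bracketZr scaleN1r. Qed.
Lemma bracketMr x a b : bracket x (a * b) = bracket x a * b + a * bracket x b.
Proof. by rewrite /bracket mulrBl mulrBr !mulrA addrA subrK. Qed.
Lemma bracket_bracket x a b :
  bracket x (bracket a b) = bracket (bracket x a) b + bracket a (bracket x b).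
Proof.
rewrite [bracket a b]/bracket bracketBr !bracketMr opprD [- _ - _]addrC.
by rewrite addrACA.
Qed.

Lemma iter_bracketZ x k c u : iter k (bracket x) (c *: u) = c *: iter k (bracket x) u.
Proof. by elim: k => //= k ->; rewrite bracketZr. Qed.
Lemma iter_bracket0 x k : iter k (bracket x) 0 = 0.
Proof. by elim: k => //= k ->; rewrite bracket0r. Qed.

Lemma trace_bracket x y z : \tr (bracket x y * z) = \tr (y * bracket z x).
Proof.
rewrite /bracket mulrBl mulrBr !raddfB /=; congr (_ - _); last by rewrite mulrA.
by rewrite -mulrA [LHS]mxtrace_mulC mulrA.
Qed.

End Bracket.

Section Engel.
Variables (C : numClosedFieldType) (n : nat).
Local Notation M := ('M[C]_n.+1).
Implicit Types (x y z v : M) (k : set M) (l : seq M).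

(** Associative nilpotency, from which a common flag is read off. *)
Definition nil_products k m :=
  forall l, size l = m -> (forall y, y \in l -> k y) -> \prod_(y <- l) y = 0.

Lemma nil_productsW k m l : nil_products k m -> (m <= size l)%N ->
  (forall y, y \in l -> k y) -> \prod_(y <- l) y = 0.
Proof.
move=> km ml kl; rewrite -(cat_take_drop m l) big_cat /= (km (take m l)) ?mul0r //.
  by rewrite size_take_min; apply/minn_idPl.
by move=> y /mem_take; apply: kl.
Qed.

Lemma nil_products_nil k m x : nil_products k m -> k x -> x ^+ m = 0.
Proof.
move=> km kx; rewrite -(km (nseq m x)) ?size_nseq //; last by move=> y /nseqP [->].
by elim: m {km} => [|m IH]; rewrite ?big_nil // big_cons -IH exprS.
Qed.

Definition with_line k x : set M := [set z | exists y c, k y /\ z = y + c *: x].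

Lemma with_line_linear k x : linear_set k -> linear_set (with_line k x).
Proof.
move=> [k0 kL]; split; first by exists 0, 0; rewrite scale0r addr0.
move=> c _ _ [y1 [c1 [k1 ->]]] [y2 [c2 [k2 ->]]].
exists (c *: y1 + y2), (c * c1 + c2); split; first exact: kL.
by rewrite scalerDr scalerDl scalerA addrACA.
Qed.

Lemma with_line_mem k x : linear_set k -> with_line k x x.
Proof. by move=> [k0 _]; exists 0, 1; rewrite scale1r add0r. Qed.

(* [W i] is the left ideal killed by all products of [i] elements of [k]; [x]
   stabilizes it, and modulo [W i] the elements of [k + C x] act on [W i.+1]
   as multiples of [x]. *)
Lemma nil_products_line k m x N : linear_set k -> nil_products k m ->
  (forall y, k y -> k (bracket x y)) -> x ^+ N = 0 ->
  nil_products (with_line k x) (m * N).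
Proof.
move=> Lk km kx xN.
pose W i v := forall l, (i <= size l)%N -> (forall y, y \in l -> k y) -> v * \prod_(y <- l) y = 0.
have WL i c u v : W i u -> W i v -> W i (c *: u + v).
  by move=> Wu Wv l il lk; rewrite mulrDl -scalerAl Wu // Wv // scaler0 addr0.
have WS i v : W i v -> W i.+1 v by move=> Wv l il; apply: Wv; apply: ltnW.
have Wk i v y : W i.+1 v -> k y -> W i (v * y).
  move=> Wv ky l il lk; rewrite -mulrA; have := Wv (y :: l); rewrite big_cons; apply=> //.
  by move=> z; rewrite in_cons => /orP [/eqP ->//|/lk].
have Wx i v : W i v -> W i (v * x).
  move=> Wv l il lk.
  have : forall l', (size l <= size l')%N -> (forall y, y \in l' -> k y) -> v * \prod_(y <- l') y = 0.
    by move=> l' ll; apply: Wv; apply: leq_trans il ll.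
  elim: l v lk {Wv il} => [|y l IH] v lk H.
    by have := H [::]; rewrite big_nil mulr1 => ->; rewrite ?mul0r.
  have ky : k y by apply: lk; rewrite mem_head.
  have lk' z : z \in l -> k z by move=> zl; apply: lk; rewrite in_cons zl orbT.
  have e : x * y = y * x + bracket x y by rewrite addrC subrK.
  rewrite big_cons -mulrA [x * _]mulrA e mulrDl mulrDr !mulrA.
  rewrite (IH (v * y)) // ?add0r; last first.
    move=> l' ll lk2; rewrite -mulrA; have := H (y :: l'); rewrite big_cons; apply => // z.
    by rewrite in_cons => /orP [/eqP ->|/lk2].
  rewrite -mulrA; have := H (bracket x y :: l); rewrite big_cons; apply => // z.
  by rewrite in_cons => /orP [/eqP ->|/lk' //]; apply: kx.
have WX i v j : W i v -> W i (v * x ^+ j).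
  by elim: j => [|j IH] Wv; rewrite ?expr0 ?mulr1 // exprSr mulrA; apply/Wx/IH.
have W0 i : W i 0 by move=> l _ _; rewrite mul0r.
have step i l : (forall z, z \in l -> with_line k x z) -> forall v, W i.+1 v ->
    exists c, W i (v * \prod_(z <- l) z - c *: (v * x ^+ size l)).
  elim: l => [|z l IH] lk v Wv.
    by exists 1; rewrite /= big_nil !mulr1 scale1r subrr; apply: W0.
  have [y [c [ky ze]]] := lk z (mem_head _ _).
  have Wvz : W i.+1 (v * z).
    rewrite ze mulrDr -scalerAr addrC; apply: WL; first exact: Wx.
    exact/WS/Wk.
  have [|c' H] := IH _ _ Wvz; first by move=> w wl; apply: lk; rewrite in_cons wl orbT.
  exists (c' * c); rewrite big_cons mulrA.
  have -> : v * z * \prod_(z0 <- l) z0 - c' * c *: (v * x ^+ size (z :: l)) =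
      c' *: (v * y * x ^+ size l) + (v * z * \prod_(z0 <- l) z0 - c' *: (v * z * x ^+ size l)).
    rewrite [v * z * x ^+ _](_ : _ = v * y * x ^+ size l + c *: (v * x ^+ (size l).+1)).
      rewrite scalerDr scalerA; move: (v * z * _) (c' *: _) (c' * c *: _) => a b d.
      by rewrite opprD addrCA [b + _]addrA subrr add0r.
    by rewrite ze mulrDr mulrDl -scalerAr -scalerAl -[v * x * _]mulrA -exprS.
  by apply: WL => //; apply: WX; apply: Wk.
have all i l : size l = (i * N)%N -> (forall z, z \in l -> with_line k x z) ->
    forall v, W i v -> v * \prod_(z <- l) z = 0.
  elim: i l => [|i IH] l sl lk v Wv.
    by have := Wv [::]; rewrite big_nil mulr1 => ->; rewrite ?mul0r.
  rewrite -(cat_take_drop N l) big_cat /= mulrA; apply: IH.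
  - by rewrite size_drop sl mulSn addKn.
  - by move=> z /mem_drop; apply: lk.
  have [|c H] := step i (take N l) _ v Wv; first by move=> z /mem_take; apply: lk.
  move: H; rewrite size_take_min (minn_idPl _) ?xN ?mulr0 ?scaler0 ?subr0 //.
  by rewrite sl mulSn leq_addr.
move=> l sl lk; rewrite -[LHS]mul1r; apply: (all m) => // l' ml l'k.
by rewrite mul1r (nil_productsW km).
Qed.

(** [Q i w] says that [w] dies when multiplied, on both sides together, by [i] elements of [k']. As
    long as some bracket with [w] leaves [k'], replacing [w] by it lowers [i], and [i = 0] would
    mean [w = 0]. *)
Lemma bracket_normalizer k k' m z : linear_set k' -> nil_products k' m -> k' `<=` k ->
  (forall x y, k x -> k y -> k (bracket x y)) -> k z -> ~ k' z ->
  exists x, [/\ k x, ~ k' x & forall y, k' y -> k' (bracket y x)].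
Proof.
move=> Lk' km kk kB kz k'z.
pose Q i w := forall l1 l2, (i <= size l1 + size l2)%N ->
  (forall y, y \in l1 ++ l2 -> k' y) -> (\prod_(y <- l1) y) * w * (\prod_(y <- l2) y) = 0.
have : Q (m + m)%N z.
  move=> l1 l2 ml lk; have [m1|m1] := leqP m (size l1).
    by rewrite (nil_productsW km m1) ?mul0r // => y yl; apply: lk; rewrite mem_cat yl.
  have m2 : (m <= size l2)%N.
    rewrite -(leq_add2l m); apply: leq_trans ml _; rewrite leq_add2r; exact: ltnW.
  by rewrite (nil_productsW km m2) ?mulr0 // => y yl; apply: lk; rewrite mem_cat yl orbT.
elim: (m + m)%N z kz k'z => [|i IH] w kw k'w Qw.
  have := Qw [::] [::]; rewrite !big_nil mulr1 mul1r => w0.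
  by case: k'w; rewrite w0 //; case: Lk'.
have [H|/existsNP [y /not_implyP [k'y nk']]] := pselect (forall y, k' y -> k' (bracket y w)).
  by exists w.
apply: (IH (bracket y w)) => //; first by apply: kB => //; apply: kk.
move=> l1 l2 il lk; rewrite /bracket mulrBr mulrBl.
have e1 := Qw (rcons l1 y) l2; rewrite big_rcons /= size_rcons addSn ?mulrA in e1.
have e2 := Qw l1 (y :: l2); rewrite big_cons /= addnS ?mulrA in e2.
rewrite !mulrA e1 ?e2 // => [|u|u].
- by rewrite subrr.
- by rewrite mem_cat in_cons orbCA -mem_cat => /orP [/eqP ->|/lk].
- by rewrite mem_cat mem_rcons in_cons -orbA -mem_cat => /orP [/eqP ->|/lk].
Qed.

(** A proper subalgebra with vanishing long products grows by a line of its normalizer, which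
    [nil_products_line] allows; dimensions are bounded. *)
Theorem engel k : linear_set k -> (forall x y, k x -> k y -> k (bracket x y)) ->
  (forall x, k x -> x ^+ n.+1 = 0) -> exists m, nil_products k m.
Proof.
move=> Lk kB kn; apply: contrapT => H.
have big d : exists U : {vspace M}, [/\ (d <= \dim U)%N, forall u, u \in U -> k u,
    forall u v, u \in U -> v \in U -> bracket u v \in U & exists m, nil_products [set` U] m].
  elim: d => [|d [U [dU Uk UB [m Um]]]].
    exists 0%VS; split=> //.
    - by move=> u /[!memv0] /eqP ->; case: Lk.
    - by move=> u v /[!memv0] /eqP -> /eqP ->; rewrite bracketxx.
    exists 1%N => l sl lk; case: l sl lk => [|x [|y l]] //= _ lk.
    by rewrite big_seq1; apply/eqP; rewrite -memv0; apply: lk; rewrite mem_head.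
  have [z [kz Uz]] : exists z, k z /\ z \notin U.
    apply: contrapT => nz; apply: H; exists m => l sl lk; apply: Um => // y /lk ky /=.
    by apply/negPn/negP => yU; apply: nz; exists y.
  have LU : linear_set [set` U].
    by split=> [|c u v /= uU vU]; rewrite /= ?mem0v // memvD ?memvZ.
  have [x [kx Ux xU]] := bracket_normalizer LU Um Uk kB kz (negP Uz).
  have xU' y : y \in U -> bracket x y \in U by move=> yU; rewrite bracketC memvN; apply: xU.
  have UE v : v \in (U + <[x]>)%VS <-> with_line [set` U] x v.
    split=> [/memv_addP [u uU [w /vlineP [c ->] ->]]|[u [c [uU ->]]]]; first by exists u, c.
    by apply: memv_add => //; apply/vlineP; exists c.
  exists (U + <[x]>)%VS; split.
  - apply: leq_ltn_trans dU _; rewrite ltnNge; apply/negP => le.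
    have := eqEdim U (U + <[x]>)%VS; rewrite addvSl le /= => /eqP UeU.
    by apply: Ux; rewrite /= UeU; apply/UE/with_line_mem.
  - move=> v /UE [u [c [uU ->]]]; apply: linear_setD => //; first exact: Uk.
    exact: linear_setZ.
  - move=> u v /UE [u' [c [uU ->]]] /UE [v' [d' [vU ->]]].
    apply: (subvP (addvSl _ _)); rewrite bracketDl !bracketDr !bracketZl !bracketZr bracketxx.
    rewrite !scaler0 addr0; apply: memvD; [apply: memvD; first exact: UB|]; apply: memvZ.
      exact: xU.
    exact: xU'.
  exists (m * n.+1)%N => l sl lk.
  apply: (nil_products_line LU Um xU' (kn _ kx)) => // y yl; apply/UE; exact: lk.
have [U [dU _ _ _]] := big (\dim (@fullv _ M)).+1.
by have := dimvS (subvf U); rewrite leqNgt dU.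
Qed.

End Engel.

(** * Flags and the matrices that are scalar on their graded pieces *)

Section Flags.
Variables (C : numClosedFieldType) (n : nat).
Local Notation M := ('M[C]_n.+1).
Local Notation V := ('rV[C]_n.+1).
Implicit Types (x y z : M) (v : V) (F : nat -> set V) (W : set V) (S : set M).

Definition filtration F m := [/\ forall i, linear_set (F i), forall i, F i `<=` F i.+1,
  forall v, F 0%N v -> v = 0 & forall v, F m v].

Definition flag_alg F : set M :=
  [set x | forall i, exists c : C, forall v, F i.+1 v -> F i (v *m x - c *: v)].

Definition lowering F j : set M := [set x | forall i v, F (i + j)%N v -> F i (v *m x)].

Definition stable W x := forall v, W v -> W (v *m x).

Section Filtration.
Variables (F : nat -> set V) (m : nat).
Hypothesis Ff : filtration F m.

Lemma filtration_le i j : (i <= j)%N -> F i `<=` F j.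
Proof.
have [_ FS _ _] := Ff; move=> /subnK <-; elim: (j - i)%N => [|k IH] v //.
by rewrite addSn => /IH /FS.
Qed.

Lemma flag_alg_stable i x : flag_alg F x -> stable (F i) x.
Proof.
have [FL FS F0 _] := Ff; move=> Fx v; case: i => [|i] Fv.
  by rewrite (F0 v Fv) mul0mx; case: (FL 0%N).
have [c /(_ v Fv) H] := Fx i; rewrite -[_ *m _](subrK (c *: v)).
by apply: linear_setD => //; [apply: FS|apply: linear_setZ].
Qed.

Lemma flag_alg_subalgebra : subalgebra (flag_alg F).
Proof.
have [FL FS F0 _] := Ff; split; first split.
- by move=> i; exists 0 => v _; rewrite mulmx0 scale0r subr0; case: (FL i).
- move=> c x y Fx Fy i; have [[a Ha] [b Hb]] := (Fx i, Fy i).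
  exists (c * a + b) => v Fv; rewrite mulmxDr -scalemxAr scalerDl opprD addrACA -scalerA -scalerBr.
  by case: (FL i) => _; apply; [apply: Ha|apply: Hb].
- by move=> i; exists 1 => v _; rewrite mulmx1 scale1r subrr; case: (FL i).
move=> x y Fx Fy i; have [[a Ha] [b Hb]] := (Fx i, Fy i).
exists (a * b) => v Fv; rewrite -[x * y]/(x *m y) mulmxA.
have -> : v *m x *m y - (a * b) *: v = (v *m x - a *: v) *m y + a *: (v *m y - b *: v).
  by rewrite mulmxBl -scalemxAl scalerBr scalerA addrA subrK.
by apply: linear_setD; [|apply: flag_alg_stable => //; apply: Ha|apply: linear_setZ => //; apply: Hb].
Qed.

Lemma lowering_linear j : linear_set (lowering F j).
Proof.
have [FL _ _ _] := Ff; split=> [i v _|c x y Hx Hy i v Fv].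
  by rewrite mulmx0; case: (FL i).
by rewrite mulmxDr -scalemxAr; case: (FL i) => _; apply; [apply: Hx|apply: Hy].
Qed.

Lemma lowering_le j k : (j <= k)%N -> lowering F k `<=` lowering F j.
Proof.
by move=> jk x H i v Fv; apply: H; apply: filtration_le Fv; rewrite leq_add2l.
Qed.

Lemma loweringM j k x y : lowering F j x -> lowering F k y -> lowering F (j + k) (x * y).
Proof.
move=> Hx Hy i v Fv; rewrite -[x * y]/(x *m y) mulmxA; apply: Hy; apply: Hx.
by rewrite -addnA [(k + j)%N]addnC.
Qed.

Lemma lowering_stable j x y : lowering F j x -> flag_alg F y -> lowering F j (x * y).
Proof.
move=> Hx Fy i v Fv; rewrite -[x * y]/(x *m y) mulmxA.
by apply: flag_alg_stable => //; apply: Hx.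
Qed.

Lemma stable_lowering j x y : flag_alg F x -> lowering F j y -> lowering F j (x * y).
Proof.
move=> Fx Hy i v Fv; rewrite -[x * y]/(x *m y) mulmxA.
by apply: Hy; apply: flag_alg_stable.
Qed.

Lemma flag_commutator x y : flag_alg F x -> flag_alg F y -> lowering F 1 (bracket x y).
Proof.
have [FL _ _ _] := Ff; move=> Fx Fy i v; rewrite addn1 => Fv.
have [[a Ha] [b Hb]] := (Fx i, Fy i).
have -> : v *m bracket x y =
    ((v *m x - a *: v) *m y - b *: (v *m x - a *: v)) - ((v *m y - b *: v) *m x - a *: (v *m y - b *: v)).
  rewrite /bracket mulmxBr -[x * y]/(x *m y) -[y * x]/(y *m x) !mulmxA.
  rewrite !mulmxBl -!scalemxAl !scalerBr !scalerA [a * b]mulrC.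
  move: (v *m x) (v *m y) (v *m x *m y) (v *m y *m x) => p q s t.
  by apply/rowP => j; rewrite !mxE; ring.
apply: linear_setB => //; apply: linear_setB => //.
- by apply: flag_alg_stable => //; apply: Ha.
- by apply: linear_setZ => //; apply: Ha.
- by apply: flag_alg_stable => //; apply: Hb.
- by apply: linear_setZ => //; apply: Hb.
Qed.

Lemma lowering_all x : lowering F m x -> x = 0.
Proof.
have [_ _ F0 Fm] := Ff; move=> H; apply/row_matrixP => i.
by rewrite rowE row0; apply: F0; apply: H; apply: Fm.
Qed.

Lemma lowering_nil x : lowering F 1 x -> x ^+ m = 0.
Proof.
move=> H; apply: lowering_all; elim: m => [|k IH].
  by move=> i v; rewrite addn0 expr0 mulmx1.
by rewrite exprS -add1n; apply: loweringM.
Qed.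

End Filtration.

(** The flag grows by one common eigenvector at a time. The default [0] of [xget] makes [next] total
    and occurs only once the whole space is reached. *)
Lemma flag_exists S : (forall W, linear_set W -> (forall s, S s -> stable W s) ->
    (exists v, ~ W v) ->
    exists2 v, ~ W v & forall s, S s -> exists c : C, W (v *m s - c *: v)) ->
  exists F m, filtration F m /\ S `<=` flag_alg F.
Proof.
move=> H.
pose good (U : {vspace V}) v :=
  v \notin U /\ forall s, S s -> exists c : C, v *m s - c *: v \in U.
pose next (U : {vspace V}) := (U + <[xget 0%R [set v | good U v]]>)%VS.
pose F i := iter i next 0%VS.
have nextP (U : {vspace V}) s : (forall v, v \in U -> v *m s \in U) -> S s ->
    exists c : C, forall v, v \in next U -> v *m s - c *: v \in U.
  move=> Us Ss; rewrite /next; case: xgetP => [v0 _ [_ /(_ s Ss) [c Hc]]|_].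
    exists c => v /memv_addP [u uU [w /vlineP [a ->] ->]].
    have -> : (u + a *: v0) *m s - c *: (u + a *: v0) = (u *m s - c *: u) + a *: (v0 *m s - c *: v0).
      rewrite mulmxDl scalerDr opprD addrACA -scalemxAl scalerBr; congr (_ + (_ - _)).
      by rewrite !scalerA mulrC.
    by apply: memvD; [apply: memvB; [apply: Us|apply: memvZ]|apply: memvZ].
  exists 0 => v /memv_addP [u uU [w /vlineP [a ->] ->]]; rewrite scaler0 addr0 scale0r subr0; exact: Us.
have Fs i s v : S s -> v \in F i -> v *m s \in F i.
  elim: i v => [|i IH] v Ss; first by rewrite /F /= !memv0 => /eqP ->; rewrite mul0mx.
  move=> vF; have [c Hc] := nextP (F i) s (fun v => IH v Ss) Ss.
  rewrite -[_ *m _](subrK (c *: v)); apply: memvD; last exact: memvZ.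
  by apply: (subvP (addvSl _ _)); apply: Hc.
have dimF i : (i <= \dim (F i))%N \/ F i = fullv.
  elim: i => [|i [IH|IH]]; first by left.
    have [->|nf] := eqVneq (F i.+1) fullv; [by right|left].
    have nf' : exists v, v \notin F i.
      apply: contrapT => nv; case/eqP: nf; apply/vspaceP => v; rewrite memvf.
      by apply: (subvP (addvSl _ _)); apply/negPn/negP => h; apply: nv; exists v.
    have LF : linear_set [set` F i].
      by split=> [|c u v /= uU vU]; rewrite /= ?mem0v // memvD ?memvZ.
    have [||v0 v0F Hv0] := H _ LF.
    - by move=> s Ss v /= vF; apply: Fs.
    - by have [v /negP] := nf'; exists v.
    apply: leq_ltn_trans IH _; rewrite ltnNge; apply/negP => le.
    have := eqEdim (F i) (F i.+1); rewrite addvSl le /= => /eqP.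
    rewrite /= /next; case: xgetP => [v1 _ [v1F _] e|/(_ v0) []]; last by split=> //; apply/negP.
    case/negP: v1F; rewrite e.
    by apply: (subvP (addvSr _ _)); apply: memv_line.
  by right; apply/eqP; rewrite eqEsubv subvf /= -[X in (X <= _)%VS]IH addvSl.
exists (fun i => [set` F i]), (\dim (@fullv _ V)).+1; split; first split.
- by move=> i; split=> [|c u v /= uU vU]; rewrite /= ?mem0v // memvD ?memvZ.
- by move=> i v; apply: (subvP (addvSl _ _)).
- by move=> v /=; rewrite memv0 => /eqP.
- move=> v /=; case: (dimF (\dim (@fullv _ V)).+1) => [le|e]; last by suff : v \in F (\dim (@fullv _ V)).+1 by []; rewrite e memvf.
  by have := leq_trans le (dimvS (subvf _)); rewrite ltnn.
by move=> s Ss i; apply: nextP => // v; apply: Fs.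
Qed.

Lemma eigen_mod_horner W x v c p : linear_set W -> stable W x -> W (v *m x - c *: v) ->
  W (v *m horner_mx x p - p.[c] *: v).
Proof.
move=> LW Wx H; elim/poly_ind: p => [|p d IH].
  by rewrite rmorph0 mulmx0 horner0 scale0r subrr; case: LW.
rewrite hornerMXaddC rmorphD rmorphM /= horner_mx_X horner_mx_C.
have -> : v *m (horner_mx x p * x + d%:M) - (p.[c] * c + d) *: v =
   (v *m horner_mx x p - p.[c] *: v) *m x + p.[c] *: (v *m x - c *: v).
  rewrite mulmxDr mul_mx_scalar scalerDl opprD addrACA subrr addr0.
  by rewrite -[_ * x]/(_ *m x) mulmxA mulmxBl -scalemxAl scalerBr addrA subrK scalerA.
by apply: linear_setD => //; [apply: Wx|apply: linear_setZ].
Qed.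

Lemma eigen_mod_eigs W x v c : linear_set W -> stable W x -> ~ W v ->
  W (v *m x - c *: v) -> c \in eigs x.
Proof.
move=> LW Wx nv H; have := eigen_mod_horner (char_poly x) LW Wx H.
rewrite (Cayley_Hamilton x) mulmx0 sub0r -scaleNr => H'.
have [r0|r0] := eqVneq (char_poly x).[c] 0.
  have : eigenvalue x c by rewrite eigenvalue_root_char; apply/eqP.
  by move=> /eigenvalueP [w wx w0]; apply/eigsP; exists w.
case: nv; have := linear_setZ (- (char_poly x).[c])^-1 LW H'.
by rewrite scalerA mulVf ?scale1r // oppr_eq0.
Qed.

(** Eigenvectors of [W'] modulo [W] without quotient spaces: the linear factors of the
    characteristic polynomial are applied until the vector falls into [W]. *)
Lemma eigen_mod W W' x v : linear_set W -> linear_set W' -> stable W x -> stable W' x ->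
  W' v -> ~ W v ->
  exists v' c, [/\ W' v', ~ W v', c \in eigs x & W (v' *m x - c *: v')].
Proof.
move=> LW LW' Wx W'x W'v nv; have [s sE] := closed_field_poly_normal (char_poly x).
have : W (v *m horner_mx x (\prod_(z <- s) ('X - z%:P))).
  suff -> : \prod_(z <- s) ('X - z%:P) = char_poly x by rewrite Cayley_Hamilton mulmx0; case: LW.
  by rewrite [RHS]sE (eqP (char_poly_monic x)) scale1r.
elim: s v W'v nv {sE} => [|z s IH] v W'v nv; first by rewrite big_nil rmorph1 mulmx1.
rewrite big_cons rmorphM /= rmorphB /= horner_mx_X horner_mx_C.
rewrite -[_ * _]/(_ *m _) mulmxA mulmxBr mul_mx_scalar.
have [Wvz _|nW] := pselect (W (v *m x - z *: v)).
  by exists v, z; split=> //; apply: eigen_mod_eigs Wvz.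
by apply: IH => //; apply: linear_setB => //; [apply: W'x|apply: linear_setZ].
Qed.

End Flags.

(** * The Lie-Kolchin theorem *)

Section Connected.
Context {R : realType} {G : affine_group R}.
Local Notation C := R[i].
Implicit Types (X : set G) (g h : G).

(* A weak form of connectedness that passes to abstract derived subgroups. *)
Definition finite_valued_constant X := forall f : G -> C, reg f ->
  (exists s : seq C, forall x, X x -> f x \in s) -> forall x y, X x -> X y -> f x = f y.

Lemma irreducible_constant X : zirreducible X -> finite_valued_constant X.
Proof.
move=> /zirreducibleP [_ XI] f rf [s fs] x y Xx Xy.
have : forall x, X x -> \prod_(c <- s) (f x - c) = 0.
  by move=> z /fs fz; apply/eqP; rewrite prodf_seq_eq0; apply/hasP; exists (f z); rewrite //= subrr.
elim: s {fs} => [|c s IH] H.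
  by have := H x Xx; rewrite big_nil => /eqP; rewrite oner_eq0.
have r1 : reg (fun z => f z - c) by apply: regB => //; apply: regC.
have r2 : reg (fun z => \prod_(c <- s) (f z - c)).
  by apply: reg_prod => i; apply: regB => //; apply: regC.
have [|e|//] := XI _ _ r1 r2; first by move=> z Xz; have := H z Xz; rewrite big_cons.
have /eqP := e x Xx; have /eqP := e y Xy.
by rewrite !subr_eq0 => /eqP -> /eqP ->.
Qed.

Lemma derived_subgroup_group X : subgroup (derived_subgroup X).
Proof.
split=> [K [K1 _] _ //|x y Dx Dy K sK KX].
by have [_ H] := sK; apply: H; [apply: Dx|apply: Dy].
Qed.

Lemma derived_commutator X g h : X g -> X h -> derived_subgroup X [~ g, h]%g.
Proof. by move=> Xg Xh K _; apply. Qed.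

Lemma derived_sub X : subgroup X -> derived_subgroup X `<=` X.
Proof.
move=> sX x; apply=> // g h Xg Xh; rewrite commgEl; apply: subgroupM => //.
  exact: subgroupV.
exact: subgroupJ.
Qed.

Lemma derived_conj X g d : subgroup X -> X g -> derived_subgroup X d ->
  derived_subgroup X (d ^ g)%g.
Proof.
move=> sX Xg Dd; have -> : (d ^ g = d * [~ d, g])%g by rewrite commgEl mulVKg.
apply: (subgroupM (derived_subgroup_group X)) => //.
by apply: derived_commutator => //; apply: derived_sub.
Qed.

(** As a function of [g] in [X], the value [f ([~ g, h] * z)] is finite-valued, hence equal to its
    value at [1]. So commutators, and then all of the abstract derived group, leave [f] invariant
    there. *)
Lemma derived_constant X : subgroup X -> finite_valued_constant X ->
  finite_valued_constant (derived_subgroup X).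
Proof.
move=> sX cX f rf [s fs].
have sD := derived_subgroup_group X.
pose K := [set x | derived_subgroup X x /\ forall z, derived_subgroup X z -> f (x * z)%g = f z].
have D1 := subgroup1 sD; have DV x := @subgroupV _ _ _ x sD.
have DM x y := @subgroupM _ _ _ x y sD.
have KD x : derived_subgroup X x -> K x.
  apply; first split.
  - by split=> [|z _]; rewrite ?mul1g.
  - move=> u v [Du Hu] [Dv Hv]; split; first exact: (DM _ _ Du (DV _ Dv)).
    move=> z Dz; rewrite -mulgA Hu; last exact: (DM _ _ (DV _ Dv) Dz).
    by rewrite -[LHS]Hv ?mulVKg //; exact: (DM _ _ (DV _ Dv) Dz).
  move=> g h Xg Xh; split; first exact: derived_commutator.
  move=> z Dz; have H := cX (fun g => f ([~ g, h] * z)%g).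
  rewrite (H _ _ g 1%g) ?comm1g ?mul1g //; last exact: subgroup1.
    apply: (reg_comp rf); apply: regmapM; last exact: regmapC.
    have e u : [~ u, h]%g = (u^-1 * u ^ h)%g by rewrite commgEl.
    rewrite (_ : (fun u => [~ u, h]%g) = (fun u => u^-1 * u ^ h)%g); last exact/funext.
    by apply: regmapM; [apply/regmapV/regmap_id|apply: regmapJ; [apply: regmap_id|apply: regmapC]].
  exists s => u Xu; apply: fs; exact: (DM _ _ (derived_commutator Xu Xh) Dz).
move=> x y Dx Dy; have [_ Hx] := KD x Dx; have [_ Hy] := KD y Dy.
by rewrite -[x]mulg1 Hx // -[y]mulg1 Hy.
Qed.

End Connected.

Section LieKolchin.
Context {R : realType} {G : affine_group R} {m : nat}.
Local Notation C := R[i].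
Local Notation V := ('rV[C]_m.+1).
Variable a : G -> 'M[C]_m.+1.
Hypotheses (a1 : a 1%g = 1) (aM : forall g h, a (g * h)%g = a g * a h).
Hypothesis areg : forall i j, reg (fun g => a g i j).
Implicit Types (X : set G) (W : set V) (g h d : G) (u v : V).

Lemma act_mul v g h : v *m a (g * h)%g = v *m a g *m a h.
Proof. by rewrite aM -[_ * _]/(_ *m _) mulmxA. Qed.

Lemma act_notin X W v g : subgroup X -> (forall g, X g -> stable W (a g)) -> X g ->
  ~ W v -> ~ W (v *m a g).
Proof.
move=> sX WX Xg nv /(WX _ (subgroupV sX Xg)); rewrite -act_mul mulgV a1 mulmx1.
exact: nv.
Qed.

Lemma reg_form (f : {linear V -> C^o}) v : reg (fun g => f (v *m a g)).
Proof.
have e g : f (v *m a g) = \sum_j (\sum_i v 0 i * a g i j) * f (delta_mx 0 j).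
  rewrite [v *m a g]row_sum_delta linear_sum; apply: eq_bigr => j _.
  by rewrite linearZ /= mxE.
rewrite (_ : (fun g => _) = (fun g => \sum_j (\sum_i v 0 i * a g i j) * f (delta_mx 0 j))); last exact/funext.
apply: reg_sum => j; apply: regM; last exact: regC.
by apply: reg_sum => i; apply: regM; [apply: regC|apply: areg].
Qed.

(** A linear form vanishing on [W] but not at [v] reads off the eigenvalue, which is thereby regular
    in [g]. *)
Lemma eigen_character W v : linear_set W -> ~ W v -> exists c : G -> C, reg c /\
  forall g z, W (v *m a g - z *: v) -> z = c g.
Proof.
move=> LW nv; have [f [fW fv]] : exists f : {linear V -> C^o}, (forall u, W u -> f u = 0) /\ f v != 0.
  apply: contrapT => H; apply: nv; apply: (linear_setP LW) => f fW.
  by apply/eqP/negPn/negP => fv; apply: H; exists f.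
exists (fun g => f (v *m a g) * (f v)^-1); split.
  by apply: regM; [apply: reg_form|apply: regC].
move=> g z /fW; rewrite linearB linearZ /= => /eqP; rewrite subr_eq0 => /eqP ->.
by rewrite mulfK.
Qed.

(** If some [g0] is not scalar on [W2] modulo [W1], its eigenspace [E] is smaller than [W2]. It is
    stable under [X]: [z * c [~ g, g0]] is always an eigenvalue of [a g0], so [c [~ g, g0]] is
    finite-valued in [g], hence equal to [1]. *)
Lemma lie_kolchin_scalar X W1 W2 (c : G -> C) : subgroup X -> finite_valued_constant X ->
  reg c -> linear_set W1 -> linear_set W2 ->
  (forall g, X g -> stable W1 (a g)) -> (forall g, X g -> stable W2 (a g)) ->
  (forall u d, W2 u -> derived_subgroup X d -> W1 (u *m a d - c d *: u)) ->
  (exists2 v, W2 v & ~ W1 v) ->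
  exists v, [/\ W2 v, ~ W1 v & forall g, X g -> exists z : C, W1 (v *m a g - z *: v)].
Proof.
move=> sX cX cr L1 L2 X1; have [U2 U2E] : exists U : {vspace V}, forall v, v \in U <-> W2 v.
  by have [S0 SL] := L2; apply: vspace_of_set.
have [N] := ubnP (\dim U2); elim: N W2 L2 U2 U2E => // N IH W2 L2 U2 U2E dN X2 DW [v W2v nv].
have [all|/existsNP [g0 /not_implyP [Xg0 ng0]]] :=
  pselect (forall g, X g -> exists z : C, forall u, W2 u -> W1 (u *m a g - z *: u)).
  exists v; split=> // g /all [z H]; exists z; exact: H.
have [v' [z [W2v' nv' zE v'z]]] := eigen_mod L1 L2 (X1 g0 Xg0) (X2 g0 Xg0) W2v nv.
pose E := [set u | W2 u /\ W1 (u *m a g0 - z *: u)].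
have z0 : z != 0.
  apply/eqP => z0; move: v'z; rewrite z0 scale0r subr0; exact: (act_notin sX X1).
have D1 := subgroup1 (derived_subgroup_group X).
have com u g : E u -> X g -> W1 (u *m a g *m a g0 - (z * c [~ g, g0]%g) *: (u *m a g)).
  move=> [W2u zu] Xg; rewrite -act_mul.
  have -> : (g * g0 = g0 * g * [~ g, g0])%g by rewrite commgEl conjgE -!mulgA !mulVKg.
  rewrite act_mul act_mul.
  have -> : u *m a g0 *m a g *m a [~ g, g0]%g - (z * c [~ g, g0]%g) *: (u *m a g) =
    (u *m a g0 - z *: u) *m a g *m a [~ g, g0]%g +
    z *: ((u *m a g) *m a [~ g, g0]%g - c [~ g, g0]%g *: (u *m a g)).
    by rewrite !mulmxBl -!scalemxAl scalerBr scalerA addrA subrK.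
  have Dc := derived_commutator Xg Xg0.
  apply: linear_setD => //; first exact: (X1 _ (derived_sub sX Dc) _ (X1 _ Xg _ zu)).
  by apply: linear_setZ => //; apply: DW => //; apply: X2.
have c1 g : X g -> c [~ g, g0]%g = 1.
  move=> Xg; transitivity (c [~ 1, g0]%g); last first.
    rewrite comm1g; have := DW v _ W2v D1; rewrite a1 mulmx1 -{1}[v]scale1r -scalerBl.
    have [/eqP|c0] := eqVneq (1 - c 1%g) 0; first by rewrite subr_eq0 => /eqP <-.
    by move=> /(linear_setZ (1 - c 1%g)^-1 L1); rewrite scalerA mulVf // scale1r.
  apply: (cX (fun g => c [~ g, g0]%g)) => //; last exact: subgroup1.
    apply: (reg_comp cr).
    rewrite (_ : (fun h => [~ h, g0]%g) = (fun h => h^-1 * h ^ g0)%g).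
      by apply: regmapM; [apply/regmapV/regmap_id|apply: regmapJ; [apply: regmap_id|apply: regmapC]].
    by apply/funext => h; rewrite commgEl.
  exists [seq z^-1 * t | t <- eigs (a g0)] => h Xh; apply/mapP.
  exists (z * c [~ h, g0]%g); last by rewrite mulKf.
  apply: (eigen_mod_eigs L1 (X1 _ Xg0)); first exact: (act_notin sX X1 Xh nv').
  exact: com.
have LE : linear_set E.
  split=> [|t x y [x2 x1] [y2 y1]]; first by split; [case: L2|rewrite mul0mx scaler0 subr0; case: L1].
  split; first by case: L2 => _; apply.
  rewrite mulmxDl -scalemxAl scalerDr opprD addrACA scalerA mulrC -scalerA -scalerBr.
  by case: L1 => _; apply.
have [UE UEE] : exists U : {vspace V}, forall v, v \in U <-> E v.
  by have [S0 SL] := LE; apply: vspace_of_set.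
have [w W2w nw] : exists2 w, W2 w & ~ W1 (w *m a g0 - z *: w).
  apply: contrapT => H; apply: ng0; exists z => u W2u; apply: contrapT => h.
  by apply: H; exists u.
have [|g Xg u Eu|u d [W2u _] Dd||t [[W2t _] nt Ht]] := IH E LE UE UEE.
- rewrite ltnS in dN; apply: leq_trans dN; rewrite ltnNge; apply/negP => le.
  have sub : (UE <= U2)%VS by apply/subvP => x /UEE [/U2E].
  have := eqEdim UE U2; rewrite sub le /= => /eqP UeU.
  by move/U2E: W2w; rewrite -UeU => /UEE [_].
- split; first by apply: X2 => //; case: Eu.
  by have := com u g Eu Xg; rewrite c1 // mulr1.
- exact: DW.
- by exists v'.
by exists t.
Qed.

(** For [d] in the derived group, its conjugates by [X] act on the vector found by induction through
    eigenvalues of [a d], finitely many; connectedness makes the character [c] invariant, so its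
    eigenspace is stable under [X] and the scalar case applies. *)
Theorem lie_kolchin X W1 W2 : zirreducible X -> solvable_subgroup X ->
  linear_set W1 -> linear_set W2 ->
  (forall g, X g -> stable W1 (a g)) -> (forall g, X g -> stable W2 (a g)) ->
  (exists2 v, W2 v & ~ W1 v) ->
  exists v, [/\ W2 v, ~ W1 v & forall g, X g -> exists z : C, W1 (v *m a g - z *: v)].
Proof.
move=> /irreducible_constant cX [sX [k Xk]] L1.
elim: k X sX cX W2 Xk => [|k IH] X sX cX W2 Xk L2 X1 X2 ex.
  have [v W2v nv] := ex; exists v; split=> // g /Xk ->; exists 1.
  by rewrite a1 mulmx1 scale1r subrr; case: L1.
have sD := derived_subgroup_group X; have DX := derived_sub sX.
have [|||v [W2v nv Hv]] := IH _ sD (derived_constant sX cX) W2 _ L2 _ _ ex.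
- by rewrite -iterSr.
- by move=> g /DX; apply: X1.
- by move=> g /DX; apply: X2.
have [c [cr cE]] := eigen_character L1 nv.
pose E := [set u | W2 u /\ forall d, derived_subgroup X d -> W1 (u *m a d - c d *: u)].
have vE d : derived_subgroup X d -> W1 (v *m a d - c d *: v).
  by move=> /Hv [z Hz]; rewrite -(cE d z).
have LE : linear_set E.
  split=> [|t x y [x2 x1] [y2 y1]].
    by split; [case: L2|move=> d _; rewrite mul0mx scaler0 subr0; case: L1].
  split=> [|d Dd]; first by case: L2 => _; apply.
  rewrite mulmxDl -scalemxAl scalerDr opprD addrACA scalerA mulrC -scalerA -scalerBr.
  by case: L1 => _; apply; [apply: x1|apply: y1].
have tw u g d : E u -> X g -> derived_subgroup X d ->
    W1 (u *m a g *m a d - c (d ^ g^-1)%g *: (u *m a g)).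
  move=> [W2u Hu] Xg Dd; rewrite -act_mul.
  have -> : (g * d = d ^ g^-1 * g)%g by rewrite conjgE invgK -!mulgA mulVg mulg1.
  rewrite act_mul scalemxAl -mulmxBl; apply: X1 => //; apply: Hu.
  by apply: derived_conj => //; apply: subgroupV.
have inv g d : X g -> derived_subgroup X d -> c (d ^ g^-1)%g = c d.
  move=> Xg Dd; transitivity (c (d ^ 1^-1)%g); last by rewrite invg1 conjg1.
  apply: (cX (fun g => c (d ^ g^-1)%g)) => //; last exact: subgroup1.
    by apply: (reg_comp cr); apply: regmapJ; [apply: regmapC|apply/regmapV/regmap_id].
  exists (eigs (a d)) => h Xh; apply: (eigen_mod_eigs L1 (X1 _ (DX _ Dd))).
    exact: (act_notin sX X1 Xh nv).
  by apply: tw.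
have [|u d [_ Hu]||t [[W2t _] nt Ht]] := @lie_kolchin_scalar X W1 E c sX cX cr L1 LE X1.
- move=> g Xg u Eu; split; first by apply: X2 => //; case: Eu.
  by move=> d Dd; have := tw u g d Eu Xg Dd; rewrite inv.
- exact: Hu.
- by exists v.
by exists t.
Qed.

End LieKolchin.

(** * Solvable groups, flags and Borel subgroups *)

Section SolvableSubgroups.
Context {R : realType} {G : affine_group R} {n : nat}.
Variable r : @linear_model R G n.
Local Notation C := R[i].
Local Notation M := ('M[C]_n.+1).
Local Notation V := ('rV[C]_n.+1).
Implicit Types (X Y B P K : set G) (x y z : M) (g h : G) (F : nat -> set V) (S W N : set M).
Local Notation lieg := (lieg r).

Lemma flag_of_solvable X : zirreducible X -> solvable_subgroup X ->
  exists F m, filtration F m /\ forall g, X g -> flag_alg F (r g).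
Proof.
move=> Xi sX; have [|F [m [Fm FS]]] := @flag_exists C n (r @` X).
  move=> W LW Ws [v nv].
  have [||||w [_ nw Hw]] := lie_kolchin (rho1 r) (rhoM r) (rho_reg r) Xi sX LW (W2 := setT).
  - by split.
  - by move=> g Xg; apply: Ws; exists g.
  - by [].
  - by exists v.
  by exists w => // _ [g Xg <-]; apply: Hw.
by exists F, m; split=> // g Xg; apply: FS; exists g.
Qed.

Lemma lie_kolchin_Ad X S S' : zirreducible X -> solvable_subgroup X ->
  linear_set S -> linear_set S' ->
  (forall g x, X g -> S x -> S (Ad r g x)) -> (forall g x, X g -> S' x -> S' (Ad r g x)) ->
  (exists2 x, S' x & ~ S x) ->
  exists x, [/\ S' x, ~ S x & forall g, X g -> exists z : C, S (Ad r g x - z *: x)].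
Proof.
move=> Xi sX LS LS' SX S'X [x0 S'x nx].
pose a g : 'M[C]_(n.+1 * n.+1) := lin_mulmx (r g^-1%g) *m lin_mulmxr (r g).
have aE g x : mxvec x *m a g = mxvec (Ad r g x).
  by rewrite /a mulmxA mul_vec_lin mul_vec_lin.
have aE' g (u : 'rV_(n.+1 * n.+1)) : u *m a g = mxvec (Ad r g (vec_mx u)).
  by rewrite -[u in LHS]vec_mxK aE.
have a1 : a 1%g = 1%:M by apply/row_matrixP => i; rewrite !rowE aE' Ad1 vec_mxK mulmx1.
have aM g h : a (g * h)%g = a g *m a h.
  by apply/row_matrixP => i; rewrite !rowE mulmxA !aE' Ad_mul mxvecK.
have areg i j : reg (fun g => a g i j).
  rewrite (_ : (fun g => _) = (fun g => mxvec (Ad r g (vec_mx (delta_mx 0 i))) 0 j)); last first.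
    by apply/funext => g; rewrite -aE' -rowE [RHS]mxE.
  case/mxvec_indexP: j => k l; set D := vec_mx _.
  rewrite (_ : (fun g => _) = (fun g => \sum_t (\sum_s r g^-1%g k s * D s t) * r g t l)); last first.
    by apply/funext => g; rewrite mxvecE /Ad mxE; apply: eq_bigr => t _; rewrite mxE.
  apply: reg_sum => t; apply: regM; last exact: rho_reg.
  apply: reg_sum => s; apply: regM; last exact: regC.
  by apply: (reg_comp (rho_reg r k s)); apply/regmapV/regmap_id.
pose W (T : set M) : set 'rV[C]_(n.+1 * n.+1) := [set u | T (vec_mx u)].
have LW (T : set M) : linear_set T -> linear_set (W T).
  move=> [T0 TL]; split=> [|c u v Tu Tv]; first by rewrite /W /= linear0.
  by rewrite /W /= linearP; apply: TL.
have WX (T : set M) : (forall g x, X g -> T x -> T (Ad r g x)) ->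
    forall g, X g -> forall u, W T u -> W T (u *m a g).
  by move=> TX g Xg u Tu; rewrite /W /= aE' mxvecK; apply: TX.
have [|v [S'v nv Hv]] := @lie_kolchin R G (n + n * n.+1) a a1 aM areg X (W S) (W S') Xi sX
    (LW _ LS) (LW _ LS') (WX _ SX) (WX _ S'X).
  by exists (mxvec x0); rewrite /W /= mxvecK.
exists (@vec_mx _ n.+1 n.+1 v); split=> // g /Hv [z]; rewrite /W /= => Hz; exists z.
by rewrite -[Ad _ _ _]mxvecK -aE' -linearZ -linearB.
Qed.

(** By Cayley-Hamilton the inverse is a polynomial in [x]. *)
Lemma subalgebra_inv S x y : subalgebra S -> S x -> x * y = 1 -> S y.
Proof.
move=> SA Sx xy; have [LS S1 SM] := SA.
pose c := (char_poly x).[0].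
have c0 : c != 0.
  apply/eqP => c0; have : eigenvalue x 0 by rewrite eigenvalue_root_char; apply/eqP.
  move=> /eigenvalueP [v vx]; rewrite -[v]mulmx1 -[1%:M]/(1 : M) -xy -[x * y]/(x *m y) mulmxA vx.
  by rewrite scale0r mul0mx eqxx.
have : root (char_poly x - c%:P) 0 by rewrite /root hornerD hornerN hornerC subrr.
move=> /factor_theorem [q]; rewrite subr0 => /(congr1 (horner_mx x)).
rewrite rmorphB rmorphM /= horner_mx_C horner_mx_X Cayley_Hamilton sub0r => qx.
have -> : y = (- c)^-1 *: horner_mx x q.
  rewrite -[horner_mx x q]mulr1 -xy mulrA -qx -scalemx1 -scaleNr.
  by rewrite -scalerAl mul1r scalerA mulVf ?scale1r // oppr_eq0.
by apply: linear_setZ => //; apply: subalgebra_horner.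
Qed.

Lemma zclosed_linear S x : linear_set S -> zclosed [set g | S (r g - x)].
Proof.
move=> LS; pose I := {f : {linear M -> C^o} | forall y, S y -> f y = 0}.
suff -> : [set g | S (r g - x)] = [set g | forall f : I, sval f (r g) = sval f x].
  apply: zclosed_bigcap => f; apply: zclosed_eq; last exact: regC.
  rewrite (_ : (fun g => _) = fun g => ev (linform (sval f)) (r g)); first exact: reg_ev.
  by apply/funext => g; rewrite ev_linform.
apply/seteqP; split=> g /= H.
  by case=> f /= /(_ _ H); rewrite linearB => /eqP; rewrite subr_eq0 => /eqP.
apply: (linear_setP LS) => f fS; rewrite linearB /=.
by have /= -> := H (exist _ f fS); rewrite subrr.
Qed.

Lemma subalgebra_group S : subalgebra S ->
  subgroup [set g | S (r g)] /\ zclosed [set g | S (r g)].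
Proof.
move=> SA; have [LS S1 SM] := SA; split; last first.
  have := zclosed_linear 0 LS; congr zclosed; apply/seteqP.
  by split=> g /=; rewrite subr0.
split=> [|g h Sg Sh] /=; first by rewrite rho1.
by rewrite rhoM; apply: SM => //; apply: (subalgebra_inv SA Sh); apply: rhoV.
Qed.

(** The derived series descends through the groups [T j] of elements congruent to [1] modulo
    [lowering F j]: a commutator of two elements of [T j.+1] lies in [T (j.+1 + j.+1)]. *)
Lemma solvable_flag F m X : filtration F m -> subgroup X ->
  (forall g, X g -> flag_alg F (r g)) -> solvable_subgroup X.
Proof.
move=> Fm sX XF; split=> //; exists m.+1.
have [FL FS F0 Fall] := Fm; have LL j := lowering_linear Fm j.
pose T j := [set g | X g /\ lowering F j (r g - 1)].
have sT j : subgroup (T j).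
  split=> [|g h [Xg Hg] [Xh Hh]].
    by split; [exact: subgroup1 sX|rewrite rho1 subrr; case: (LL j)].
  have XV := subgroupV sX Xh; split; first exact: (subgroupM sX Xg XV).
  have -> : r (g / h)%g - 1 = ((r g - 1) - (r h - 1)) * r h^-1%g.
    by rewrite opprB addrA subrK rhoM mulrBl rhoV.
  exact: (lowering_stable Fm (linear_setB (LL j) Hg Hh) (XF _ XV)).
have com j g h : X g -> X h -> lowering F j (bracket (r g) (r h)) -> T j [~ g, h]%g.
  move=> Xg Xh H; have Xc' := subgroupM sX (subgroupV sX Xg) (subgroupV sX Xh).
  split; first by rewrite commgEl; exact: (subgroupM sX (subgroupV sX Xg) (subgroupJ sX Xg Xh)).
  have -> : r [~ g, h]%g - 1 = r (g^-1 * h^-1)%g * bracket (r g) (r h).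
    rewrite /bracket mulrBr -!rhoM commgEl conjgE !mulgA; congr (_ - _).
    by rewrite -!mulgA mulKg mulVg rho1.
  exact: (stable_lowering Fm (XF _ Xc') H).
have D1 : derived_subgroup X `<=` T 1%N.
  move=> x; apply=> // g h Xg Xh; apply: com => //.
  exact: (flag_commutator Fm (XF _ Xg) (XF _ Xh)).
have DT j : iter j.+1 (@derived_subgroup R G) X `<=` T j.+1.
  elim: j => [|j IH] //; rewrite iterS => y; apply=> // g h /IH [Xg Hg] /IH [Xh Hh].
  apply: com => //; have -> : bracket (r g) (r h) = bracket (r g - 1) (r h - 1).
    have b1 (x : M) : bracket x 1 = 0 by rewrite /bracket mulr1 mul1r subrr.
    by rewrite bracketBr b1 subr0 [RHS]bracketC bracketBr b1 subr0 -bracketC.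
  apply: (lowering_le Fm (_ : (j.+2 <= j.+1 + j.+1)%N)); first by rewrite addnS ltnS leq_addr.
  by apply: (linear_setB (LL _)); apply: loweringM.
move=> x /DT [_ H]; apply: (rho_inj (r := r)).
apply/eqP; rewrite rho1 -subr_eq0; apply/eqP; apply: (lowering_all Fm).
exact: (lowering_le Fm (leqnSn m) H).
Qed.

Lemma flag_group F m : filtration F m -> exists X,
  [/\ closed_connected_subgroup X, solvable_subgroup X,
   forall Y, closed_connected_subgroup Y -> (forall g, Y g -> flag_alg F (r g)) -> Y `<=` X &
   forall x, lieg setT x -> flag_alg F x -> lieg X x].
Proof.
move=> Fm; have SA := flag_alg_subalgebra Fm; have [sS cS] := subalgebra_group SA.
have [X XP] := component_exists sS cS.
have [XS sX cX iX [irrX conX _]] := XP; exists X; split.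
- exact: component_connected XP.
- by apply: (solvable_flag Fm sX) => g /XS.
- by move=> Y [sY cY conY] YF; apply: conX => //; apply: subgroup1 sY.
move=> x gx Fx; apply: (lieg_component sS cS XP).
have sT : subgroup (setT : set G) by [].
by apply: liegS (lieg_subalgebra sT (@zclosedT R G) SA gx Fx) => g [_].
Qed.

(** Closed connected subgroups are irreducible, so a strictly increasing sequence of candidates
    would exceed the bound on chains. *)
Lemma borel_exists X : closed_connected_subgroup X -> solvable_subgroup X ->
  exists2 B, borel_subgroup B & X `<=` B.
Proof.
move=> cX solX; apply: contrapT => H.
pose cand (B : set G) := closed_connected_subgroup B /\ solvable_subgroup B.
have next B : exists B', cand B /\ X `<=` B -> [/\ cand B', X `<=` B' & B `<` B'].
  have [[cB XB]|nB] := pselect (cand B /\ X `<=` B); last by exists B => /nB.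
  apply: contrapT => nex; apply: H; exists B => //; split=> // B' cB' BB'.
  apply: contrapT => ne; apply: nex; exists B' => _; split=> //.
    by apply: subset_trans BB'.
  by split=> // B'B; apply: ne; apply/seteqP.
have /choice [f fP] := next.
pose Z i := iter i f X.
have ZP i : cand (Z i) /\ X `<=` Z i.
  by elim: i => [|i /fP [? ? _]]; split.
suff : ((ambient G).+1 <= ambient G)%N by rewrite ltnn.
apply: (@krull_bound R G _ Z) => i _; last by have [_ _] := fP _ (ZP i).
have [[cZ _] _] := ZP i; split; first by case: cZ.
exact: connected_irreducible.
Qed.

(** The connected solvable group attached to the flag contains [B], hence equals [B] by
    maximality. *)
Lemma borel_lie B F m x : borel_subgroup B -> filtration F m ->
  (forall g, B g -> flag_alg F (r g)) -> lieg setT x -> flag_alg F x -> lieg B x.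
Proof.
move=> [[cB sB] Bmax] Fm BF gx Fx; have [X [cX sX XP Xx]] := flag_group Fm.
by rewrite -(Bmax X) //; [apply: Xx|apply: XP].
Qed.

Lemma closed_sub_of_lie X Y : closed_connected_subgroup Y -> subgroup X -> zclosed X ->
  (forall x, lieg Y x -> lieg X x) -> Y `<=` X.
Proof.
move=> cY sX cX YX g Yg; have [sY _ _] := cY.
suff [h Xh /rho_inj <- //] : (r @` X) (r g).
apply: (zclosed_rho (r := r) cX) => p pX.
apply: (jet_zero_vanish (mulclosed_rho r sY) (zirreducible_rho (connected_irreducible cY))); last by exists g.
move=> l lY; suff V : vanish (r @` X) (foldr (@D C n.+1) p l).
  by apply: V; exists 1%g; [apply: subgroup1 sX|apply: rho1].
elim: l lY => [|x l IH] lY //; apply: (lieP (mulclosed_rho r sX)).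
  by apply/YX/lY/mem_head.
by apply: IH => y yl; apply: lY; rewrite in_cons yl orbT.
Qed.

Lemma expm_trivial x : x ^+ n.+1 = 0 -> (forall t, expm t x = 1) -> x = 0.
Proof.
move=> xn ex; have : lie [set (1 : M)] x by apply: lie_of_expm.
move=> H; apply/matrixP => i j; rewrite mxE -dev_cf1; apply: H => _ ->; exact: ev_cf1.
Qed.

Lemma Ad_expm g t x : Ad r g (expm t x) = expm t (Ad r g x).
Proof.
rewrite /expm; have AdL : linear (Ad r g) by move=> c u v; apply: Ad_linear.
pose f := HB.pack_for {linear M -> M} (Ad r g) (GRing.isLinear.Build _ _ _ _ _ AdL).
rewrite -[LHS]/(f _) linear_sum; apply: eq_bigr => k _.
by rewrite linearZ /= /f /= AdX.
Qed.

End SolvableSubgroups.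

(** * Nondegeneracy of the trace form *)

Section TraceForm.
Context {R : realType} {G : affine_group R} {n : nat}.
Variable r : @linear_model R G n.
Local Notation C := R[i].
Local Notation M := ('M[C]_n.+1).
Local Notation V := ('rV[C]_n.+1).
Implicit Types (X Y B P K U : set G) (x y z : M) (g h : G) (N S : set M).
Local Notation lieg := (lieg r).

Lemma nil_products_filtration N m : nil_products N m -> exists F : nat -> set V,
  filtration F m /\ forall x, N x -> lowering F 1 x.
Proof.
move=> Nm; pose F i := [set v : V | forall l : seq M, (i <= size l)%N ->
  (forall y, y \in l -> N y) -> v *m (\prod_(y <- l) y) = 0].
exists F; split; first split.
- move=> i; split=> [l _ _|c u v Fu Fv l il lN]; first by rewrite mul0mx.
  by rewrite mulmxDl -scalemxAl Fu // Fv // scaler0 addr0.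
- by move=> i v Fv l il; apply: Fv; apply: ltnW.
- by move=> v /(_ [::]); rewrite big_nil mulmx1; apply.
- by move=> v l ml lN; rewrite (nil_productsW Nm) ?mulmx0.
move=> x Nx i v; rewrite addn1 => Fv l il lN.
have := Fv (x :: l); rewrite big_cons -[x * _]/(x *m _) mulmxA; apply=> // y.
by rewrite in_cons => /orP [/eqP ->|/lN].
Qed.

Lemma flag_alg_unipotent F x : @lowering C n F 1 (x - 1) -> flag_alg F x.
Proof.
move=> H i; exists 1 => v Fv; have := H i v; rewrite addn1 mulmxBr mulmx1 scale1r.
exact.
Qed.

Lemma lowering_expm F m t x : @filtration C n F m -> lowering F 1 x -> lowering F 1 (expm t x - 1).
Proof.
move=> Fm Fx; have LL := lowering_linear Fm 1.
rewrite /expm big_ord_recl /= expr0 expr0 fact0 divr1 scale1r addrAC subrr add0r.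
apply: (linear_set_sum LL) => i _; apply: (linear_setZ _ LL).
rewrite /bump /= add1n; elim: (val i) => [|k IH]; first by rewrite expr1.
by rewrite exprS; apply: (lowering_le Fm (_ : 1 <= 1 + 1)%N) => //; apply: loweringM.
Qed.

(** Engel's theorem puts [N] in a common flag. [K] is the closed subgroup generated by the
    exponentials of [N], defined as an intersection so that each property can be checked on
    generators. *)
Lemma nilpotent_ideal_group P N : subgroup P -> zclosed P -> linear_set N ->
  (forall x, N x -> lieg P x) -> (forall g x, P g -> N x -> N (Ad r g x)) ->
  (forall x, N x -> x ^+ n.+1 = 0) ->
  exists K, [/\ normal_in P K, closed_connected_subgroup K, solvable_subgroup K,
    forall u, K u -> unipotent u & forall x t, N x -> exists2 g, K g & r g = expm t x].
Proof.
move=> sP cP LN NP NAd Nn.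
have NB x y : N x -> N y -> N (bracket x y).
  move=> Nx Ny; apply: (lieg_bracket LN (X := P)); last exact: NP.
  by move=> g Pg; apply: NAd.
have [m /nil_products_filtration [F [Fm NF]]] := engel LN NB Nn.
have [FA LL] := (flag_alg_subalgebra Fm, lowering_linear Fm 1).
have [LA A1 AM] := FA.
pose gen Q := forall x t h, N x -> r h = expm t x -> Q h.
pose K := [set g | forall Q : set G, subgroup Q -> zclosed Q -> gen Q -> Q g].
have sK : subgroup K.
  split=> [Q sQ _ _|g h Kg Kh Q sQ cQ gQ]; first exact: subgroup1 sQ.
  by case: sQ (sQ) => _ H sQ; apply: H; [apply: Kg|apply: Kh].
have cK : zclosed K.
  apply/zclosedP => g Kg Q sQ cQ gQ.
  by apply: (zclosure_min (X := K) cQ) Kg => h; apply.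
have genK : gen K by move=> x t h Nx hE Q _ _ gQ; exact: (gQ x t h Nx hE).
have expK x t : N x -> exists2 g, K g & r g = expm t x.
  move=> Nx; have [g Pg gE] := expm_in_group t sP cP (NP x Nx) (Nn x Nx).
  by exists g => //; apply: genK gE.
have KP : K `<=` P.
  move=> g; apply=> // x t h Nx hE.
  have [h' Ph' h'E] := expm_in_group t sP cP (NP x Nx) (Nn x Nx).
  by rewrite (_ : h = h') //; apply: (rho_inj (r := r)); rewrite hE.
have KA g : K g -> lowering F 1 (r g - 1).
  move=> Kg; have : [set a | lowering F 1 (r a - 1)] g; last by [].
  apply: Kg.
  - split=> [|a b Ha Hb] /=; first by rewrite rho1 subrr; case: LL.
    have Fa h : lowering F 1 (r h - 1) -> flag_alg F (r h).
      exact: flag_alg_unipotent.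
    have -> : r (a / b)%g - 1 = ((r a - 1) - (r b - 1)) * r b^-1%g.
      by rewrite opprB addrA subrK rhoM mulrBl rhoV.
    apply: (lowering_stable Fm (linear_setB LL Ha Hb)).
    by apply: (subalgebra_inv FA (Fa _ Hb)); apply: rhoV.
  - exact: zclosed_linear.
  - by move=> x t h Nx /= ->; apply: (lowering_expm _ Fm); apply: NF.
(* Each one-parameter subgroup lies in the identity component, so [K] is connected. *)
have [K0 K0P] := component_exists sK cK; have [K0K sK0 cK0 _ _] := K0P.
have KK0 : K = K0.
  apply/seteqP; split=> // g; apply=> // x t h Nx hE.
  have lx : lieg K x.
    by apply: lie_of_expm (Nn x Nx) => s; have [k Kk kE] := expK x s Nx; exists k.
  have [k K0k kE] := expm_in_component t sK cK K0P lx (Nn x Nx).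
  by rewrite (_ : h = k) //; apply: (rho_inj (r := r)); rewrite hE.
exists K; split=> //.
- split=> // g p Kg Pp Q sQ cQ gQ; have : [set a | Q (a ^ p)%g] g; last by [].
  apply: Kg => /=.
  - split=> [|a b Qa Qb] /=; first by rewrite conj1g; apply: subgroup1 sQ.
    by rewrite conjMg conjVg; case: sQ => _; apply.
  - by apply: zclosed_preim => //; apply: regmapJ; [apply: regmap_id|apply: regmapC].
  - move=> x t h Nx hE /=; apply: (gQ (Ad r p x) t); first exact: NAd.
    by rewrite conjgE !rhoM mulrA -Ad_expm hE.
- by rewrite KK0; apply: component_connected K0P.
- apply: (solvable_flag (r := r) Fm sK) => g /KA; exact: flag_alg_unipotent.
- by move=> u /KA H; apply: (unipotent_rho (r := r) (k := m)); apply: (lowering_nil Fm).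
Qed.

(** Some [real_exp c] separates a nonzero eigenvalue from [0]; then [smap (real_exp c) x], the image
    of an element of [U], would have an eigenvalue other than [1]. *)
Lemma lieg_unipotent U x : subgroup U -> zclosed U -> (forall u, U u -> unipotent u) ->
  lieg U x -> x ^+ n.+1 = 0.
Proof.
move=> sU cU uU Ux.
have eig0 a : a \in eigs x -> a = 0.
  move=> ax; have [->//|a0] := eqVneq a 0.
  have [_ _ /(_ [:: a; 0])] := real_exp_separating R; rewrite /= mem_seq1 a0 => /(_ isT) [E' [c _ <-] injE].
  have [g Ug gE] := smap_in_group sU cU Ux (real_exp_exponential c).
  have rr : rational_representation r.
    by split; [apply: rho1|apply: rhoM|apply: rho_reg].
  have [k gk] : exists k, (r g - 1) ^+ k = 0 := uU g Ug _ _ rr.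
  rewrite gE in gk.
  have ea : real_exp c a = 1.
    have pr : sproj x a * (smap (real_exp c) x - 1) = (real_exp c a - 1) *: sproj x a.
      by rewrite mulrBr mulr1 proj_smap // scalerBl scale1r.
    have prk j : sproj x a * (smap (real_exp c) x - 1) ^+ j = (real_exp c a - 1) ^+ j *: sproj x a.
      elim: j => [|j IH]; first by rewrite !expr0 mulr1 scale1r.
      by rewrite exprSr mulrA IH -scalerAl pr scalerA exprSr.
    have := prk k; rewrite gk mulr0 => /eqP; rewrite eq_sym scaler_eq0.
    by rewrite (negPf (sproj_neq0 ax)) orbF expf_eq0 subr_eq0 => /andP [_ /eqP].
  have e0 : real_exp c 0 = 1 by case: (real_exp_exponential c).
  by apply: injE; rewrite ?inE ?eqxx ?orbT // ea e0.
rewrite -[RHS](npart_nil x); congr (_ ^+ _); rewrite /npart /smap big_seq big1 ?subr0 //.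
by move=> a /eig0 ->; rewrite scale0r.
Qed.

(** Along [exp (t x)] each torus coordinate is a polynomial in [t] without zeros, hence constant, so
    the curve is constant. *)
Lemma torus_nilpotent T x : torus T -> lieg T x -> x ^+ n.+1 = 0 -> x = 0.
Proof.
move=> [sT [cT [k [f [fp fM f0 _ fq]]]]] Tx xn.
have ex t := expm_in_group t sT cT Tx xn.
have fconst s t g h : T g -> T h -> r g = expm s x -> r h = expm t x -> f g = f h.
  move=> Tg Th gE hE; apply/rowP => j; have [p pE] := fp j.
  have /(regE r) [q qE] : reg (fun g => eval_at p (coord g)) by exists p.
  have fE u a : T a -> r a = expm u x -> f a 0 j = (pathev q (expath x)).[u].
    by move=> Ta aE; rewrite pE // qE aE horner_pathev at_expath.
  have /size_poly1P [c _ qc] : size (pathev q (expath x)) == 1%N.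
    apply/negPn/negP => /closed_rootP [u]; have [a Ta aE] := ex u.
    by rewrite /root -(fE u a Ta aE) (negPf (f0 a Ta j)).
  by rewrite (fE s g) // (fE t h) // qc !hornerC.
apply: (expm_trivial xn) => t; have [g Tg gE] := ex t; have T1 := subgroup1 sT.
rewrite -gE -(rho1 r); congr (r _); apply: coord_inj; apply/rowP => i; have [q qE] := fq i.
have e : f g = f 1%g by apply: (fconst t 0) => //; rewrite expm0 rho1.
by rewrite qE // qE // e.
Qed.

Lemma reductive_trace_form x : reductive G -> lieg setT x ->
  (forall y, lieg setT y -> \tr (x * y) = 0) -> x = 0.
Proof.
move=> [conG [T [_ maxT] tT]] gx xo.
have sG : subgroup (setT : set G) by [].
have LG := lieg_linear r setT; have cG := @zclosedT R G.
pose N := [set z | lieg setT z /\ forall y, lieg setT y -> \tr (z * y) = 0].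
have Ng z : N z -> lieg setT z by case.
have Nn z : N z -> z ^+ n.+1 = 0.
  move=> [gz zo]; apply: trace_conj_nilpotent; apply: zo.
  by apply: lieg_smap => // a b; rewrite rmorphD.
have LN : linear_set N.
  split=> [|c u v [gu uo] [gv vo]].
    by split; [case: LG|move=> y _; rewrite mul0r mxtrace0].
  split=> [|y gy]; first by case: LG => _; apply.
  by rewrite mulrDl -scalerAl linearD linearZ /= uo // vo // mulr0 addr0.
have NA g z : setT g -> N z -> N (Ad r g z).
  move=> _ [gz zo]; split; first by apply: lieg_Ad gz.
  move=> y gy; rewrite -[y](AdKV r g) Ad_trace; apply: zo.
  by apply: lieg_Ad gy.
have [K [nK cK solK _ expK]] := nilpotent_ideal_group sG cG LN Ng NA Nn.
have KT : K `<=` T by apply: maxT.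
have Nx : N x by [].
apply: (torus_nilpotent tT) (Nn _ Nx) => //.
by apply: lie_of_expm (Nn _ Nx) => t; have [k Kk kE] := expK x t Nx; exists k => //; apply: KT.
Qed.

End TraceForm.

(** * The theorems of Jacobson and Morozov *)

Section TraceDuality.
Variables (C : numClosedFieldType) (n : nat).
Local Notation M := ('M[C]_n.+1).
Implicit Types (x y z : M) (W : set M).

Lemma trace_functional (f : {linear M -> C^o}) : exists F, forall x, f x = \tr (F * x).
Proof.
exists (\matrix_(i, j) f (delta_mx j i)) => x.
rewrite [in LHS](matrix_sum_delta x) linear_sum.
transitivity (\sum_i \sum_j x i j * f (delta_mx i j)).
  by apply: eq_bigr => i _; rewrite linear_sum; apply: eq_bigr => j _; rewrite linearZ.
rewrite exchange_big; apply: eq_bigr => i _; rewrite mxE.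
by apply: eq_bigr => j _; rewrite mxE mulrC.
Qed.

Variable g : set M.
Hypothesis gL : linear_set g.
Hypothesis g0 : forall x, g x -> (forall y, g y -> \tr (x * y) = 0) -> x = 0.

Lemma riesz (f : {linear M -> C^o}) : exists2 z, g z & forall x, g x -> f x = \tr (z * x).
Proof.
have [F FE] := trace_functional f.
pose S := [set u | exists2 z, g z & forall x, g x -> \tr ((u - z) * x) = 0].
suff : S F.
  move=> [z gz H]; exists z => // x gx; apply/eqP; rewrite FE -subr_eq0 -raddfB /= -mulrBl.
  by rewrite H.
have LS : linear_set S.
  split=> [|c u v [z gz Hz] [w gw Hw]].
    by exists 0; [case: gL|move=> x _; rewrite subrr mul0r mxtrace0].
  exists (c *: z + w); first by case: gL => _; apply.
  move=> x gx; rewrite opprD addrACA -scalerBr mulrDl linearD /= -scalerAl linearZ /=.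
  by rewrite Hz // Hw // mulr0 addr0.
apply: (linear_setP LS) => h hS; have [K KE] := trace_functional h.
suff K0 : K = 0 by rewrite KE K0 mul0r mxtrace0.
apply: g0 => [|y gy]; last first.
  by rewrite -KE; apply: hS; exists y => // x _; rewrite subrr mul0r mxtrace0.
apply: (linear_setP gL) => f' f'g; have [F' F'E] := trace_functional f'.
rewrite F'E mxtrace_mulC -[_ *m _]/(_ * _) -KE; apply: hS; exists 0; first by case: gL.
by move=> x gx; rewrite subr0 -F'E f'g.
Qed.

Lemma perp_perp W x : linear_set W -> W `<=` g -> g x ->
  (forall y, g y -> (forall w, W w -> \tr (y * w) = 0) -> \tr (y * x) = 0) -> W x.
Proof.
move=> LW Wg gx H; apply: (linear_setP LW) => f fW; have [z gz fE] := riesz f.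
by rewrite fE // H // => w Ww; rewrite -fE ?fW //; apply: Wg.
Qed.

End TraceDuality.

Section JacobsonMorozov.
Variables (C : numClosedFieldType) (n : nat).
Local Notation M := ('M[C]_n.+1).
Local Notation V := ('rV[C]_n.+1).
Implicit Types (x y z w d e h : M).

Lemma iter_bracket_nil e m w : e ^+ m = 0 -> iter (m + m) (bracket e) w = 0.
Proof.
move=> em; pose Q i w := forall a b, (i <= a + b)%N -> e ^+ a * w * e ^+ b = 0.
have eX k : (m <= k)%N -> e ^+ k = 0 by move=> /subnK <-; rewrite exprD em mulr0.
have Q0 u : Q (m + m)%N u.
  move=> a b mab; have [ma|ma] := leqP m a; first by rewrite eX // !mul0r.
  by rewrite [e ^+ b]eX ?mulr0 // -(leq_add2l a); apply: leq_trans mab; rewrite leq_add2r ltnW.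
have Qk k i u : Q (k + i)%N u -> Q i (iter k (bracket e) u).
  elim: k i u => [|k IH] i u Qu //; rewrite iterSr; apply: IH => a b kab.
  rewrite /bracket mulrBr mulrBl mulrA -exprSr Qu ?addSn ?ltnS // sub0r.
  by rewrite -mulrA -mulrA -exprS mulrA Qu ?oppr0 // addSn addnS ltnS.
have := Qk (m + m)%N 0%N w; rewrite addn0 => /(_ (Q0 w) 0%N 0%N isT).
by rewrite expr0 mul1r mulr1.
Qed.

Section Nilpotency.
Variables (e z : M) (m : nat).
Hypotheses (em : e ^+ m = 0) (ec : bracket e (bracket e z) = 0).
Let c := bracket e z.

Lemma iter_bracket_mul k u : iter k.+1 (bracket e) (u * z) =
  iter k.+1 (bracket e) u * z + k.+1%:R *: (iter k (bracket e) u * c).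
Proof.
elim: k => [|k IH]; first by rewrite /= bracketMr scale1r.
rewrite iterS IH bracketDr bracketZr !bracketMr ec mulr0 addr0 -addrA -iterS; congr (_ + _).
by rewrite -[X in X + _]scale1r -scalerDl nat1r.
Qed.

(** The [k]-th power of [ad e] sends [z ^+ k] to [c ^+ k] times the factorial of [k], and [ad e] is
    nilpotent. *)
Lemma bracket_nilpotent : exists k, c ^+ k = 0.
Proof.
have H k : iter k (bracket e) (z ^+ k) = k`!%:R *: c ^+ k /\ iter k.+1 (bracket e) (z ^+ k) = 0.
  elim: k => [|k [IH1 IH2]].
    by rewrite expr0 fact0 scale1r /= /bracket mulr1 mul1r subrr.
  have E j : (k <= j)%N -> iter j.+1 (bracket e) (z ^+ k.+1) =
      (j.+1)%:R *: (iter j (bracket e) (z ^+ k) * c).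
    move=> /subnK <-; rewrite exprSr iter_bracket_mul -addnS iterD IH2 iter_bracket0 mul0r.
    by rewrite add0r.
  split; first by rewrite E // IH1 -scalerAl scalerA -natrM -factS exprSr.
  by rewrite E // IH2 mul0r scaler0.
exists (m + m)%N; have [] := H (m + m)%N; rewrite iter_bracket_nil // => /esym /eqP.
by rewrite scaler_eq0 pnatr_eq0 eqn0Ngt fact_gt0 => /eqP.
Qed.

(** With [F i] the kernel of [e ^+ i], the product [z * e] acts on [F i.+1] modulo [F i] as [- i.+1]
    times [c], which is nilpotent; so [z * e] is nilpotent. *)
Lemma bracket_kernel_trace : \tr (e * z) = 0.
Proof.
have [k ck] := bracket_nilpotent.
have ecc : e * c = c * e by apply/eqP; rewrite -subr_eq0; apply/eqP.
have ez : e * z = z * e + c by rewrite addrC subrK.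
pose F i := [set v : V | v *m (e ^+ i) = 0].
have FL i : linear_set (F i).
  split=> [|a u v Fu Fv]; rewrite /F /= ?mul0mx // mulmxDl -scalemxAl.
  by rewrite (Fu : _ = 0) (Fv : _ = 0) scaler0 addr0.
have FS i : F i `<=` F i.+1.
  by move=> v Fv; rewrite /F /= exprSr -[_ * e]/(_ *m e) mulmxA (Fv : _ = 0) mul0mx.
have Ff : filtration F m.
  by split=> // [v|v]; rewrite /F /= ?em ?mulmx0 // expr0 mulmx1.
have eXc i : e ^+ i * c = c * e ^+ i.
  by elim: i => [|i IH]; rewrite ?expr0 ?mulr1 ?mul1r // exprS -mulrA IH !mulrA ecc.
have eXz i : e ^+ i.+1 * z = z * e ^+ i.+1 + i.+1%:R *: (c * e ^+ i).
  elim: i => [|i IH]; first by rewrite !expr1 expr0 mulr1 scale1r.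
  rewrite exprS -mulrA IH mulrDr -scalerAr [e * (z * _)]mulrA ez [e * (c * _)]mulrA ecc.
  rewrite mulrDl -[z * e * _]mulrA -[c * e * _]mulrA -!exprS -addrA.
  by congr (_ + _); rewrite -[X in X + _]scale1r -scalerDl nat1r.
have Fc i v : F i v -> F i (v *m c).
  move=> Fv; rewrite /F /= -mulmxA -[c *m _]/(c * _) -eXc -[_ * c]/(_ *m c) mulmxA.
  by rewrite (Fv : _ = 0) mul0mx.
have step i v : F i.+1 v -> F i (v *m (z * e) + i.+1%:R *: (v *m c)).
  move=> Fv; rewrite /F /= mulmxDl -scalemxAl -mulmxA -[_ *m e ^+ i]/(_ * _) -mulrA -exprS.
  rewrite -[X in _ + _ *: X]mulmxA -[c *m _]/(c * _) scalemxAr -mulmxDr -eXz.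
  by rewrite -[_ * z]/(_ *m z) mulmxA (Fv : _ = 0) mul0mx.
have Fze i v : F i v -> F i (v *m (z * e)).
  case: i => [|i] Fv.
    by move: Fv; rewrite /F /= expr0 mulmx1 => ->; rewrite mul0mx mul0mx.
  rewrite -[_ *m _](addrK (i.+1%:R *: (v *m c))); apply: (linear_setB (FL _)).
    by apply: FS; apply: step.
  by apply: (linear_setZ _ (FL _)); apply: Fc.
have pow i v j : F i.+1 v ->
    F i (v *m ((z * e) ^+ j) - (- i.+1%:R) ^+ j *: (v *m (c ^+ j))).
  move=> Fv; elim: j => [|j IH].
    by rewrite !expr0 scale1r subrr; case: (FL i).
  set A := v *m (z * e) ^+ j in IH *; set B := v *m c ^+ j in IH *.
  have FcB : F i.+1 B.
    rewrite /B; elim: (j) => [|l IHl]; first by rewrite expr0 mulmx1.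
    by rewrite exprSr -[_ * c]/(_ *m c) mulmxA; apply: Fc.
  have -> : v *m ((z * e) ^+ j.+1) - (- i.+1%:R) ^+ j.+1 *: (v *m (c ^+ j.+1)) =
     (A - (- i.+1%:R) ^+ j *: B) *m (z * e) +
     (- i.+1%:R) ^+ j *: (B *m (z * e) + i.+1%:R *: (B *m c)).
    rewrite exprSr -[_ * (z * e)]/(_ *m (z * e)) mulmxA -/A mulmxBl -scalemxAl scalerDr.
    rewrite addrA subrK scalerA; congr (_ + _).
    rewrite [c ^+ _]exprSr -[_ * c]/(_ *m c) mulmxA -/B -scaleNr; congr (_ *: _).
    by rewrite exprSr mulrN opprK.
  apply: (linear_setD (FL i)); first exact: Fze.
  by apply: (linear_setZ _ (FL i)); apply: step.
have lowk : lowering F 1 ((z * e) ^+ k).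
  move=> i v; rewrite addn1 => Fv; have := pow i v k Fv.
  by rewrite ck mulmx0 scaler0 subr0.
rewrite [LHS]mxtrace_mulC; apply: (@nilpotent_trace _ _ (z * e) (k * m)).
by rewrite exprM; apply: (lowering_nil Ff).
Qed.

End Nilpotency.

(** The left side runs, up to sign, through the image of the square of [ad e]. By nondegeneracy this
    image contains [e] as soon as [e] is orthogonal to all [z] with [[e, [e, z]] = 0], which is
    [bracket_kernel_trace]. *)
Theorem jacobson_morozov (g : set M) e m : linear_set g ->
  (forall x y, g x -> g y -> g (bracket x y)) ->
  (forall x, g x -> (forall y, g y -> \tr (x * y) = 0) -> x = 0) ->
  g e -> e ^+ m = 0 -> exists2 y, g y & bracket (bracket e y) e = 2%:R *: e.
Proof.
move=> gL gB g0 ge em.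
pose W := [set u | exists2 y, g y & bracket (bracket e y) e = u].
have LW : linear_set W.
  split=> [|c _ _ [y gy <-] [y' gy' <-]].
    by exists 0; [case: gL|rewrite bracket0r bracketC bracket0r oppr0].
  exists (c *: y + y'); first by case: gL => _; apply.
  by rewrite bracketDr bracketDl bracketZr bracketZl.
suff [y gy yE] : W (2%:R *: e) by exists y.
apply: (linear_setZ _ LW); apply: (perp_perp gL g0 LW) => // [_ [y gy <-]|z gz zW].
  exact: (gB _ _ (gB _ _ ge gy) ge).
rewrite mxtrace_mulC; apply: (bracket_kernel_trace em).
apply: g0 => [|y gy]; first exact: (gB _ _ ge (gB _ _ ge gz)).
rewrite trace_bracket trace_bracket [bracket y e]bracketC -scaleN1r bracketZl -scalerAr.
rewrite linearZ /= zW ?mulr0 //.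
by exists y.
Qed.

Section Jacobson.
Variables (e y h : M) (m : nat).
Hypotheses (em : e ^+ m = 0) (hE : h = bracket e y) (he : bracket h e = 2%:R *: e).

Lemma bracket_h_e a : bracket h (bracket e a) = bracket e (bracket h a) + 2%:R *: bracket e a.
Proof. by rewrite bracket_bracket he bracketZl addrC. Qed.

(** The commutation rule of [sl2]: [[(ad e)^(i+1), ad y] = (i+1) (ad h - i) (ad e)^i]. *)
Lemma iter_bracket_y i w : iter i.+1 (bracket e) (bracket y w) =
  bracket y (iter i.+1 (bracket e) w) +
  i.+1%:R *: (bracket h (iter i (bracket e) w) - i%:R *: iter i (bracket e) w).
Proof.
elim: i => [|i IH].
  by rewrite /= bracket_bracket -hE scale0r subr0 scale1r addrC.
rewrite iterS IH bracketDr (bracketZr i.+1%:R) (bracketBr (bracket h _)) (bracketZr i%:R).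
rewrite [in LHS]bracket_bracket -hE -!iterS.
set u := iter i.+1 (bracket e) w.
have -> : bracket e (bracket h (iter i (bracket e) w)) = bracket h u - 2%:R *: u.
  by apply/eqP; rewrite eq_sym subr_eq; apply/eqP; apply: bracket_h_e.
rewrite [bracket h u + _]addrC -addrA; congr (_ + _).
apply/matrixP => a b; rewrite !mxE; move: (bracket h u a b) (u a b) => p q.
rewrite -[i.+2]addn2 -[i.+1]addn1 !natrD; ring.
Qed.

(** On the kernel of [ad e], the operator [ad h - i] moves the image of the [i]-th power of [ad e]
    into that of the next power. These images vanish eventually, which leaves only natural numbers
    as weights. *)
Lemma jacobson_step i w d : d = iter i (bracket e) w -> bracket e d = 0 ->
  exists w', bracket h d - i%:R *: d = iter i.+1 (bracket e) w' /\
    bracket e (bracket h d - i%:R *: d) = 0.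
Proof.
move=> dE d0; exists (i.+1%:R^-1 *: bracket y w); split.
  rewrite iter_bracketZ iter_bracket_y iterS -dE d0 bracket0r add0r scalerA.
  by rewrite mulVf ?scale1r // pnatr_eq0.
rewrite bracketBr bracketZr d0 scaler0 subr0.
have := bracket_h_e d; rewrite d0 bracket0r scaler0 addr0 => <- //.
Qed.

Lemma iter_nil i w : (m + m <= i)%N -> iter i (bracket e) w = 0.
Proof. by move=> /subnK <-; rewrite iterD (iter_bracket_nil _ em) iter_bracket0. Qed.

Lemma jacobson_eigenvalue d c : bracket e d = 0 -> bracket h d = c *: d -> d != 0 ->
  exists j : nat, c = j%:R.
Proof.
move=> d0 dc dn; apply: contrapT => H.
suff E i : exists w, d = iter i (bracket e) w.
  by have [w dE] := E (m + m)%N; case/eqP: dn; rewrite dE iter_nil.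
elim: i => [|i [w dE]]; first by exists d.
have [w' [wE _]] := jacobson_step dE d0.
have ci : c - i%:R != 0 by apply: contra_notN H; rewrite subr_eq0 => /eqP ->; exists i.
exists ((c - i%:R)^-1 *: w'); rewrite iter_bracketZ -wE dc -scalerBl scalerA.
by rewrite mulVf ?scale1r.
Qed.

Lemma jacobson_sum k i w d : (m + m <= i + k)%N -> d = iter i (bracket e) w ->
  bracket e d = 0 -> exists q : nat -> M, d = \sum_(i <= j < i + k) q j /\
    forall j, bracket h (q j) = j%:R *: q j.
Proof.
elim: k i w d => [|k IH] i w d mik dE d0.
  exists (fun=> 0); split=> [|j]; last by rewrite bracket0r scaler0.
  by rewrite addn0 big_geq // dE iter_nil // -(addn0 i).
have [w' [wE wd]] := jacobson_step dE d0.
have [|q [qs qE]] := IH i.+1 w' _ _ wE wd; first by rewrite addSnnS.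
pose c j : C := (j%:R - i%:R)^-1.
(* [ad h - i] sends [d] to a sum of eigenvectors [q l] with [l > i]; subtracting the [q l] divided
   by [l - i] from [d] leaves an eigenvector of weight [i]. *)
pose q' j := if j == i then d - \sum_(i.+1 <= l < i.+1 + k) c l *: q l else c j *: q j.
exists q'; split=> [|j]; last first.
  rewrite /q'; case: eqP => [->|_]; last by rewrite bracketZr qE !scalerA mulrC.
  have hs (s : seq nat) : bracket h (\sum_(l <- s) c l *: q l) = \sum_(l <- s) l%:R *: (c l *: q l).
    rewrite (big_morph _ (fun u v => bracketDr u v h) (bracket0r h)).
    by apply: eq_bigr => l _; rewrite bracketZr qE !scalerA mulrC.
  set B := \sum_(_ <= l < _) _; have : \sum_(i.+1 <= l < i.+1 + k) q l =
      bracket h B - i%:R *: B.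
    rewrite hs scaler_sumr -sumrB; apply: eq_big_nat => l /andP [il _].
    rewrite -scalerBl scalerA mulfV ?scale1r // subr_eq0 eqr_nat.
    by rewrite gtn_eqF.
  rewrite -qs (bracketBr d) scalerBr => /eqP; rewrite subr_eq => /eqP ->.
  by rewrite addrC -addrA addKr addrC.
rewrite big_ltn ?addnS ?ltnS ?leq_addr // -addSn {1}/q' eqxx.
rewrite [X in _ + X](eq_big_nat _ _ (F2 := fun l => c l *: q l)) ?subrK // => l /andP [il _].
by rewrite /q' gtn_eqF.
Qed.

End Jacobson.
End JacobsonMorozov.

(** * Parabolic subgroups attached to elements of the Lie algebra *)

Section GeneralizedEigenspaces.
Variables (C : numClosedFieldType) (n : nat).
Local Notation M := ('M[C]_n.+1).
Implicit Types (x y z : M).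

Lemma iter_shift_mulmx p x b k (u : 'M[C]_(p, n.+1)) :
  iter k (shift (mulmx^~ x) b) u = u *m ((x - b%:M) ^+ k).
Proof.
elim: k => [|k IH]; first by rewrite expr0 mulmx1.
by rewrite iterS IH exprSr -[_ * (x - _)]/(_ *m (x - _)) mulmxA mulmxBr mul_mx_scalar.
Qed.

Lemma sproj_commX x a b k : GRing.comm ((x - b%:M) ^+ k) (sproj x a).
Proof.
apply: commr_sym; apply: commrX; apply: commrB; first exact/esym/sproj_comm.
by apply: commr_sym; rewrite /GRing.comm -[_%:M * _]/(_ *m _) -[_ * _%:M]/(_ *m _) mul_scalar_mx mul_mx_scalar.
Qed.

Lemma gen_eigen_proj p x a b k (u : 'M[C]_(p, n.+1)) : a \in eigs x -> a != b ->
  u *m ((x - b%:M) ^+ k) = 0 -> u *m sproj x a = 0.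
Proof.
move=> ax ab ub.
apply: (@iter_shift_cancel C _ (mulmx^~ x) (fun w => w = 0) _ _ _ _ _ _ b a n.+1 k).
- by move=> v w; rewrite mulmxBl.
- by move=> c v; rewrite -scalemxAl.
- by [].
- by move=> v w -> ->; rewrite subrr.
- by move=> c v ->; rewrite scaler0.
- by move=> v ->; rewrite mul0mx.
- by rewrite eq_sym.
- rewrite iter_shift_mulmx -mulmxA -[sproj x a *m _]/(_ * _) -sproj_commX.
  by rewrite (sproj_nil ax) mulmx0.
by rewrite iter_shift_mulmx -mulmxA -[sproj x a *m _]/(_ * _) -sproj_commX mulmxA ub mul0mx.
Qed.

Lemma sproj_separate p x (u : 'M[C]_(p, n.+1)) :
  (forall a, a \in eigs x -> u *m sproj x a = 0) -> u = 0.
Proof.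
move=> H; rewrite -[u]mulmx1 -[1%:M]/(1 : M) -(sproj_sum x) mulmx_sumr.
by rewrite big_seq big1.
Qed.

Lemma bracket_eigen_shift x z (j c : C) k p (u : 'M[C]_(p, n.+1)) : bracket x z = j *: z ->
  u *m ((x - c%:M) ^+ k) = 0 -> u *m z *m ((x - (c - j)%:M) ^+ k) = 0.
Proof.
move=> xz; have e : z * (x - (c - j)%:M) = (x - c%:M) * z.
  rewrite mulrBr mulrBl; have -> : z * x = x * z - j *: z by rewrite -xz opprB addrC subrK.
  rewrite -[z * _%:M]/(z *m _) -[_%:M * z]/(_ *m z) mul_scalar_mx mul_mx_scalar.
  by rewrite scalerBl opprB addrA subrK.
have eX l : z * ((x - (c - j)%:M) ^+ l) = (x - c%:M) ^+ l * z.
  elim: l => [|l IH]; first by rewrite !expr0 mulr1 mul1r.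
  by rewrite exprS mulrA e -mulrA IH mulrA -exprS.
by move=> uc; rewrite -mulmxA -[z *m _]/(z * _) eX -[_ * z]/(_ *m z) mulmxA uc mul0mx.
Qed.

Lemma sproj_intertwine x y P Q : x * P = P * y -> P * Q = 1 ->
  eigs x = eigs y /\ forall a, sproj x a * P = P * sproj y a.
Proof.
move=> xP PQ.
have Pu : P \in unitmx by have [] := mulmx1_unit PQ.
have cE : char_poly x = char_poly y.
  have dP : \det (map_mx (@polyC C) P) != 0.
    by rewrite det_map_mx polyC_eq0 -unitfE -unitmxE.
  apply: (mulfI dP); rewrite -[RHS]det_mulmx [LHS]mulrC -[LHS]det_mulmx; congr (\det _).
  by rewrite /char_poly_mx mulmxBl mulmxBr scalar_mxC -!map_mxM -[x *m P]/(x * P) xP.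
have eE : eigs x = eigs y by rewrite /eigs cE.
have hE (p : {poly C}) : horner_mx x p * P = P * horner_mx y p.
  elim/poly_ind: p => [|p c IH]; first by rewrite !rmorph0 mul0r mulr0.
  rewrite !rmorphD !rmorphM /= !horner_mx_X !horner_mx_C mulrDl mulrDr -mulrA xP !mulrA IH.
  congr (_ + _); rewrite -[_%:M * _]/(_ *m _) -[_ * _%:M]/(_ *m _).
  by rewrite mul_scalar_mx mul_mx_scalar.
by split=> // a; rewrite /sproj /eproj eE hE.
Qed.

Lemma avoid_progression (s : seq C) (a b : C) : b != 0 ->
  exists K : nat, forall l : nat, (K <= l)%N -> a + l%:R * b \notin s.
Proof.
move=> b0; elim: s => [|d s [K HK]]; first by exists 0%N.
have [[i iE]|ni] := pselect (exists i : nat, a + i%:R * b = d).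
  exists (maxn K i.+1) => j; rewrite geq_max => /andP [Kj ij].
  rewrite in_cons negb_or HK // andbT -iE; apply: contraTneq ij => /addrI /(mulIf b0) /eqP.
  by rewrite eqr_nat => /eqP ->; rewrite ltnn.
exists K => j Kj; rewrite in_cons negb_or HK // andbT.
by apply/eqP => e; apply: ni; exists j.
Qed.

End GeneralizedEigenspaces.

(** * Filtrations by the size of the eigenvalues *)

Section Filtration.
Context {R : realType} {n : nat}.
Local Notation C := R[i].
Local Notation M := ('M[C]_n.+1).
Local Notation V := ('rV[C]_n.+1).
Variable phi : C -> R.
Hypothesis phiD : forall a b, phi (a + b) = phi a + phi b.
Implicit Types (x y z : M) (u v : V) (a b : R) (c : C).

Lemma phi0 : phi 0 = 0.
Proof. by apply: (addrI (phi 0)); rewrite -phiD !addr0. Qed.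
Lemma phiN c : phi (- c) = - phi c.
Proof. by apply: (addrI (phi c)); rewrite -phiD !subrr phi0. Qed.
Lemma phi_additive : additive_map (fun c => (phi c)%:C : C).
Proof. by move=> c c'; rewrite phiD raddfD. Qed.

(** The sum of the generalized eigenspaces whose eigenvalues have [phi] at most [a], written by
    equations. *)
Definition filt x a : set V :=
  [set v | forall c, c \in eigs x -> a < phi c -> v *m sproj x c = 0].

Lemma filt_linear x a : linear_set (filt x a).
Proof.
split=> [c _ _|d u v Fu Fv c cx ac]; first by rewrite mul0mx.
by rewrite mulmxDl -scalemxAl Fu // Fv // scaler0 addr0.
Qed.

Lemma filt_le x a b : a <= b -> filt x a `<=` filt x b.
Proof. by move=> ab v Fv c cx bc; apply: Fv => //; apply: le_lt_trans bc. Qed.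

Lemma filt_gen_eigen x u c k : u *m ((x - c%:M) ^+ k) = 0 -> filt x (phi c) u.
Proof.
move=> uc b bx cb; apply: gen_eigen_proj uc => //.
by apply: contraTneq cb => ->; rewrite ltxx.
Qed.

Lemma filt_cancel x u c : filt x (phi c) (u *m (x - c%:M)) -> filt x (phi c) u.
Proof.
move=> H b bx cb; have bc : b != c by apply: contraTneq cb => ->; rewrite ltxx.
rewrite -[sproj x b](sproj_idem bx) -[_ * _]/(_ *m _) mulmxA.
apply: (gen_eigen_proj (k := 1) bx bc).
by rewrite -mulmxA -[_ *m _ ^+ 1]/(_ * _) -sproj_commX expr1 mulmxA H.
Qed.

Lemma filt_stable_split x a (S : set V) : linear_set S ->
  (forall u c, c \in eigs x -> phi c <= a -> u *m ((x - c%:M) ^+ n.+1) = 0 -> S u) ->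
  filt x a `<=` S.
Proof.
move=> LS H v Fv; rewrite -[v]mulmx1 -[1%:M]/(1 : M) -(sproj_sum x) mulmx_sumr.
apply: (linear_set_sum LS) => c cx; have [ac|ca] := ltP a (phi c).
  by rewrite Fv //; case: LS.
apply: (H _ c) => //; rewrite -mulmxA -[sproj x c *m _]/(_ * _) -sproj_commX.
by rewrite (sproj_nil cx) mulmx0.
Qed.

Lemma commute_filt x y a : x * y = y * x -> stable (filt x a) y.
Proof.
move=> xy v Fv c cx ac; rewrite -mulmxA -[y *m _]/(y * _).
have -> : y * sproj x c = sproj x c * y.
  have SA := @subalgebra_commutant C n [set y].
  suff : [set u | forall w, [set y] w -> u * w = w * u] (sproj x c) by move=> /(_ y erefl).
  by apply: (subalgebra_horner _ SA) => _ ->.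
by rewrite -[_ * y]/(_ *m y) mulmxA Fv // mul0mx.
Qed.

(** Each [q j] lowers eigenvalues by [j], so [d] sends a generalized eigenspace into strictly lower
    ones. The outer induction is on the number [K] of steps after which [c - l] leaves the spectrum,
    the inner one on the order [k], with [filt_cancel] undoing [h + d - c]. *)
Lemma filt_perturb h d (s : seq nat) (q : nat -> M) a : 0 < phi 1 ->
  d = \sum_(j <- s) q j -> (forall j, j \in s -> (0 < j)%N) ->
  (forall j, bracket h (q j) = j%:R *: q j) -> filt h a `<=` filt (h + d) a.
Proof.
move=> phi1 dE s0 qE; apply: filt_stable_split; first exact: filt_linear.
move=> u c _ ca uc; apply: (filt_le ca) => {a ca}.
have phin j : 0 <= phi (j%:R : C).
  by elim: j => [|j IH]; rewrite ?phi0 // -natr1 phiD addr_ge0 // ltW.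
have N1 : (-1 : C) != 0 by rewrite oppr_eq0 oner_eq0.
have [K HK'] := avoid_progression (eigs h) c N1.
have HK l : (K <= l)%N -> c - l%:R \notin eigs h by rewrite -mulrN1; apply: HK'.
have {uc} [k uc] : exists k, u *m ((h - c%:M) ^+ k) = 0 by exists n.+1.
elim: K c u k uc HK {HK'} => [|K IH] c u k uc HK.
  suff -> : u = 0 by case: (filt_linear (h + d) (phi c)).
  apply: (@sproj_separate _ _ _ h) => b bh; apply: gen_eigen_proj uc => //.
  by apply: contraTneq bh => ->; have := HK 0%N isT; rewrite subr0.
have low w l : w *m ((h - c%:M) ^+ l) = 0 -> filt (h + d) (phi c) (w *m d).
  have -> : w *m d = \sum_(j <- s) w *m q j by rewrite dE mulmx_sumr.
  move=> wc; apply: (linear_set_sum (filt_linear _ _)) => j js.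
  have [c' c'E] : exists c', c' = c - j%:R by exists (c - j%:R).
  have c'c : phi c' <= phi c by rewrite c'E phiD phiN lerBlDr lerDl.
  have H : w *m q j *m ((h - c'%:M) ^+ l) = 0 by rewrite c'E; apply: bracket_eigen_shift wc.
  apply: (filt_le c'c); apply: (IH c' _ l H) => i Ki.
  have -> : c' - i%:R = c - (j + i)%:R by rewrite c'E natrD opprD addrA.
  by apply: HK; rewrite -addn1 addnC leq_add // s0.
elim: k u uc => [|k IHk] u uc.
  by move: uc; rewrite expr0 mulmx1 => ->; case: (filt_linear (h + d) (phi c)).
apply: filt_cancel; have -> : u *m (h + d - c%:M) = u *m (h - c%:M) + u *m d.
  by rewrite addrAC mulmxDr.
apply: (linear_setD (filt_linear _ _)); last exact: low uc.
by apply: IHk; rewrite -mulmxA -[_ *m _ ^+ _]/(_ * _) -exprS.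
Qed.

End Filtration.

(** * The gradation by a replica with real eigenvalues *)

Section Gradation.
Context {R : realType} {n : nat}.
Local Notation C := R[i].
Local Notation M := ('M[C]_n.+1).
Local Notation V := ('rV[C]_n.+1).
Variable phi : C -> R.
Hypothesis phiD : forall a b, phi (a + b) = phi a + phi b.
Variable x : M.
Implicit Types (y z w : M) (u v : V) (a b c : C) (s : R).

Definition phi_part : M := smap (fun c => (phi c)%:C) x.
Local Notation t := phi_part.

Definition gpart s z : M :=
  \sum_(c <- eigs x) \sum_(b <- eigs x | phi c - phi b == s) sproj x c * z * sproj x b.

Definition gweights : seq R := undup [seq phi c - phi b | c <- eigs x, b <- eigs x].

Lemma bracket_gpart s z : bracket t (gpart s z) = s%:C *: gpart s z.
Proof.
rewrite /bracket mulr_sumr mulr_suml scaler_sumr -sumrB; apply: eq_big_seq => c cx.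
rewrite mulr_sumr mulr_suml scaler_sumr -sumrB big_seq_cond [RHS]big_seq_cond.
apply: eq_bigr => b /andP [bx /eqP sE].
rewrite !mulrA smap_proj // -[_ * sproj x b * _]mulrA proj_smap // -!scalerAl -scalerAr.
by rewrite -scalerBl -rmorphB sE.
Qed.

Lemma sum_gpart z : z = \sum_(s <- gweights) gpart s z.
Proof.
rewrite exchange_big /=; transitivity (\sum_(c <- eigs x) \sum_(b <- eigs x) sproj x c * z * sproj x b).
  under eq_bigr do rewrite -mulr_sumr sproj_sum mulr1.
  by rewrite -mulr_suml sproj_sum mul1r.
apply: eq_big_seq => c cx; under [RHS]eq_bigr do rewrite big_mkcond.
rewrite exchange_big /=; apply: eq_big_seq => b bx; rewrite -big_mkcond /=.
under eq_bigl do rewrite eq_sym.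
rewrite -big_filter filter_pred1_uniq ?undup_uniq ?big_seq1 // mem_undup.
by apply/allpairsP; exists (c, b).
Qed.

Lemma sproj_gpart s z c b : c \in eigs x -> b \in eigs x ->
  sproj x c * gpart s z * sproj x b = if phi c - phi b == s then sproj x c * z * sproj x b else 0.
Proof.
move=> cx bx; rewrite mulr_sumr mulr_suml (bigD1_seq c) ?undup_uniq //= [X in _ + X]big1_seq ?addr0; last first.
  move=> c' /andP [c'c c'x]; rewrite mulr_sumr mulr_suml big1 // => b' _.
  by rewrite !mulrA sproj_ortho ?mul0r // eq_sym.
rewrite mulr_sumr mulr_suml big_mkcond (bigD1_seq b) ?undup_uniq //= [X in _ + X]big1_seq ?addr0; last first.
  move=> b' /andP [b'b b'x]; case: ifP => // _.
  by rewrite -!mulrA sproj_ortho ?mulr0.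
case: (_ == s); last exact: erefl.
have assoc (p q u v w : M) : p * (q * u * v) * w = (p * q) * u * (v * w) by rewrite !mulrA.
by rewrite assoc !sproj_idem.
Qed.

Lemma gpart_mem (S : set M) s z : linear_set S -> (forall y, S y -> S (bracket t y)) ->
  S z -> s \in gweights -> S (gpart s z).
Proof.
move=> LS St Sz sw; have [S0 SL] := LS.
pose vs := [seq s%:C | s <- gweights].
pose q (nu : C) := gpart (complex.Re nu) z.
pose q' (nu : C) := if nu \in vs then q nu else 0.
have vsR nu : nu \in vs -> (complex.Re nu)%:C = nu by move=> /mapP [s' _ ->].
have -> : gpart s z = q' s%:C by rewrite /q' map_f.
apply: (@weight_components C _ (bracket t) S _ _ S0 _ _ _ vs q'); last exact: map_f.
- by move=> u v; rewrite bracketBr.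
- by move=> c u; rewrite bracketZr.
- by move=> u v; apply: linear_setB.
- by move=> c u; apply: linear_setZ.
- exact: St.
- by rewrite map_inj_uniq ?undup_uniq // => a b [].
- move=> nu; exists 1%N; rewrite /= /shift /q'; case: ifP => [/vsR nuE|_].
    by rewrite /q bracket_gpart nuE subrr.
  by rewrite bracket0r scaler0 subrr.
rewrite big_map (eq_big_seq (fun s => gpart s z)) -?sum_gpart // => s' s'w.
by rewrite /q' map_f.
Qed.

Lemma filt_gpart s z (a : R) : 0 <= s -> stable (filt phi x a) (gpart s z).
Proof.
move=> s0 v Fv b bx ab; rewrite -mulmxA -[v]mulmx1 -[1%:M]/(1 : M) -(sproj_sum x).
rewrite mulmx_sumr mulmx_suml big1_seq // => c /andP [_ cx].
rewrite -mulmxA -[sproj x c *m _]/(_ * (_ * _)) mulrA sproj_gpart //.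
case: eqP => [e|_]; last by rewrite mulmx0.
rewrite -mulrA -[_ * (_ * _)]/(_ *m _) mulmxA Fv ?mul0mx //.
by rewrite -(subrK (phi b) (phi c)) e ltr_wpDl.
Qed.

(** A part of negative weight strictly raises [phi], so it preserves the filtration only if it
    vanishes. *)
Lemma gpart_stable0 s z : s < 0 -> (forall a : R, stable (filt phi x a) (gpart s z)) -> gpart s z = 0.
Proof.
move=> s0 H; apply: (@sproj_separate _ _ _ x) => b bx.
rewrite -[gpart s z]mul1r -(sproj_sum x) mulr_suml mulmx_suml big1_seq // => c /andP [_ cx].
rewrite -[_ *m _]/(_ * _) sproj_gpart //; case: eqP => // e.
have := @sproj_gpart s z c b cx bx; rewrite e eqxx => <-.
apply/row_matrixP => i; rewrite row0 -[_ * gpart s z * _]/(_ *m _ *m _) !row_mul.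
apply: (H (phi c)) => //; last first.
  by rewrite -subr_gt0 -opprB e oppr_gt0.
apply: (filt_gen_eigen (k := n.+1)).
by rewrite -row_mul -[sproj x c *m _]/(_ * _) -sproj_commX (sproj_nil cx) row0.
Qed.

End Gradation.

Lemma bracket_weights_trace (C : numClosedFieldType) n (t z w : 'M[C]_n.+1) a b :
  bracket t z = a *: z -> bracket t w = b *: w -> a + b != 0 -> \tr (z * w) = 0.
Proof.
move=> tz tw ab; have := trace_bracket t z w.
rewrite tz [bracket w t]bracketC tw -scaleNr -scalerAl -scalerAr !linearZ /= => /eqP.
by rewrite mulNr -addr_eq0 -mulrDl mulf_eq0 (negPf ab) => /eqP.
Qed.

Lemma seq_minimum (R : realType) (T : eqType) (s : seq T) (P : T -> Prop) (f : T -> R) :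
  (exists2 c, c \in s & P c) ->
  exists c, [/\ c \in s, P c & forall b, b \in s -> P b -> f c <= f b].
Proof.
elim: s => [[] //|b s IH] [c0 c0s Pc0].
have [[c cs Pc]|ns] := pselect (exists2 c, c \in s & P c); last first.
  have nP c : c \in s -> P c -> False by move=> cs Pc; apply: ns; exists c.
  move: c0s; rewrite in_cons => /orP [/eqP e|/nP //].
  exists c0; rewrite e mem_head -e; split=> // c; rewrite in_cons => /orP [/eqP -> _|/nP //].
  by rewrite e.
have [|c' [c's Pc' cmin]] := IH; first by exists c.
have [[Pb bc]|nb] := pselect (P b /\ f b <= f c').
  exists b; rewrite mem_head; split=> // d; rewrite in_cons => /orP [/eqP ->//|ds Pd].
  exact: le_trans bc (cmin d ds Pd).
exists c'; rewrite in_cons c's orbT; split=> // d; rewrite in_cons => /orP [/eqP -> Pb|/cmin //].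
by case: (leP (f c') (f b)) => // /ltW h; case: nb.
Qed.

Section Parabolics.
Context {R : realType} {G : affine_group R} {n : nat}.
Variable r : @linear_model R G n.
Hypothesis Gred : reductive G.
Local Notation C := R[i].
Local Notation M := ('M[C]_n.+1).
Local Notation V := ('rV[C]_n.+1).
Local Notation lieg := (lieg r).
Local Notation gg := (lieg setT).
Implicit Types (x y z w : M) (g h : G) (P B H X : set G).

Lemma groupT : subgroup (setT : set G). Proof. by []. Qed.

Lemma closed_connectedT : closed_connected_subgroup (setT : set G).
Proof. by case: Gred => conG _; split=> //; apply: zclosedT. Qed.

Lemma lieg_closed_bracket X x y : subgroup X -> lieg X x -> lieg X y -> lieg X (bracket x y).
Proof.
move=> sX Xx Xy; apply: (lieg_bracket (lieg_linear r X) _ Xy) => g Xg.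
by apply: lieg_Ad Xx => h Xh; apply: subgroupJ.
Qed.

Lemma gg_bracket x y : gg x -> gg y -> gg (bracket x y).
Proof. exact: lieg_closed_bracket. Qed.

Lemma gg_commutes x : (forall z, gg z -> bracket x z = 0) -> forall g, x * r g = r g * x.
Proof.
move=> H g; have SA := @subalgebra_commutant C n [set x].
have := rho_subalgebra (r := r) closed_connectedT SA; move=> /(_ _ g I) /= -> // z gz _ ->.
by apply/esym/eqP; rewrite -subr_eq0; apply/eqP; apply: H.
Qed.

Lemma commutes_gg P x z : (forall g, P g -> x * r g = r g * x) -> lieg P z -> bracket x z = 0.
Proof.
move=> H Pz; have [LA _ _] := @subalgebra_commutant C n [set x].
have := lieg_sub LA _ Pz => /= Hz; apply/eqP; rewrite subr_eq0; apply/eqP.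
by rewrite Hz // => g Pg _ ->; apply/esym/H.
Qed.

(** Once the stabilizer of the filtration is [G], no negative weight of [t] occurs in [gg]. Opposite
    weights are dual under the trace form, so no positive one occurs either, and [t] is central. *)
Lemma parabolic_of_element (phi : C -> R) x :
  (forall a b, phi (a + b) = phi a + phi b) -> gg x ->
  (forall P, parabolic_subgroup P ->
    (forall g, (forall a, stable (filt phi x a) (r g)) -> P g) -> P = setT) ->
  forall g, phi_part phi x * r g = r g * phi_part phi x.
Proof.
move=> phiD gx Hpar; set t := phi_part phi x.
have gL := lieg_linear r setT; have g0 := reductive_trace_form Gred.
have gt : gg t by apply: lieg_smap => //; apply: phi_additive.
have gpart_g z s : gg z -> s \in gweights phi x -> gg (gpart phi x s z).
  by move=> gz sw; apply: gpart_mem => // y gy; apply: gg_bracket.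
have pairing s z w : gg w -> (s \in gweights phi x) ->
    (- s \in gweights phi x -> \tr (gpart phi x s z * gpart phi x (- s) w) = 0) ->
    \tr (gpart phi x s z * w) = 0.
  move=> gw sw H; rewrite {1}[w](sum_gpart phi x) mulr_sumr raddf_sum big1_seq // => s' /andP [_ s'w].
  have [e|ne] := eqVneq s' (- s); first by rewrite e in s'w *; apply: H.
  apply: (bracket_weights_trace (bracket_gpart phi x s z) (bracket_gpart phi x s' w)).
  by rewrite -rmorphD /= (inj_eq (@complexI _)) addrC addr_eq0.
pose S : set M := [set z | z = t \/ gg z /\ exists2 s : R, 0 < s & bracket t z = s%:C *: z].
(* Modulo [W], take an eigenvalue [c] of [t] with least real part: an element of positive weight [s]
   sends its eigenvectors to the eigenvalue [c - s], hence kills them. *)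
have [F [m [Fm SF]]] : exists F m, filtration F m /\ S `<=` flag_alg F.
  apply: flag_exists => W LW Ws [v0 nv0]; have tS : S t by left.
  pose Q (c : C) := exists2 v, ~ W v & W (v *m t - c *: v).
  have LT : linear_set (setT : set V) by split.
  have [v1 [c1 [_ nv1 c1t v1c]]] := eigen_mod LW LT (Ws t tS) (fun _ _ => I) I nv0.
  have [|c [ct [v nv vc] cmin]] := @seq_minimum R _ (eigs t) Q (@complex.Re R).
    by exists c1 => //; exists v1.
  exists v => // z [->|[gz [s s0 tz]]]; first by exists c.
  exists 0; rewrite scale0r subr0; apply: contrapT => nW.
  have vz : W (v *m z *m t - (c - s%:C) *: (v *m z)).
    have -> : v *m z *m t - (c - s%:C) *: (v *m z) = (v *m t - c *: v) *m z.
      have zt : z *m t = t *m z - s%:C *: z by rewrite -tz /bracket opprB addrC subrK.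
      rewrite -mulmxA zt mulmxBr mulmxBl -scalemxAl -scalemxAr scalerBl opprB mulmxA.
      by rewrite addrA subrK.
    by apply: Ws => //; right; split=> //; exists s.
  have := cmin (c - s%:C) (eigen_mod_eigs LW (Ws t tS) nW vz).
  have Rc : complex.Re (c - s%:C) = complex.Re c - s by case: (c).
  rewrite Rc lerBrDl gerDr leNgt s0 => H.
  by suff /H : Q (c - s%:C) by []; exists (v *m z).
have [X [cX sX _ Xx]] := flag_group r Fm.
have [B BB XB] := borel_exists cX sX; have [[cB solB] _] := BB.
have SB z : gg z -> S z -> lieg B z by move=> gz /SF Fz; apply: liegS XB _; apply: Xx.
have Bg z : lieg B z -> gg z by apply: liegS.
have Bt : lieg B t by apply: SB => //; left.
have [F' [m' [F'm BF']]] := flag_of_solvable r (connected_irreducible cB) solB.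
have F'A := flag_alg_subalgebra F'm; have [LA _ _] := F'A.
have bF' z : lieg B z -> flag_alg F' z by apply: lieg_sub LA _.
(* A negative part is a multiple of its commutator with [t], so it lowers the flag [F']; its product
   with a positive part, also in [lieg B], is nilpotent and has trace [0]. *)
have neg s z : lieg B z -> s \in gweights phi x -> s < 0 -> gpart phi x s z = 0.
  move=> Bz sw s0; have Bs : lieg B (gpart phi x s z).
    apply: gpart_mem => //; first exact: lieg_linear.
    by move=> y By; apply: lieg_closed_bracket => //; case: cB.
  apply: g0 => [|w gw]; first exact: Bg.
  apply: pairing => // sw'; set z' := gpart phi x s z; set w' := gpart phi x (- s) w.
  have Bw' : lieg B w'.
    apply: SB; first exact: gpart_g.
    by right; split; [apply: gpart_g|exists (- s); [rewrite oppr_gt0|apply: bracket_gpart]].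
  have low : lowering F' 1 z'.
    have := flag_commutator F'm (bF' _ Bt) (bF' _ Bs); rewrite bracket_gpart => H.
    have sC : s%:C != 0 :> C by rewrite (inj_eq (@complexI _)) lt_eqF.
    by have := linear_setZ (s%:C)^-1 (lowering_linear F'm 1) H; rewrite scalerA mulVf // scale1r.
  apply: (@nilpotent_trace _ _ _ m'); apply: (lowering_nil F'm).
  exact: (lowering_stable F'm low (bF' _ Bw')).
pose SA : set M := [set y | forall a, stable (filt phi x a) y].
have SAP : subalgebra SA.
  have LF a := filt_linear phi x a.
  split; first split.
  - by move=> a v Fv; rewrite mulmx0; case: (LF a).
  - move=> c y y' Hy Hy' a v Fv; rewrite mulmxDr -scalemxAr; case: (LF a) => _; apply.
      exact: Hy.
    exact: Hy'.
  - by move=> a v Fv; rewrite mulmx1.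
  - by move=> y y' Hy Hy' a v Fv; rewrite -[y * y']/(y *m y') mulmxA; apply/Hy'/Hy.
have [LSA _ _] := SAP.
have [sP cP] := subalgebra_group r SAP.
have BSA z : lieg B z -> SA z.
  move=> Bz; rewrite [z](sum_gpart phi x) ; apply: (linear_set_sum LSA) => s sw.
  have [s0|s0] := leP 0 s; first by move=> a; apply: filt_gpart.
  by rewrite (neg s z) //; case: LSA.
have PT : [set g | SA (r g)] = setT.
  apply: Hpar => //; split=> //; exists B => // g Bg'.
  exact: (rho_subalgebra cB SAP BSA).
have gSA z : gg z -> SA z.
  by apply: lieg_sub LSA _ => g _; have : [set g | SA (r g)] g by rewrite PT.
have neg' s z : gg z -> s \in gweights phi x -> s < 0 -> gpart phi x s z = 0.
  by move=> gz sw s0; apply: (gpart_stable0 s0); apply: gSA; apply: gpart_g.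
apply: gg_commutes => z gz; rewrite [z](sum_gpart phi x) -/t.
rewrite (big_morph _ (fun u v => bracketDr u v t) (bracket0r t)) big1_seq // => s /andP [_ sw].
rewrite bracket_gpart; have [s0|s0|->] := ltgtP s 0; last by rewrite scale0r.
  by rewrite neg' // scaler0.
rewrite (_ : gpart _ _ _ _ = 0) ?scaler0 //; apply: g0 => [|w gw]; first exact: gpart_g.
by apply: pairing => // sw'; rewrite (neg' (- s)) ?oppr_lt0 // mulr0 mxtrace0.
Qed.

End Parabolics.

(** [e] shifts the eigenvalues of [h] by [2], hence their real parts as well. *)
Lemma commuting_part_zero (R : realType) n (h e : 'M[R[i]]_n.+1) :
  bracket h e = 2%:R *: e ->
  bracket (phi_part (@complex.Re R) h) e = 0 -> e = 0.
Proof.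
move=> he te.
have z c b : c \in eigs h -> b \in eigs h -> sproj h c * e * sproj h b = 0.
  move=> ch bh; have [bE|bc] := eqVneq b (c - 2%:R); last first.
    apply: (gen_eigen_proj (k := n.+1) bh bc); apply: (bracket_eigen_shift he).
    by rewrite -[_ *m _]/(_ * _) -sproj_commX (sproj_nil ch).
  have te' : phi_part (@complex.Re R) h * e = e * phi_part (@complex.Re R) h.
    by apply/eqP; rewrite -subr_eq0; apply/eqP.
  have E : ((complex.Re c)%:C - (complex.Re b)%:C) *: (sproj h c * e * sproj h b) = 0.
    rewrite scalerBl; apply/eqP; rewrite subr_eq0; apply/eqP.
    transitivity (sproj h c * (phi_part (@complex.Re R) h * e) * sproj h b).
      by rewrite mulrA /phi_part proj_smap // -!scalerAl.
    by rewrite te' mulrA -[_ * phi_part _ _ * _]mulrA /phi_part smap_proj // -scalerAr.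
  apply/eqP; move/eqP: E; rewrite scaler_eq0 -rmorphB /= => /orP [|//].
  have -> : complex.Re c - complex.Re b = 2%:R.
    by rewrite bE; case: (c) => u v /=; rewrite opprD addrA subrr add0r opprK.
  by rewrite (inj_eq (@complexI _)) pnatr_eq0.
apply: (@sproj_separate _ _ _ h) => b bh.
rewrite -[e]mul1r -(sproj_sum h) mulr_suml mulmx_suml big1_seq // => c /andP [_ ch].
exact: z.
Qed.

(** * Commutants of irreducible subgroups *)

Section Irreducible.
Context {R : realType} {G : affine_group R} {n : nat}.
Variable r : @linear_model R G n.
Hypothesis Gred : reductive G.
Local Notation C := R[i].
Local Notation M := ('M[C]_n.+1).
Local Notation lieg := (lieg r).
Local Notation gg := (lieg setT).
Implicit Types (x y z w e h : M) (g : G) (P B H : set G).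

Lemma nilpotent_filt_stable H e y m : subgroup H -> e ^+ m = 0 ->
  (forall g, H g -> Ad r g e = e) -> bracket (bracket e y) e = 2%:R *: e ->
  forall g a, H g -> stable (filt (@complex.Re R) (bracket e y) a) (r g).
Proof.
move=> sH em He he; set h := bracket e y.
have AdB g u v : Ad r g (bracket u v) = bracket (Ad r g u) (Ad r g v).
  by rewrite /bracket AdB !AdM.
have ReD (c b : C) : complex.Re (c + b) = complex.Re c + complex.Re b by case: c b => ? ? [].
have sub g a : H g -> filt (@complex.Re R) h a `<=` filt (@complex.Re R) (Ad r g h) a.
  move=> Hg; pose w := Ad r g y - y.
  have dE : Ad r g h - h = bracket e w by rewrite AdB He // bracketBr.
  have ehE u : bracket (bracket e u) e = 2%:R *: e -> bracket e (bracket e u) = - (2%:R *: e).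
    by move=> <-; rewrite bracketC.
  have d0 : bracket e (Ad r g h - h) = 0.
    rewrite bracketBr ehE // -[X in bracket X _](He g Hg) -AdB ehE //.
    rewrite -scalerN -scaleN1r scalerA.
    have -> c : Ad r g (c *: e) = c *: e.
      by rewrite /Ad -scalerAr -scalerAl -[X in _ = _ *: X](He g Hg).
    by rewrite subrr.
  (* The displacement of [h] lies in the kernel and in the image of [ad e]; starting at [i := 1]
     makes its weights positive. *)
  have [|q [qs qE]] := jacobson_sum em (erefl h) he (k := m + m) (i := 1) _ dE d0.
    by rewrite leq_addl.
  have Re1 : 0 < complex.Re (1 : C) by rewrite ltr01.
  have := filt_perturb (a := a) ReD Re1 qs _ qE; rewrite addrC subrK; apply.
  by move=> j; rewrite mem_index_iota => /andP [].
move=> g a Hg v Fv.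
have Hg' := subgroupV sH Hg.
have [eE pE] : eigs (Ad r g^-1%g h) = eigs h /\
    forall c, sproj (Ad r g^-1%g h) c * r g = r g * sproj h c.
  apply: (sproj_intertwine (Q := r g^-1%g)); last exact: rhoV.
  by rewrite /Ad invgK -[LHS]mulrA rhoVl mulr1.
move=> c ch ac; rewrite -mulmxA -[r g *m _]/(r g * _) -pE -[_ * r g]/(_ *m r g) mulmxA.
have := sub _ a Hg' v Fv c; rewrite eE => /(_ ch ac) vc.
by rewrite [X in X *m _]vc mul0mx.
Qed.

Theorem irreducible_commutant H x : irreducible_subgroup H -> gg x ->
  (forall g, H g -> x * r g = r g * x) -> forall g, x * r g = r g * x.
Proof.
move=> [sH irrH] gx Hx.
have part (phi : C -> R) : (forall a b, phi (a + b) = phi a + phi b) ->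
    forall g, phi_part phi x * r g = r g * phi_part phi x.
  move=> phiD; apply: parabolic_of_element => // P PP sub; apply: irrH => // g Hg.
  by apply: sub => a; apply: commute_filt; apply: Hx.
(* The real and imaginary parts of the eigenvalues reassemble the semisimple part, so it remains to
   kill the nilpotent one. *)
have sid g : smap id x * r g = r g * smap id x.
  have -> : smap id x = phi_part (@complex.Re R) x + 'i *: phi_part (@complex.Im R) x.
    rewrite /phi_part /smap scaler_sumr -big_split /=; apply: eq_bigr => c _.
    rewrite scalerA -scalerDl; congr (_ *: _); exact: complexE.
  rewrite mulrDl mulrDr -scalerAl -scalerAr !part //.
    by case=> ? ? [].
  by case=> ? ? [].
suff e0 : npart x = 0.
  by move=> g; move: e0 => /eqP; rewrite subr_eq0 => /eqP ->; apply: sid.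
set e := npart x; have ge : gg e by apply: lieg_npart.
have em : e ^+ n.+1 = 0 := npart_nil x.
have He g : H g -> Ad r g e = e.
  by move=> Hg; apply/Ad_fixP; rewrite /e /npart mulrBl mulrBr Hx // sid.
have [y gy he] := jacobson_morozov (lieg_linear r setT) (@gg_bracket _ _ _ r)
  (fun x => reductive_trace_form Gred (x := x)) ge em.
apply: (commuting_part_zero he); apply: (commutes_gg (r := r) (P := setT)) => // g _.
apply: (parabolic_of_element (r := r)) => //.
- by case=> ? ? [].
- by apply: gg_bracket.
move=> P PP sub; apply: irrH => // k Hk; apply: sub => a.
exact: (nilpotent_filt_stable sH em He he).
Qed.

End Irreducible.

(** * Borel subalgebras *)

Section Nilpotent.
Variables (C : numClosedFieldType) (n : nat).
Implicit Types (z : 'M[C]_n.+1).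

Lemma nilpotent_eigs z k c : z ^+ k = 0 -> c \in eigs z -> c = 0.
Proof.
move=> zk /eigsP [v vz v0].
have vk j : v *m (z ^+ j) = c ^+ j *: v.
  elim: j => [|j IH]; first by rewrite !expr0 mulmx1 scale1r.
  by rewrite exprSr -[_ * z]/(_ *m z) mulmxA IH -scalemxAl vz scalerA exprSr.
have /eqP := vk k; rewrite zk mulmx0 eq_sym scaler_eq0 (negPf v0) orbF expf_eq0.
by move=> /andP [_ /eqP].
Qed.

Lemma nilpotent_dim z k : z ^+ k = 0 -> z ^+ n.+1 = 0.
Proof.
move=> zk; rewrite -[RHS](npart_nil z); congr (_ ^+ _).
rewrite /npart /smap big1_seq ?subr0 // => a /andP [_ /(nilpotent_eigs zk) ->].
by rewrite scale0r.
Qed.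

Lemma nilpotent_bracket_eigen z w c k : z ^+ k = 0 -> bracket z w = c *: w -> c *: w = 0.
Proof.
move=> zk zw; have E j : iter j (bracket z) w = c ^+ j *: w.
  elim: j => [|j IH]; first by rewrite expr0 scale1r.
  by rewrite iterS IH bracketZr zw scalerA exprSr.
have := E (k + k)%N; rewrite iter_bracket_nil // => /esym /eqP.
rewrite scaler_eq0 expf_eq0 => /orP [/andP [_ /eqP ->]|/eqP ->]; first by rewrite scale0r.
by rewrite scaler0.
Qed.

End Nilpotent.

Section Borel.
Context {R : realType} {G : affine_group R} {n : nat}.
Variable r : @linear_model R G n.
Local Notation C := R[i].
Local Notation M := ('M[C]_n.+1).
Local Notation V := ('rV[C]_n.+1).
Local Notation lieg := (lieg r).
Local Notation gg := (lieg setT).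
Implicit Types (x y z w e h : M) (g : G) (P B H X : set G) (W S T : set M).

Definition perp T : set M := [set x | gg x /\ forall y, T y -> \tr (x * y) = 0].

Lemma perp_linear T : linear_set (perp T).
Proof.
have LG := lieg_linear r (setT : set G); split=> [|c u v [gu uo] [gv vo]].
  by split; [case: LG|move=> y _; rewrite mul0r mxtrace0].
split=> [|y gy]; first by case: LG => _; apply.
by rewrite mulrDl -scalerAl linearD linearZ /= uo // vo // mulr0 addr0.
Qed.

Lemma lieg_Ad_stable X g x : subgroup X -> X g -> lieg X x -> lieg X (Ad r g x).
Proof. by move=> sX Xg; apply: lieg_Ad => h Xh; apply: subgroupJ. Qed.

Lemma perp_Ad X g x : subgroup X -> X g -> perp (lieg X) x -> perp (lieg X) (Ad r g x).
Proof.
move=> sX Xg [gx xo]; split; first exact: lieg_Ad_stable.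
move=> y Xy; rewrite -[y](AdKV r g) Ad_trace; apply: xo.
by apply: lieg_Ad_stable => //; apply: subgroupV.
Qed.

Lemma lieg_perp_nilpotent X x : subgroup X -> lieg X x ->
  (forall y, lieg X y -> \tr (x * y) = 0) -> x ^+ n.+1 = 0.
Proof.
move=> sX Xx xo; apply: trace_conj_nilpotent; apply: xo.
by apply: lieg_smap => // a b; rewrite rmorphD.
Qed.

(** A common eigenvector of [B] modulo [W] is modified until it is also one of [v]. Elements of [N]
    have eigenvalue [0] on it, so only the scalars [chi w] matter. *)
Lemma flag_extension B v (N : set M) : closed_connected_subgroup B -> solvable_subgroup B ->
  (forall x, N x -> lieg B x) -> (forall x, N x -> x ^+ n.+1 = 0) ->
  (forall w, lieg B w -> exists c : C, N (bracket v w - c *: v)) ->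
  exists F m, [/\ @filtration C n F m, forall x, lieg B x -> flag_alg F x & flag_alg F v].
Proof.
move=> cB solB NB Nn vB.
have [chi chiP] : exists chi : M -> C, forall w, lieg B w -> N (bracket v w - chi w *: v).
  have H w : exists c, lieg B w -> N (bracket v w - c *: v).
    have [/vB [c Hc]|nB] := pselect (lieg B w); first by exists c.
    by exists 0 => /nB.
  by have [chi chiP] := choice H; exists chi.
suff [F [m [Fm SF]]] : exists F m, filtration F m /\ [set x | lieg B x \/ x = v] `<=` flag_alg F.
  by exists F, m; split=> // [x Bx|]; apply: SF; [left|right].
apply: flag_exists => W LW Ws [v0 nv0].
have WB w : lieg B w -> stable W w by move=> Bw; apply: Ws; left.
have Wv : stable W v by apply: Ws; right.
have LT : linear_set (setT : set V) by split.
have WrB g : B g -> stable W (r g).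
  have SA : subalgebra [set y : M | stable W y].
    split; first split.
    - by move=> u Wu; rewrite mulmx0; case: LW.
    - by move=> c y y' Hy Hy' u Wu; rewrite mulmxDr -scalemxAr; case: LW => _; apply; [apply: Hy|apply: Hy'].
    - by move=> u Wu; rewrite mulmx1.
    - by move=> y y' Hy Hy' u Wu; rewrite -[y * y']/(y *m y') mulmxA; apply/Hy'/Hy.
  by move=> Bg; apply: (rho_subalgebra cB SA) => // w; apply: WB.
have [||u0 [_ nu0 Hu0]] := lie_kolchin (rho1 r) (rhoM r) (rho_reg r)
    (connected_irreducible cB) solB LW LT WrB.
- by [].
- by exists v0.
have u0B w : exists c : C, lieg B w -> W (u0 *m w - c *: u0).
  have [Bw|nB] := pselect (lieg B w); last by exists 0 => /nB.
  suff [c Hc] : exists c : C, W (u0 *m w - c *: u0) by exists c.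
  have LS : linear_set [set y : M | exists c : C, W (u0 *m y - c *: u0)].
    split=> [|c y y' [a Ha] [b Hb]].
      by exists 0; rewrite mulmx0 scale0r subrr; case: LW.
    exists (c * a + b); rewrite mulmxDr -scalemxAr scalerDl opprD addrACA -scalerA -scalerBr.
    by case: LW => _; apply.
  by apply: lieg_sub LS _ Bw.
have /choice [la laP] := u0B.
have N0 u c w : N w -> ~ W u -> W (u *m w - c *: u) -> c = 0.
  move=> Nw nu H; apply: (nilpotent_eigs (Nn w Nw)).
  exact: eigen_mod_eigs LW (WB _ (NB _ Nw)) nu H.
(* If [chi] vanishes on [lieg B], the joint eigenspace for [la] is stable under [v]. Otherwise the
   vectors [u0 *m v ^+ k] have the distinct eigenvalues [la w0 + k * chi w0] under [w0], so they
   fall into [W] eventually. *)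
have [all0|/existsNP [w0 /not_implyP [Bw0 chi0]]] := pselect (forall w, lieg B w -> chi w = 0).
  pose E := [set u | forall w, lieg B w -> W (u *m w - la w *: u)].
  have LE : linear_set E.
    split=> [w _|c u u' Hu Hu' w Bw]; first by rewrite mul0mx scaler0 subr0; case: LW.
    rewrite mulmxDl -scalemxAl scalerDr opprD addrACA scalerA mulrC -scalerA -scalerBr.
    by case: LW => _; apply; [apply: Hu|apply: Hu'].
  have Eu0 : E u0 by move=> w; apply: laP.
  have Ev : stable E v.
    move=> u Eu w Bw; have Nb := chiP w Bw; rewrite all0 // scale0r subr0 in Nb.
    have l0 : la (bracket v w) = 0 by apply: (N0 u0 _ _ Nb nu0); apply: laP; apply: NB.
    have -> : u *m v *m w - la w *: (u *m v) =
        (u *m w - la w *: u) *m v + (u *m bracket v w - la (bracket v w) *: u).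
      rewrite l0 scale0r subr0 mulmxBl -scalemxAl /bracket mulmxBr.
      rewrite -[v * w]/(v *m w) -[w * v]/(w *m v) !mulmxA.
      by rewrite [RHS]addrC addrA subrK.
    by apply: linear_setD => //; [apply: Wv; apply: Eu|apply: Eu; apply: NB].
  have [u' [c [Eu' nu' _ Hc]]] := eigen_mod LW LE Wv Ev Eu0 nu0.
  by exists u' => // w [Bw|->]; [exists (la w); apply: Eu'|exists c].
pose u k := u0 *m (v ^+ k).
have uS k : u k.+1 = u k *m v by rewrite /u exprSr -[_ * v]/(_ *m v) mulmxA.
have ueig k w : lieg B w -> W (u k *m w - (la w + k%:R * chi w) *: u k).
  elim: k w => [|k IH] w Bw.
    by rewrite /u expr0 mulmx1 mul0r addr0; apply: laP.
  set b := bracket v w - chi w *: v; have Nb : N b := chiP w Bw.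
  have ub : W (u k *m b).
    have := IH b (NB _ Nb); set c := la b + _ => Hc.
    have [Wu|nWu] := pselect (W (u k)); first by apply: WB => //; apply: NB.
    by have c0 : c = 0 := N0 _ _ _ Nb nWu Hc; rewrite c0 scale0r subr0 in Hc.
  have -> : u k.+1 *m w - (la w + k.+1%:R * chi w) *: u k.+1 =
     (u k *m w - (la w + k%:R * chi w) *: u k) *m v + u k *m b.
    rewrite uS /b /bracket mulmxBl !mulmxBr -[v * w]/(v *m w) -[w * v]/(w *m v) !mulmxA.
    rewrite -scalemxAl -scalemxAr -natr1 mulrDl mul1r addrA.
    move: (u k *m v) (u k *m v *m w) (u k *m w *m v) => p q s.
    by rewrite [(_ + chi w) *: p]scalerDl; apply/rowP => j; rewrite !mxE; ring.
  by apply: linear_setD => //; apply: Wv; apply: IH.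
have [k [nk Wk]] : exists k, ~ W (u k) /\ W (u k.+1).
  apply: contrapT => H; have nW k : ~ W (u k).
    elim: k => [|k IH Wk]; first by rewrite /u expr0 mulmx1.
    by apply: H; exists k.
  have [k Hk] := avoid_progression (eigs w0) (la w0) (introN eqP chi0).
  by have := Hk k (leqnn k); rewrite (eigen_mod_eigs LW (WB _ Bw0) (nW k) (ueig k w0 Bw0)).
exists (u k) => // w [Bw|->]; first by exists (la w + k%:R * chi w); apply: ueig.
by exists 0; rewrite scale0r subr0 -uS.
Qed.

(** An element of the orthogonal outside [lieg B] may be taken to be an eigenvector [v] of [B]
    modulo [N], whose elements are nilpotent. It then shares a flag with [B], against the maximality
    of [B]. *)
Theorem borel_perp B x : borel_subgroup B -> perp (lieg B) x -> lieg B x.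
Proof.
move=> BB px; have [[cB solB] _] := BB; have [sB _ _] := cB.
apply: contrapT => nx; have LB := lieg_linear r B; have LP := perp_linear (lieg B).
pose N := [set y | lieg B y /\ perp (lieg B) y].
have LN : linear_set N.
  by split=> [|c u v [] ? ? [] ? ?]; split; [case: LB|case: LP|case: LB => _; apply|case: LP => _; apply].
have [|||v [pv nv Hv]] := lie_kolchin_Ad (r := r) (connected_irreducible cB) solB LN LP.
- by move=> g y Bg [By py]; split; [apply: lieg_Ad_stable|apply: perp_Ad].
- by move=> g y Bg; apply: perp_Ad.
- by exists x => // -[].
have nBv : ~ lieg B v by move=> Bv; apply: nv.
have [|||F [m [Fm FB Fv]]] := @flag_extension B v N cB solB.
- by move=> y [].
- by move=> y [By [_ yo]]; apply: lieg_perp_nilpotent yo.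
- move=> w Bw.
  have [|y [c [Ny e]]] := @lieg_bracket _ _ _ r B (with_line N v) w v (with_line_linear _ LN) _ Bw.
    move=> g Bg; have [z Hz] := Hv g Bg; exists (Ad r g v - z *: v), z; split=> //.
    by rewrite subrK.
  by exists c; rewrite /bracket e addrK.
apply: nBv; apply: (borel_lie BB Fm) => //; last by case: pv.
move=> g Bg; apply: (rho_subalgebra cB (flag_alg_subalgebra Fm)) => //.
Qed.

End Borel.

(** * The determinant of the adjoint action on an ideal *)

Section DerivativeDeterminant.
Variables (C : comNzRingType) (n : nat).
Local Notation P := {mpoly C[n * n]}.
Implicit Types (M Y : 'M[C]_n).

Lemma dev_prod1 I (s : seq I) (F : I -> P) M Y : (forall i, ev (F i) M = 1) ->
  dev (\prod_(i <- s) F i) M Y = \sum_(i <- s) dev (F i) M Y.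
Proof.
move=> F1; elim: s => [|i s IH].
  by rewrite !big_nil -[1]/(1%:MP) devC.
rewrite !big_cons devM IH F1 mul1r ev_prod big1 ?mulr1 // => j _; exact: F1.
Qed.

Lemma dev_mul0 (p q : P) M Y : ev p M = 0 -> ev q M = 0 -> dev (p * q) M Y = 0.
Proof. by move=> p0 q0; rewrite devM p0 q0 mulr0 mul0r addr0. Qed.

Lemma ev_det k (Q : 'M[P]_k) M : ev (\det Q) M = \det (map_mx (fun p => ev p M) Q).
Proof.
rewrite /determinant ev_sum; apply: eq_bigr => s _; rewrite evM ev_prod; congr (_ * _).
  by case: (odd_perm s); rewrite ?expr0 ?expr1 ?evN ev1.
by apply: eq_bigr => i _; rewrite mxE.
Qed.

(* Jacobi's formula at the identity: a permutation other than the identity moves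
   two indices, so its term vanishes to second order. *)
Lemma dev_det1 k (Q : 'M[P]_k) M Y : map_mx (fun p => ev p M) Q = 1%:M ->
  dev (\det Q) M Y = \sum_i dev (Q i i) M Y.
Proof.
move=> Q1; have QE i j : ev (Q i j) M = (i == j)%:R.
  by move/matrixP/(_ i j): Q1; rewrite !mxE.
rewrite /determinant dev_sum (bigD1 (1%g : {perm 'I_k})) //= [X in _ + X]big1 ?addr0 => [|s s1].
  rewrite odd_perm1 expr0 mul1r; under eq_bigr do rewrite perm1.
  by rewrite dev_prod1 // => i; rewrite QE eqxx.
have [i si] : exists i, s i != i.
  apply: contrapT => H; case/eqP: s1; apply/permP => i; rewrite perm1.
  by apply/eqP/negPn/negP => h; apply: H; exists i.
rewrite (bigD1 i) //= (bigD1 (s i)) //= [(-1) ^+ s * _]mulrCA; apply: dev_mul0.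
  by rewrite QE eq_sym (negPf si).
by rewrite evM evM QE eq_sym (inj_eq perm_inj) (negPf si) mul0r mulr0.
Qed.

End DerivativeDeterminant.

Section LinearMaps.
Variables (C : numClosedFieldType) (n : nat).
Local Notation M := ('M[C]_n.+1).
Implicit Types (f g : M -> M) (z : M).

Definition endo_mx f : 'M[C]_(n.+1 * n.+1) :=
  \matrix_(k, l) mxvec (f (vec_mx (delta_mx 0 k))) 0 l.

Lemma mul_endo_mx f z : linear f -> mxvec z *m endo_mx f = mxvec (f z).
Proof.
move=> fl; pose F := HB.pack_for {linear M -> M} f (GRing.isLinear.Build _ _ _ _ _ fl).
have -> : endo_mx f = lin_mx F.
  by apply/matrixP => k l; rewrite !mxE.
by rewrite mul_vec_lin.
Qed.

Lemma endo_mxP f (A : 'M[C]_(n.+1 * n.+1)) : (forall z, mxvec z *m A = mxvec (f z)) -> A = endo_mx f.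
Proof.
move=> H; apply/row_matrixP => k; apply/rowP => l; rewrite rowE -[delta_mx 0 k]vec_mxK H.
by rewrite !mxE.
Qed.

Lemma endo_mx_comp f g : linear f -> linear g ->
  endo_mx (fun z => g (f z)) = endo_mx f *m endo_mx g.
Proof. by move=> fl gl; apply/esym/endo_mxP => z; rewrite mulmxA !mul_endo_mx. Qed.

Lemma endo_mx_linear c f g : endo_mx (fun z => c *: f z + g z) = c *: endo_mx f + endo_mx g.
Proof.
apply/matrixP => k l; rewrite [LHS]mxE linearP /=.
by rewrite ![in LHS]mxE [RHS]mxE [in RHS]mxE /endo_mx ![in RHS]mxE.
Qed.

Lemma endo_mx_id : endo_mx id = 1%:M.
Proof. by apply/esym/endo_mxP => z; rewrite mulmx1. Qed.

Lemma endo_trace_comm f g : linear f -> linear g ->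
  \tr (endo_mx (fun z => g (f z))) = \tr (endo_mx (fun z => f (g z))).
Proof. by move=> fl gl; rewrite (endo_mx_comp fl gl) (endo_mx_comp gl fl) mxtrace_mulC. Qed.

End LinearMaps.

Lemma linear_projector (C : numClosedFieldType) (V : vectType C) (S : set V) : linear_set S ->
  exists pi : V -> V, [/\ linear pi, forall v, S (pi v) & forall v, S v -> pi v = v].
Proof.
move=> [S0 SL]; have [U US] := vspace_of_set S0 SL.
exists (projv U); split=> [c u v|v|v /US vU]; first exact: linearP.
  by apply/US; apply: memv_proj.
exact: projv_id.
Qed.

Section AdjointCharacter.
Context {R : realType} {G : affine_group R} {n : nat}.
Variable r : @linear_model R G n.
Local Notation C := R[i].
Local Notation M := ('M[C]_n.+1).
Local Notation lieg := (lieg r).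
Variables (U : set M) (pi : M -> M).
Hypotheses (piL : linear pi) (piU : forall z, U (pi z)) (pi_id : forall z, U z -> pi z = z).
Implicit Types (x y z : M) (g h : G) (X : set G).

Lemma piB u v : pi (u - v) = pi u - pi v.
Proof. by rewrite -[u - v]addrC -scaleN1r piL scaleN1r addrC. Qed.

(** For [x] normalizing [U], the trace of [z |-> [z, x]] on [U]: composing with the projector gives
    an operator on all matrices with the same trace. *)
Definition ad_trace x : C := \tr (endo_mx (fun z => bracket (pi z) x)).

Lemma linear_bracketl x : linear (fun z : M => bracket z x).
Proof. by move=> c z z'; rewrite bracketDl bracketZl. Qed.

Lemma linear_comp (f g : M -> M) : linear f -> linear g -> linear (fun z => g (f z)).
Proof. by move=> fl gl c u v; rewrite fl gl. Qed.

Lemma ad_traceP c x y : ad_trace (c *: x + y) = c * ad_trace x + ad_trace y.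
Proof.
rewrite /ad_trace -mxtraceZ -mxtraceD; congr (\tr _).
rewrite -endo_mx_linear; congr (endo_mx _); apply/funext => z.
by rewrite bracketDr bracketZr.
Qed.

(** [Ad g] on [U], extended by the identity on the kernel of [pi] so as to have the same
    determinant. *)
Definition ad_endo g z : M := Ad r g (pi z) + (z - pi z).

Lemma Ad_bracket g u v : Ad r g (bracket u v) = bracket (Ad r g u) (Ad r g v).
Proof. by rewrite /bracket AdB !AdM. Qed.

Lemma Ad_islinear g : linear (Ad r g). Proof. by move=> c u v; apply: Ad_linear. Qed.

Lemma ad_endo_linear g : linear (ad_endo g).
Proof.
move=> c z z'; rewrite /ad_endo piL Ad_linear scalerDr scalerBr opprD.
by rewrite [c *: z + z' + _]addrACA [LHS]addrACA.
Qed.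

Definition ad_det g : C := \det (endo_mx (ad_endo g)).

Lemma ad_detM g h : (forall z, U z -> U (Ad r g z)) ->
  ad_det (g * h)%g = ad_det g * ad_det h.
Proof.
move=> gU; rewrite /ad_det -det_mulmx -(endo_mx_comp (ad_endo_linear g) (ad_endo_linear h)).
congr (\det (endo_mx _)); apply/funext => z; rewrite /ad_endo.
have e : pi (Ad r g (pi z) + (z - pi z)) = Ad r g (pi z).
  rewrite -[Ad r g (pi z)]scale1r piL piB (pi_id (piU z)) subrr addr0 (pi_id (gU _ (piU z))).
  by [].
by rewrite e Ad_mul [Ad r g (pi z) + _]addrC addrK.
Qed.

Lemma ad_det_poly : exists p, [/\ forall g, ad_det g = ev p (r g), ev p 1 = 1 &
  forall X x, lieg X x -> dev p 1 x = ad_trace x].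
Proof.
have [W [WE dW]] := rho_inv_poly r.
pose b k : M := vec_mx (delta_mx 0 k).
pose A k := W *m cstx n.+1 (pi (b k)) *m idx C n.+1.
pose Q := \matrix_(k, l) (mxvec (A k) 0 l + (mxvec (b k - pi (b k)) 0 l)%:MP).
have AE k g : evx (A k) (r g) = Ad r g (pi (b k)).
  by rewrite evxM evxM evx_cst evx_id WE.
have QE g : map_mx (fun p => ev p (r g)) Q = endo_mx (ad_endo g).
  apply/matrixP => k l; rewrite [LHS]mxE [in LHS]mxE evD evC [RHS]mxE /ad_endo -/(b k).
  rewrite [mxvec (Ad _ _ _ + _)]linearD [RHS]mxE; congr (_ + _).
  by rewrite -AE /evx /= -map_mxvec [RHS]mxE.
have Q1 : map_mx (fun p => ev p 1) Q = 1%:M.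
  rewrite -(rho1 r) QE -endo_mx_id; congr endo_mx; apply/funext => z.
  by rewrite /ad_endo Ad1 addrC subrK.
exists (\det Q); split=> [g||X x Xx]; first by rewrite ev_det QE.
  by rewrite ev_det Q1 det1.
rewrite dev_det1 // /ad_trace; apply: eq_bigr => k _; rewrite [Q k k]mxE [RHS]mxE devDl devC addr0.
rewrite -/(b k); have <- : devx (A k) 1 x = bracket (pi (b k)) x.
  rewrite devxM devxM devx_cst devx_id evx_id evxM evx_cst (dW X) // -(rho1 r) WE invg1 rho1.
  by rewrite mulmx0 addr0 mul1mx mulmx1 mulNmx addrC.
by rewrite /devx -map_mxvec [RHS]mxE.
Qed.

(** Conjugation by [Ad g] replaces [pi] by another projector [q] onto [U], and the trace of an
    operator preserving [U] is the same for both. *)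
Lemma ad_trace_Ad g x : (forall z, U z -> U (Ad r g z)) ->
  (forall z, U z -> U (Ad r g^-1%g z)) -> (forall z, U z -> U (bracket z x)) ->
  ad_trace (Ad r g x) = ad_trace x.
Proof.
move=> gU gVU xU; have AL := Ad_islinear; have bL := linear_bracketl x.
pose q z := Ad r g^-1%g (pi (Ad r g z)).
have qL : linear q := linear_comp (linear_comp (AL g) piL) (AL g^-1%g).
have qU z : U (q z) by apply: gVU.
have q_id z : U z -> q z = z by move=> Uz; rewrite /q pi_id ?AdK //; apply: gU.
transitivity (\tr (endo_mx (fun z => bracket (q z) x))).
  have fL := linear_comp (linear_comp piL (AL g^-1%g)) bL.
  have := endo_trace_comm (AL g) fL; rewrite /= => ->.
  congr (\tr (endo_mx _)); apply/funext => z.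
  by rewrite Ad_bracket AdKV.
refine (etrans (endo_trace_comm qL bL) _).
transitivity (\tr (endo_mx (fun z => q (bracket (pi z) x)))); last first.
  congr (\tr (endo_mx _)); apply/funext => z; apply: q_id; exact: xU.
apply/esym; refine (etrans (endo_trace_comm piL (linear_comp bL qL)) _).
congr (\tr (endo_mx _)); apply/funext => z; exact: pi_id (qU _).
Qed.

End AdjointCharacter.

(** * Levi subgroups of proper parabolic subgroups *)

Lemma iter_bracketl (C : numClosedFieldType) n (z : 'M[C]_n.+1) T k w :
  (forall v, T v = bracket v z) -> iter k T w = (-1) ^+ k *: iter k (bracket z) w.
Proof.
move=> TE; elim: k => [|k IH]; first by rewrite expr0 scale1r.
by rewrite !iterS IH TE bracketZl bracketC exprS mulN1r scaleNr scalerN.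
Qed.

(** Inside the kernel of [ad e] the weights of [h] are natural numbers, so the eigenvalues of [z |->
    [z, h]] are opposites of these; all terms of the trace have one sign, and [e] contributes
    [-2]. *)
Lemma ad_trace_neq0 (R : realType) n (U : set 'M[R[i]]_n.+1) (pi : 'M[R[i]]_n.+1 -> 'M[R[i]]_n.+1)
    (e y h : 'M[R[i]]_n.+1) m :
  linear pi -> linear_set U -> (forall z, U (pi z)) -> (forall z, U z -> pi z = z) ->
  e ^+ m = 0 -> h = bracket e y -> bracket h e = 2%:R *: e -> U e -> e != 0 ->
  (forall u, U u -> bracket e u = 0) -> (forall u, U u -> U (bracket u h)) ->
  ad_trace pi h != 0.
Proof.
move=> piL LU piU pi_id em hE he Ue en eU hU; rewrite /ad_trace.
have lin : linear (fun z => bracket (pi z) h).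
  by move=> c u v; rewrite piL bracketDl bracketZl.
have LE z := mul_endo_mx z lin.
move: (endo_mx _) LE => L LE.
pose L' : 'M[R[i]]_((n + n * n.+1).+1) := L.
have trE : \tr L = \sum_(a <- eigs L') a * (\rank (sproj L' a))%:R.
  have := trace_smap L' (fun=> 1); rewrite smap1 mulr1 => ->.
  by apply: eq_bigr => a _; rewrite mulr1.
have mx0 : mxvec (0 : 'M[R[i]]_n.+1) = 0 by rewrite linear0.
have mxZ c (z : 'M[R[i]]_n.+1) : mxvec (c *: z) = c *: mxvec z by rewrite linearZ.
have nonpos a : a \in eigs L' -> exists j : nat, a = - j%:R.
  move=> /eigsP [v vL v0]; have [->|a0] := eqVneq a 0; first by exists 0%N; rewrite oppr0.
  have zE : bracket (pi (@vec_mx _ n.+1 n.+1 v)) h = a *: @vec_mx _ n.+1 n.+1 v.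
    have := LE (@vec_mx _ n.+1 n.+1 v); rewrite vec_mxK => H.
    by rewrite -[LHS]mxvecK -H [v *m L]vL linearZ.
  set z := vec_mx _ in zE.
  have Uz : U z.
    have -> : z = a^-1 *: (a *: z) by rewrite scalerA mulVf ?scale1r.
    by apply: linear_setZ => //; rewrite -zE; apply/hU/piU.
  rewrite pi_id // in zE.
  have z0 : z != 0.
    apply: contraNneq v0 => z0; rewrite -[v](@vec_mxK _ n.+1 n.+1) -/z z0.
    exact/eqP/mx0.
  have hz : bracket h z = (- a) *: z by rewrite bracketC zE scaleNr.
  by have [j jE] := jacobson_eigenvalue em hE he (eU z Uz) hz z0; exists j; rewrite -jE opprK.
have two : - 2%:R \in eigs L'.
  apply/eigsP; exists (mxvec e); last first.
    by apply: contraNneq en => e0; rewrite -[e]mxvecK e0 linear0.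
  by have := LE e; rewrite pi_id // bracketC he -scaleNr mxZ.
apply/eqP => tr0; have : \sum_(a <- eigs L') - a * (\rank (sproj L' a))%:R = 0.
  by under eq_bigr do rewrite mulNr; rewrite sumrN -trE tr0 oppr0.
move=> /eqP; rewrite big_seq psumr_eq0 => [|a /nonpos [j ->]]; last first.
  by rewrite opprK mulr_ge0 ?ler0n.
move=> /allP /(_ _ two); rewrite two opprK /= mulf_eq0 !pnatr_eq0 /= mxrank_eq0.
by rewrite (negPf (sproj_neq0 two)).
Qed.

Section Levi.
Context {R : realType} {G : affine_group R} {n : nat}.
Variable r : @linear_model R G n.
Hypothesis Gred : reductive G.
Local Notation C := R[i].
Local Notation M := ('M[C]_n.+1).
Local Notation lieg := (lieg r).
Local Notation gg := (lieg setT).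
Implicit Types (x y z w e h : M) (g : G) (P B H L U X : set G).

(** The radical [rr] of the form on [lieg L] consists of nilpotent elements, but it is normalized by
    [L] only; adding [lieg U] makes it stable under [P] and keeps it nilpotent. The unipotent normal
    subgroup obtained lies in [U], which meets [L] trivially. *)
Lemma levi_nondegenerate P L U x : subgroup P -> zclosed P -> closed_connected_subgroup L ->
  L `<=` P -> is_unipotent_radical P U -> L `&` U = [set 1%g] ->
  P = [set (l * u)%g | l in L & u in U] ->
  lieg L x -> (forall y, lieg L y -> \tr (x * y) = 0) -> x = 0.
Proof.
move=> sP cP [sL cL conL] LP [[[sU UP nU] [_ cU _] uU] maxU] LU PE Lx xo.
pose rr := perp r (lieg L) `&` lieg L.
have Lrr : linear_set rr.
  have [L1 L2] := (perp_linear r (lieg L), lieg_linear r L).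
  by split=> [|c u v [] ? ? [] ? ?]; split; [case: L1|case: L2|case: L1 => _; apply|case: L2 => _; apply].
have rrn z : rr z -> z ^+ n.+1 = 0 by move=> [[_ zo] Lz]; apply: lieg_perp_nilpotent zo.
have LieU := lieg_linear r U; have LieP := lieg_linear r P.
have UAd g y : P g -> lieg U y -> lieg U (Ad r g y).
  by move=> Pg; apply: lieg_Ad => h Uh; apply: nU.
have Un y : lieg U y -> y ^+ n.+1 = 0 by apply: lieg_unipotent.
have [m Um] := engel LieU (fun _ _ => lieg_closed_bracket sU) Un.
have UPb w z : lieg P w -> lieg U z -> lieg U (bracket w z).
  move=> Pw Uz; rewrite bracketC -scaleN1r; apply: (linear_setZ _ LieU).
  by apply: (lieg_bracket LieU _ Pw) => g Pg; apply: UAd.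
pose N := [set z | exists a b, [/\ rr a, lieg U b & z = b + a]].
have LN : linear_set N.
  split=> [|c _ _ [a [b [ra Ub ->]]] [a' [b' [ra' Ub' ->]]]].
    by exists 0, 0; split; [case: Lrr|case: LieU|rewrite addr0].
  exists (c *: a + a'), (c *: b + b'); split; [by case: Lrr => _; apply|by case: LieU => _; apply|].
  by rewrite scalerDr addrACA.
have rP a : rr a -> lieg P a by move=> [_]; apply: liegS.
have NP z : N z -> lieg P z.
  by move=> [a [b [ra Ub ->]]]; apply: (linear_setD LieP); [apply: liegS UP _|apply: rP].
have NAd g z : P g -> N z -> N (Ad r g z).
  move=> Pg [a [b [ra Ub ->]]]; rewrite -[b]scale1r Ad_linear scale1r.
  have Ub' := UAd g b Pg Ub; move: (Pg); rewrite PE => -[l Ll [u Uu guE]].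
  have ra' : rr (Ad r l a).
    by case: ra => pa La; split; [apply: perp_Ad|apply: lieg_Ad_stable].
  (* Elements of [U] act trivially on [lieg P] modulo [lieg U]. *)
  have Uc : lieg U (Ad r u (Ad r l a) - Ad r l a).
    apply: (lieg_commutator (X := P)); last exact: rP.
    move=> k Pk; have -> : (k^-1 * k ^ u = (u^-1) ^ k * u)%g by rewrite !conjgE !mulgA.
    by apply: (subgroupM sU) => //; apply: nU => //; exact: subgroupV.
  exists (Ad r l a), (Ad r g b + (Ad r u (Ad r l a) - Ad r l a)); split.
  - exact: ra'.
  - exact: (linear_setD LieU Ub' Uc).
  - by rewrite -addrA subrK -Ad_mul guE.
have Nn z : N z -> z ^+ n.+1 = 0.
  move=> [a [b [ra Ub ->]]]; have Pa := rP a ra.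
  have NL := nil_products_line LieU Um (fun y Uy => UPb a y Pa Uy) (rrn a ra).
  apply: (nilpotent_dim (k := (m * n.+1)%N)); apply: (nil_products_nil NL).
  by exists b, 1; rewrite scale1r.
have [K [nK cK _ uK expK]] := nilpotent_ideal_group sP cP LN NP NAd Nn.
have KU : K `<=` U by apply: maxU.
have rx : rr x by split=> //; split=> //; apply: liegS Lx.
apply: (expm_trivial (rrn x rx)) => t.
have [k Kk kE] := expK x t (ex_intro _ x (ex_intro _ 0 (And3 rx (proj1 LieU) (esym (add0r x))))).
have [l Ll lE] := expm_in_group t sL cL Lx (rrn x rx).
have kl : k = l by apply: (rho_inj (r := r)); rewrite kE lE.
have : (L `&` U) k by split; [rewrite kl|apply: KU].
by rewrite LU => k1; rewrite -kE k1 rho1.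
Qed.

Theorem levi_element P L : parabolic_subgroup P -> P <> setT -> levi_subgroup P L ->
  exists x, [/\ gg x, forall g, L g -> x * r g = r g * x & ~ forall g, x * r g = r g * x].
Proof.
move=> [sP cP [B BB BP]] PT [cL LP [UU [radU LU PE]]].
have [[cB solB] _] := BB; have [sB _ _] := cB; have [sL _ _] := cL.
have g0 z := reductive_trace_form (r := r) Gred (x := z).
have gL := lieg_linear r (setT : set G); have LB := lieg_linear r B.
pose U := perp r (lieg P); have LieU : linear_set U := perp_linear r (lieg P).
have Bperp z : perp r (lieg B) z -> lieg B z := @borel_perp _ _ _ r B z BB.
have Uperp z : U z -> perp r (lieg B) z.
  by move=> [gz zo]; split=> // y By; apply: zo; apply: liegS By.
have UB z : U z -> lieg B z by move=> /Uperp /Bperp.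
have pn z : perp r (lieg B) z -> z ^+ n.+1 = 0.
  by move=> pz; case: (pz) => _; apply: lieg_perp_nilpotent => //; apply: Bperp.
have UAd g z : P g -> U z -> U (Ad r g z) by apply: perp_Ad.
have PB z : lieg B z -> lieg P z by apply: liegS.
have Pg z : lieg P z -> gg z by apply: liegS.
have Ubr w z : U z -> lieg P w -> U (bracket z w).
  by move=> Uz Pw; apply: (lieg_bracket LieU _ Pw) => g Pg'; apply: UAd.
(* If [U] were [0], nondegeneracy would make [lieg P] equal to [gg], and then [P] equal to [G]. *)
have [e0 Ue0 ne0] : exists2 z, U z & z <> 0.
  apply: contrapT => nU; apply: PT; apply/seteqP; split=> //.
  apply: (closed_sub_of_lie (closed_connectedT Gred) sP cP (r := r)) => x gx.
  apply: (perp_perp gL g0 (lieg_linear r P)) => // y gy yo.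
  have [->|y0] := pselect (y = 0); first by rewrite mul0r mxtrace0.
  by case: nU; exists y.
have L0 : linear_set [set (0 : M)] by split=> // c u v -> ->; rewrite scaler0 addr0.
have [|||e [Ue ne He]] := lie_kolchin_Ad (r := r) (connected_irreducible cB) solB L0 LieU.
- by move=> g x _ ->; rewrite /Ad mulr0 mul0r.
- by move=> g x /BP; apply: UAd.
- by exists e0.
have ebr w : lieg B w -> exists c : C, bracket e w = c *: e.
  move=> Bw; apply: (lieg_bracket (S := [set z | exists c : C, z = c *: e]) _ _ Bw).
    split=> [|c _ _ [a ->] [b ->]]; first by exists 0; rewrite scale0r.
    by exists (c * a + b); rewrite scalerDl scalerA.
  by move=> g /He [c /= /eqP]; rewrite subr_eq0 => /eqP ->; exists c.
have en : e ^+ n.+1 = 0 by apply/pn/Uperp.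
have ge : gg e by apply/Pg/PB/UB.
(* [e] is an eigenvector of [ad z] with [z] nilpotent, so the eigenvalue is [0]. *)
have perp_e z : perp r (lieg B) z -> bracket e z = 0.
  move=> pz; have [c cE] := ebr z (Bperp z pz).
  have := nilpotent_bracket_eigen (pn z pz) (w := e) (c := - c).
  by rewrite bracketC cE scaleNr => /(_ erefl) /eqP; rewrite oppr_eq0 => /eqP.
have [y gy he] := jacobson_morozov gL (@gg_bracket _ _ _ r) g0 ge en.
set h := bracket e y in he.
have gh : gg h by apply: gg_bracket.
(* [h] is in the double orthogonal of [lieg B], because the trace of [[e, y] * z] is that of [y *
   [z, e]]. *)
have Bh : lieg B h.
  apply: (perp_perp gL g0 LB) => // [|z gz zo]; first by move=> z /PB /Pg.
  by rewrite mxtrace_mulC trace_bracket bracketC perp_e // oppr0 mulr0 mxtrace0.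
have [pi [piL piU pi_id]] := linear_projector LieU.
have tau_h : ad_trace pi h != 0.
  apply: (ad_trace_neq0 piL LieU piU pi_id en (erefl h) he Ue); first exact/eqP.
    by move=> u /Uperp; apply: perp_e.
  by move=> u Uu; apply: Ubr => //; apply: PB.
have tauAd g z : L g -> lieg L z -> ad_trace pi (Ad r g z) = ad_trace pi z.
  move=> /LP Pg' Lz; apply: (ad_trace_Ad piL piU pi_id) => u; first exact: UAd.
    by apply: UAd; apply: subgroupV.
  by move=> Uu; apply: Ubr => //; apply: liegS LP _.
have Lnd z : lieg L z -> (forall y, lieg L y -> \tr (z * y) = 0) -> z = 0.
  exact: levi_nondegenerate sP cP cL LP radU LU PE.
have tl : linear (ad_trace pi : M -> C^o) by move=> c u v; apply: ad_traceP.
have [x Lx xE] := riesz (lieg_linear r L) Lnd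
  (HB.pack_for {linear M -> C^o} (ad_trace pi : M -> C^o) (GRing.isLinear.Build _ _ _ _ _ tl)).
rewrite /= in xE.
exists x; split; first by apply: liegS Lx.
  move=> g Lg; apply/Ad_fixP; apply/eqP; rewrite -subr_eq0; apply/eqP.
  have LAx : lieg L (Ad r g x) by apply: lieg_Ad_stable.
  apply: Lnd; first exact: (linear_setB (lieg_linear r L)).
  move=> z Lz; have LVz : lieg L (Ad r g^-1%g z) by apply: lieg_Ad_stable => //; apply: subgroupV.
  rewrite mulrBl raddfB /= -{1}[z](AdKV r g) Ad_trace -!xE //.
  by rewrite -(tauAd g) // AdKV subrr.
move=> xc.
have comm z : (forall g, z * r g = r g * z) -> ad_trace pi z = 0.
  move=> zc; rewrite /ad_trace (_ : (fun u => _) = fun=> 0).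
    rewrite -[RHS](mxtrace0 C (n.+1 * n.+1)); congr (\tr _); apply/matrixP => k l.
    by rewrite !mxE linear0 mxE.
  apply/funext => u; rewrite bracketC.
  have gu : gg (pi u) by case: (piU u).
  by rewrite (commutes_gg (P := setT) (r := r) (fun g _ => zc g)) ?oppr0.
(* The conjugate replica of a central [x] is central, so [ad_trace] vanishes on it; the sum of the
   squared moduli of the eigenvalues of [x] is therefore [0]. *)
have xn : x ^+ n.+1 = 0.
  apply: trace_conj_nilpotent; rewrite -xE; last first.
    by apply: lieg_smap => // a b; rewrite rmorphD.
  apply: comm => g; have SA := @subalgebra_commutant C n [set r g].
  suff : [set y | forall z, [set r g] z -> y * z = z * y] (smap Num.conj x).
    by move=> /(_ (r g) erefl).
  by apply: (subalgebra_smap _ SA) => _ ->; apply: xc.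
have tauL z : lieg L z -> ad_trace pi z = 0.
  move=> Lz; rewrite xE //; apply: (@nilpotent_trace _ _ _ n.+1).
  have gz : gg z by apply: liegS Lz.
  have xz : x * z = z * x.
    by apply/eqP; rewrite -subr_eq0; apply/eqP; apply: (commutes_gg (P := setT) (r := r) (fun g _ => xc g)).
  by rewrite exprMn_comm // xn mul0r.
have [[[sUU UUP nUU] cUU uUU] _] := radU; have [_ cUc _] := cUU.
have tauU z : lieg UU z -> ad_trace pi z = 0.
  move=> Uz; have zn := lieg_unipotent sUU cUc uUU Uz.
  have lin : linear (fun u => bracket (pi u) z).
    by move=> c u v; rewrite piL bracketDl bracketZl.
  have Pz : lieg P z by apply: liegS Uz.
  rewrite /ad_trace; have LE u := mul_endo_mx u lin.
  move: (endo_mx _) LE => A LE; pose A' : 'M[C]_((n + n * n.+1).+1) := A.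
  have [T TzE] : exists T : M -> M, forall w, T w = bracket w z by exists (fun w => bracket w z).
  have UT w k : U w -> U (iter k T w).
    move=> Uw; elim: k => [|k IH]; first exact: Uw.
    by rewrite iterS TzE; exact: (Ubr z _ IH Pz).
  have TE w k := iter_bracketl k w TzE.
  have AE k (u : M) : (mxvec u : 'rV[C]_((n + n * n.+1).+1)) *m (A' ^+ k.+1) =
      mxvec (iter k.+1 T (pi u)).
    elim: k => [|k IH]; first by rewrite expr1 /= TzE; apply: LE.
    have := LE (iter k.+1 T (pi u)); rewrite (pi_id _ (UT _ k.+1 (piU u))) -TzE -iterS => <-.
    by rewrite exprSr -IH -[_ * A']/(_ *m A') mulmxA.
  apply: (@nilpotent_trace _ _ A' (n.+1 + n.+1).+1); apply/row_matrixP => k.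
  rewrite rowE row0; have := AE (n.+1 + n.+1)%N (@vec_mx _ n.+1 n.+1 (delta_mx 0 k)).
  rewrite vec_mxK TE iterS (iter_bracket_nil _ zn) bracket0r scaler0 linear0.
  exact.
have [p [pE p1 dp]] := ad_det_poly r pi.
have triv X : closed_connected_subgroup X -> X `<=` P -> (forall z, lieg X z -> ad_trace pi z = 0) ->
    forall g, X g -> ev p (r g) = 1.
  move=> cX XP tauX; apply: (trivial_character cX) => // [g k Xg _|z Xz]; last by rewrite (dp X) // tauX.
  by rewrite -!pE; apply: (ad_detM piL piU pi_id) => u; apply: UAd; apply: XP.
(* The determinant [p] is [1] on [L] and on the unipotent radical, hence on [P]; its differential
   vanishes at [h], which lies in [lieg P]. *)
case/eqP: tau_h; have <- : dev p 1 h = ad_trace pi h := dp P h (PB h Bh).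
have : dev (p - 1%:MP) 1 h = 0.
  apply: (PB h Bh) => _ [g Pg' <-]; rewrite evB evC -pE.
  move: Pg'; rewrite PE => -[l Ll [u Uu <-]].
  rewrite (ad_detM piL piU pi_id); last by move=> w; apply: UAd; apply: LP.
  by rewrite !pE (triv L) ?(triv UU) // mulr1 subrr.
by rewrite devB devC subr0 => ->.
Qed.

End Levi.

(** * Dimensions *)

(* The notations of constructive_ereal clash with those of mpoly. *)
Import -(notations) constructive_ereal.

Section Chains.
Context {R : realType} {G : affine_group R}.
Implicit Types (X Y Z H : set G) (g : G).

Definition chain X (n : nat) := exists Z : nat -> set G,
  (forall i, (i <= n)%N -> [/\ zclosed (Z i), zirreducible (Z i) & Z i `<=` X]) /\
  (forall i, (i < n)%N -> Z i `<` Z i.+1).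

Lemma chain_sub X Y n : X `<=` Y -> chain X n -> chain Y n.
Proof.
move=> XY [Z [ZX Zlt]]; exists Z; split=> // i /ZX [cZ iZ ZiX]; split=> //.
exact: subset_trans XY.
Qed.

Lemma chain_bound X n : chain X n -> (n <= ambient G)%N.
Proof. by move=> [Z [ZX Zlt]]; apply: (krull_bound (Z := Z)) => // i /ZX []. Qed.

Lemma chain0 X : zclosed X -> zirreducible X -> chain X 0.
Proof. by move=> cX iX; exists (fun=> X); split=> [i _|i]; [split|rewrite ltn0]. Qed.

Lemma chainS X Y n : zclosed Y -> zirreducible Y -> X `<` Y -> zclosed X -> 
  chain X n -> chain Y n.+1.
Proof.
move=> cY iY [XY nYX] cX [Z [ZX Zlt]]; exists (fun i => if (i <= n)%N then Z i else Y).
split=> [i _|i].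
  by case: ifP => [/ZX [cZ iZ ZiX]|_]; split=> //; apply: subset_trans XY.
move=> iSn; have [lin|nin] := ltnP i n; first by rewrite /= ltnW //; apply: Zlt.
have -> : i = n by apply/eqP; rewrite eqn_leq nin andbT -ltnS.
rewrite /= leqnn; have [_ _ ZnX] := ZX n (leqnn n).
by split=> [|YZ]; [apply: subset_trans XY|apply: nYX; apply: subset_trans ZnX].
Qed.

(** Translation by a point of the smallest member makes all members irreducible sets through [1],
    which lie in the component. *)
Lemma chain_component X X0 n : subgroup X -> is_component X X0 -> chain X n -> chain X0 n.
Proof.
move=> sX [_ _ _ _ [irrX _ _]] [Z [ZX Zlt]].
have [_ [[z Zz] _] ZX0] := ZX 0%N isT; have Xz := ZX0 z Zz.
have Z0 i : (i <= n)%N -> Z i z.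
  elim: i => [|i IH] // lin; have [H _] := Zlt i lin; apply: H; apply: IH; exact: ltnW.
exists (fun i => [set y | Z i (z * y)%g]); split=> i lin; last first.
  have [H1 H2] := Zlt i lin; split=> [y|H] /=; first exact: H1.
  by apply: H2 => y Zy; have := H (z^-1 * y)%g; rewrite /= mulVKg; apply.
have [cZ iZ ZiX] := ZX i lin.
have iZ' : zirreducible [set y | Z i (z * y)%g].
  have -> : [set y | Z i (z * y)%g] = (fun y => z^-1 * y)%g @` Z i.
    apply/seteqP; split=> [y Zy|_ [y Zy <-]] /=; last by rewrite mulVKg.
    by exists (z * y)%g => //; rewrite mulKg.
  by apply: zirreducible_image => //; apply: regmapM; [apply: regmapC|apply: regmap_id].
split=> //; first exact: zclosed_mull.
apply: irrX => //; first by rewrite /= mulg1; apply: Z0.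
move=> y /ZiX Xzy; rewrite -[y](mulKg z); apply: subgroupM => //; exact: subgroupV.
Qed.

Lemma krull_dim_eq X Y : (forall n, chain X n <-> chain Y n) -> krull_dim X = krull_dim Y.
Proof.
move=> H; rewrite /krull_dim; congr (ereal.ereal_sup _); apply/seteqP.
by split=> _ [n /= cn <-]; exists n => //; apply/H.
Qed.

(** If all chains of [Y] were shorter than [n], the supremum for [Y] would be at most [n - 1], while
    that for [X] is at least [n]. *)
Lemma krull_dim_chain X Y n : krull_dim X = krull_dim Y -> chain X n ->
  exists2 m, chain Y m & (n <= m)%N.
Proof.
move=> dimXY cn; apply: contrapT => H.
have ltn' m : chain Y m -> (m < n)%N.
  by move=> cm; rewrite ltnNge; apply/negP => h; apply: H; exists m.
have n0 : (0 < n)%N \/ n = 0%N by case: (n) => [|k]; [right|left].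
have le1 : (EFin (n%:R : R) <= krull_dim X)%O.
  by apply: ereal.ereal_sup_ubound; exists n.
have le2 : (krull_dim Y <= EFin (n%:R - 1 : R))%O.
  apply: ereal.ge_ereal_sup => _ [m /ltn' mn <-].
  by rewrite lee_fin lerBrDr natr1 ler_nat.
have := le_trans le1 _; rewrite dimXY => /(_ _ le2).
by rewrite lee_fin lerBrDr natr1 ler_nat ltnn.
Qed.

Lemma centralizer_group H : subgroup (centralizer H).
Proof.
split=> [h Hh|x y Cx Cy h Hh]; first by rewrite /commute mul1g mulg1.
have /(_ h Hh) xh := Cx; have /(_ h Hh) yh := Cy.
rewrite /commute -[(x / y * h)%g]mulgA.
have -> : (y^-1 * h = h * y^-1)%g.
  by apply: (mulgI y); rewrite mulVKg mulgA yh mulgK.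
by rewrite mulgA xh mulgA.
Qed.

Lemma centralizer_closed H : zclosed (centralizer H).
Proof.
have -> : centralizer H = [set g | forall h : {h | H h}, (sval h ^ g)%g = sval h].
  apply/seteqP; split=> g Hg.
    by case=> h Hh /=; rewrite conjgE -(Hg h Hh) mulKg.
  move=> h Hh; have := Hg (exist _ h Hh) => /= e.
  by rewrite /commute -{1}e conjgE mulVKg.
apply: zclosed_bigcap => h; apply: (zclosed_preim (A := [set sval h])).
  by apply: regmapJ; [apply: regmapC|apply: regmap_id].
exact: zclosed_set1.
Qed.

End Chains.

(** * Comparison of the centralizer with the center *)

Section Main.
Context {R : realType} {G : affine_group R} {n : nat}.
Variable r : @linear_model R G n.
Hypothesis Gred : reductive G.
Local Notation M := ('M[R[i]]_n.+1).
Local Notation lieg := (lieg r).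
Implicit Types (H A X : set G) (x : M) (g h : G).

Lemma lieg_centralizer H X x : X `<=` centralizer H -> lieg X x ->
  forall g, H g -> x * r g = r g * x.
Proof.
move=> XC Xx g Hg; have [LA _ _] := @subalgebra_commutant R[i] n [set r g].
apply: (lieg_sub LA _ Xx) (erefl (r g)) => h Xh _ ->.
by rewrite -!rhoM (XC h Xh g Hg).
Qed.

(** The commutant of [H] is an associative subalgebra, to which [lieg_subalgebra] applies. *)
Lemma centralizer_lieg H x : lieg setT x -> (forall g, H g -> x * r g = r g * x) ->
  lieg (centralizer H) x.
Proof.
move=> gx xH; have SA := @subalgebra_commutant R[i] n (r @` H).
have := lieg_subalgebra (groupT (G := G)) (@zclosedT R G) SA gx.
move=> /(_ _)/(liegS _); apply; last by move=> _ [g Hg <-]; apply: xH.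
move=> g [_ Sg] h Hh; apply: (rho_inj (r := r)); rewrite !rhoM.
by apply: Sg; exists h.
Qed.

Lemma irreducible_center H A : irreducible_subgroup H -> is_component (centralizer H) A ->
  A `<=` center G.
Proof.
move=> irrH CA; have [AC _ _ _ _] := CA; have cA := component_connected CA.
have SA := @subalgebra_commutant R[i] n (r @` setT).
move=> g Ag h _; apply: (rho_inj (r := r)); rewrite !rhoM.
apply: (rho_subalgebra (r := r) cA SA _ Ag); last by exists h.
move=> x Ax _ [k _ <-]; apply: (irreducible_commutant Gred irrH).
  by apply: liegS Ax.
exact: lieg_centralizer AC Ax.
Qed.

Lemma center_irreducible H : completely_reducible H ->
  krull_dim (centralizer H) = krull_dim (center G) -> irreducible_subgroup H.
Proof.
move=> [sH crH] dimE; split=> // P PP HP; apply: contrapT => PT.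
have [L LL HL] := crH P PP HP.
have [x [gx xL nx]] := levi_element r Gred PP PT LL.
have [sC cC] := (centralizer_group H, centralizer_closed H).
have [sZ cZ] := (centralizer_group (setT : set G), centralizer_closed (setT : set G)).
have [A CA] := component_exists sC cC; have [A0 ZA0] := component_exists sZ cZ.
have [AC sA cA iA [irrA _ _]] := CA; have [A0Z sA0 cA0 iA0 _] := ZA0.
have ZC : center G `<=` centralizer H by move=> g Zg h _; apply: Zg.
have A0A : A0 `<=` A.
  by apply: irrA => //; [apply: subgroup1|apply: subset_trans ZC].
(* Otherwise [x], which lies in the Lie algebra of [A], would commute with all of [G]. *)
have nAA0 : ~ A `<=` A0.
  move=> AA0; apply: nx => g.
  apply: (@lieg_centralizer setT A0 x A0Z) => //.
  apply: (liegS AA0); apply: (lieg_component sC cC CA).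
  by apply: centralizer_lieg => // h /HL; apply: xL.
have exC : exists k, `[< chain (center G) k >].
  by exists 0%N; apply/asboolP; apply: (chain_sub A0Z); apply: chain0.
have bound k : `[< chain (center G) k >] -> (k <= ambient G)%N by move=> /asboolP /chain_bound.
(* A longest chain of the center is translated into [A0], and adding [A] on top makes it longer than
   any chain of the center. *)
have [d /asboolP dC dmax] := ex_maxnP exC bound.
have cd : chain (centralizer H) d.+1.
  apply: (chain_sub AC); apply: (chainS cA iA (conj A0A nAA0) cA0).
  exact: chain_component ZA0 dC.
have [m cm] := krull_dim_chain dimE cd.
by rewrite ltnNge dmax //; apply/asboolP.
Qed.

End Main.

Theorem corollary17 (R : realType) (G : affine_group R) (H : set G) :
  reductive G -> completely_reducible H ->
  (irreducible_subgroup H <->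
   krull_dim (centralizer H) = krull_dim (center G)).
Proof.
move=> Gred crH; have [n [r]] := @linear_model_exists R G.
split; last exact: (center_irreducible r Gred crH).
move=> irrH; apply: krull_dim_eq => k.
have [sC cC] := (centralizer_group H, centralizer_closed H).
have [A CA] := component_exists sC cC.
split=> ck; last first.
  by apply: chain_sub ck => g Zg h _; apply: Zg.
(* Up to translation a chain of the centralizer lies in its identity component, which is central. *)
apply: (chain_sub (irreducible_center r Gred irrH CA)).
exact: chain_component CA ck.
Qed.
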